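(* Let $\mathcal G$ be a connected noncompact metric graph satisfying Assumption (H), and consider the critical energy ($p=6$). Then $\mu_{\mathcal G}=\mu_{\mathbb R}$, and $\mathcal E_{\mathcal G}(\mu_{\mathbb R})=0$, this value being attained if and only if $\mathcal G$ is $\mathbb R$ or a bubble tower.
   Context: Metric graphs have finitely many edges and vertices, bounded edges identified with $[0,\ell_e]$ and halflines with $[0,\infty)$ (far endpoints: vertices at infinity); noncompact means at least one halfline. A trail is a path of adjacent edges traversing each edge exactly once. Assumption (H): every point of $\mathcal G$ lies on a trail containing two halflines (equivalently, after identifying all vertices at infinity, $\mathcal G$ admits a covering by cycles). A bubble tower is a graph obtained from $\mathbb R$ by identifying finitely many pairs of opposite points $x_j\sim-x_j$. $H^1_\mu(\mathcal G)$: continuous functions, $H^1$ on each edge, $\|u\|_2^2=\mu$. $E(u,\mathcal G)=\frac12\int|u'|^2-\frac16\int|u|^6$, $\mathcal E_{\mathcal G}(\mu)=\inf_{H^1_\mu(\mathcal G)}E(\cdot,\mathcal G)$. For a graph $X$, $K_X=\sup_{u\in H^1(X),u\ne0}\frac{\|u\|_6^6}{\|u\|_2^4\|u'\|_2^2}$ and $\mu_X=\sqrt{3/K_X}$; $\mu_{\mathbb R}=\pi\sqrt3/2$. *)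

(* Defs.v *)
From HB Require Import structures.
From mathcomp Require Import all_boot all_order all_algebra.
From mathcomp Require Import all_classical all_reals all_analysis.
Set Implicit Arguments. Unset Strict Implicit. Unset Printing Implicit Defensive.
Import Order.TTheory GRing.Theory Num.Theory.
Local Open Scope classical_set_scope.
Local Open Scope ring_scope.

(* ---------- Metric graphs ----------
   Finitely many vertices 'I_nV and edges 'I_nE.  Edge e starts at vertex
   [ghd e]; if [gtl e = Some w] it is a bounded edge [0, glen e] ending at w,
   if [gtl e = None] it is a halfline [0, +oo) (far end = vertex at infinity).
   Loops and multiple edges are allowed. *)
Record mgraph (R : realType) := MGraph {
  nV : nat;
  nE : nat;
  ghd : 'I_nE -> 'I_nV;
  gtl : 'I_nE -> option 'I_nV;
  glen : 'I_nE -> R;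
  glen_gt0 : forall e, 0 < glen e }.
Arguments nV {R} _.
Arguments nE {R} _.
Arguments ghd {R} _ _.
Arguments gtl {R} _ _.
Arguments glen {R} _ _.

Section Graphs.
Variable R : realType.
Implicit Types G : mgraph R.

Definition Rline : mgraph R :=
  @MGraph R 1 2 (fun _ => ord0) (fun _ => None) (fun _ => 1) (fun _ => ltr01).

Definition noncompact G : Prop := exists e, gtl G e = None.

Definition gpoint G := ('I_(nE G) * R)%type.

Definition in_dom G (p : gpoint G) : bool :=
  (0 <= p.2) && (if gtl G p.1 is Some _ then p.2 <= glen G p.1 else true).

Definition vtx_of G (p : gpoint G) : option 'I_(nV G) :=
  if p.2 == 0 then Some (ghd G p.1)
  else match gtl G p.1 with
       | Some w => if p.2 == glen G p.1 then Some w else None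
       | None => None end.

Definition same_pt G (p q : gpoint G) : bool :=
  (p == q) || ((vtx_of p != None) && (vtx_of p == vtx_of q)).

Definition gchain G (p q : gpoint G) (c0 : gpoint G * gpoint G)
  (cs : seq (gpoint G * gpoint G)) : Prop :=
  c0.1 = p /\ (last c0 cs).2 = q /\
  all (fun c => (c.1.1 == c.2.1) && in_dom c.1 && in_dom c.2) (c0 :: cs) /\
  path (fun a b => same_pt a.2 b.1) c0 cs.

Definition gcost G (cs : seq (gpoint G * gpoint G)) : R :=
  \sum_(c <- cs) `|c.1.2 - c.2.2|.

Definition gdist G (p q : gpoint G) : R :=
  inf [set r | exists c0 cs, gchain p q c0 cs /\ r = gcost (c0 :: cs)].

Definition gconnected G : Prop :=
  forall p q : gpoint G, in_dom p -> in_dom q -> exists c0 cs, gchain p q c0 cs.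

(* a step traverses edge e forwards (true) or backwards (false);
   its (entry, exit) vertices, None = vertex at infinity *)
Definition step_ends G (s : 'I_(nE G) * bool) : option 'I_(nV G) * option 'I_(nV G) :=
  if s.2 then (Some (ghd G s.1), gtl G s.1) else (gtl G s.1, Some (ghd G s.1)).

Definition trail2 G (s0 : 'I_(nE G) * bool) (ss : seq ('I_(nE G) * bool)) : bool :=
  [&& path (fun a b => ((step_ends a).2 == (step_ends b).1) && ((step_ends a).2 != None)) s0 ss,
      uniq (map fst (s0 :: ss)),
      (step_ends s0).1 == None &
      (step_ends (last s0 ss)).2 == None].

Definition on_trail G (p : gpoint G) s0 ss : Prop :=
  p.1 \in map fst (s0 :: ss) \/
  exists v, vtx_of p = Some v /\
    has (fun s => ((step_ends s).1 == Some v) || ((step_ends s).2 == Some v)) (s0 :: ss).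

Definition assumptionH G : Prop :=
  forall p : gpoint G, in_dom p -> exists s0 ss, trail2 s0 ss /\ on_trail p s0 ss.

Definition edom G (e : 'I_(nE G)) : set R :=
  if gtl G e is Some _ then `[0, glen G e] else `[0, +oo[.

Definition Leb := (@lebesgue_measure R).

(* u : function on the graph (edgewise), g : its (weak) derivative.
   H1 G u g: u, g in L^2 of each edge, u absolutely continuous on each edge
   with derivative g, and u continuous at the vertices. *)
Definition H1 G (u g : 'I_(nE G) -> R -> R) : Prop :=
  (forall e, Leb.-integrable (edom e) (fun x => ((u e x) ^+ 2)%:E)) /\
  (forall e, Leb.-integrable (edom e) (fun x => ((g e x) ^+ 2)%:E)) /\
  (forall e x, edom e x ->
     Leb.-integrable `[0, x] (fun t => (g e t)%:E) /\
     u e x = u e 0 + fine (\int[Leb]_(t in `[0, x]) (g e t)%:E)) /\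
  (exists phi : 'I_(nV G) -> R, forall e,
     u e 0 = phi (ghd G e) /\ forall w, gtl G e = Some w -> u e (glen G e) = phi w).

Definition normk G (k : nat) (f : 'I_(nE G) -> R -> R) : R :=
  \sum_(e < nE G) fine (\int[Leb]_(x in edom e) (`|f e x| ^+ k)%:E).

Definition energy G (u g : 'I_(nE G) -> R -> R) : R :=
  2^-1 * normk 2 g - 6^-1 * normk 6 u.

Definition Elevel G (m : R) : \bar R :=
  ereal_inf [set y | exists u g : 'I_(nE G) -> R -> R, H1 u g /\ normk 2 u = m /\ y = (energy u g)%:E].

Definition attained G (m : R) : Prop :=
  exists u g : 'I_(nE G) -> R -> R, H1 u g /\ normk 2 u = m /\ (energy u g)%:E = Elevel G m.

(* K_X and mu_X = sqrt(3 / K_X) (with 3/+oo read as 0) *)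
Definition Kconst G : \bar R :=
  ereal_sup [set y | exists u g : 'I_(nE G) -> R -> R, H1 u g /\ 0 < normk 2 u /\
     y = (normk 6 u / (normk 2 u ^+ 2 * normk 2 g))%:E].

Definition mucrit G : R := Num.sqrt (3 / fine (Kconst G)).

(* the quotient pseudo-distance on R obtained by identifying x ~ -x, x in xs *)
Definition glued (xs : seq R) (a b : R) : bool :=
  (a == b) || has (fun x => ((a == x) && (b == - x)) || ((a == - x) && (b == x))) xs.

Definition glue_dist (xs : seq R) (s t : R) : R :=
  inf [set r | exists c0 cs, c0.1 = s /\ (last c0 cs).2 = t /\
        path (fun a b => glued xs a.2 b.1) c0 cs /\
        r = \sum_(c <- c0 :: cs) `|c.1 - c.2|].

(* G is isometric (as a metric space, points identified at distance 0)
   to the pseudometric space (R, d) *)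
Definition isometric_to G (d : R -> R -> R) : Prop :=
  exists f : gpoint G -> R,
    (forall p q, in_dom p -> in_dom q -> d (f p) (f q) = gdist p q) /\
    (forall t, exists p, in_dom p /\ d (f p) t = 0).

Definition is_R G : Prop := isometric_to G (fun s t => `|s - t|).

Definition is_bubble_tower G : Prop :=
  exists xs : seq R, [/\ xs != [::], uniq xs, all (fun x => 0 < x) xs &
                        isometric_to G (glue_dist xs)].

End Graphs.

(* Main.v *)
(* Let M be the maximum of |u|, m the mass of u and c = pi / m.  Expanding
   the square in 0 <= \int_G (2 |u'| - c |u| sqrt (M ^ 4 - u ^ 4)) ^ 2, the
   cross term is controlled from below along a trail through a point where |u| = M:
   a primitive of s sqrt (M ^ 4 - s ^ 4), taken at |u|, climbs from 0 to its value at M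
   and comes back to 0, along edges used only once.  This is the sharp inequality
   pi ^ 2 |u|_6 ^ 6 <= 4 |u|_2 ^ 4 |u'|_2 ^ 2, whose constant is approached on
   any graph with a halfline by truncated solitons sech (x - T) ^ (1/2).

   In the equality case the square vanishes almost everywhere, so
   arcosh (M ^ 2 / u ^ 2) is a Lipschitz function vanishing at the maximum point.
   Laying the trail isometrically along the line, u ^ 2 therefore dominates a soliton
   of the position, which already carries the whole mass: the trail covers G, and u ^ 2
   equals the soliton.  Since the soliton is even and decreasing away from its maximum,
   the trail can meet itself only at opposite positions, and G is the line or a
   bubble tower.  Conversely, the soliton composed with the isometry from such
   a graph to the glued line has the norms of the soliton, because the isometry is
   piecewise isometric on the edges. *)
Require Import Defs.
From HB Require Import structures.
From mathcomp Require Import all_boot all_order all_algebra.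
From mathcomp Require Import all_classical all_reals all_analysis.
From mathcomp Require Import measurable_realfun.
From mathcomp Require Import ring lra.
Set Implicit Arguments. Unset Strict Implicit. Unset Printing Implicit Defensive.
Import Order.TTheory GRing.Theory Num.Theory.
Import numFieldNormedType.Exports.
Local Open Scope classical_set_scope.
Local Open Scope ring_scope.

(** * Primitives of integrable functions *)

Section RealAnalysis.
Context {R : realType}.
Notation mu := (@lebesgue_measure R).
Implicit Types (a b c x y z C : R) (f g h : R -> R) (D : set (measurableTypeR R)).

Lemma itv_local_to_global (P : R -> R -> Prop) a b : a <= b ->
  (forall x y z, a <= x -> x <= y -> y <= z -> z <= b -> P x y -> P y z -> P x z) ->
  (forall x, a <= x <= b -> exists2 d, 0 < d & forall y z, a <= y -> y <= x ->
     x <= z -> z <= b -> x - d < y -> z < x + d -> P y z) ->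
  P a b.
Proof.
move=> ab Ptrans Ploc.
pose S := [set x | a <= x <= b /\ P a x].
have Sb : ubound S b by move=> x [/andP[]].
have Sa : S a.
  have [|d d0 Pd] := Ploc a; first by rewrite lexx.
  by split; [rewrite lexx|apply: Pd => //; lra].
have as_ : a <= sup S by apply: ub_le_sup => //; exists b.
have sb : sup S <= b by apply: ge_sup => //; exists a.
have [|d d0 Pd] := Ploc (sup S); first by rewrite as_.
have [x [/andP[ax xb] Pax] dx] := sup_adherent d0 (conj (ex_intro _ a Sa) (ex_intro _ b Sb)).
have xs : x <= sup S by apply: ub_le_sup; [exists b|split; rewrite ?ax].
pose t := Num.min b (sup S + d / 2).
have st : sup S <= t by rewrite le_min sb/=; lra.
have tb : t <= b by rewrite ge_min lexx.
have Pat : P a t.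
  apply: (Ptrans a x t) => //; first exact: le_trans st.
  by apply: Pd => //; rewrite gt_min; apply/orP; right; lra.
have : t <= sup S.
  by apply: ub_le_sup; [exists b|split; rewrite ?tb ?andbT//; exact: le_trans st].
rewrite ge_min => /orP[bs|]; last by lra.
by rewrite (_ : b = t)//; apply/eqP; rewrite eq_le ge_min lexx le_min lexx andbT; lra.
Qed.

Lemma continuous_fun_comp f g : continuous f -> continuous g -> continuous (fun x => g (f x)).
Proof. by move=> cf cg x; apply: (@continuous_comp _ _ _ f g); [exact: cf|exact: cg]. Qed.

Lemma continuous_funX f n : continuous f -> continuous (fun x => f x ^+ n).
Proof. by move=> cf; exact: (continuous_fun_comp cf (@exprn_continuous _ n)). Qed.

Lemma continuous_affine a b : continuous (fun x : R => a * x + b).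
Proof. by move=> x; apply: cvgD; [exact: mulrl_continuous|exact: cvg_cst]. Qed.

Lemma within_itv_continuousP a b f : {within `[a, b], continuous f} <->
  forall x e, a <= x <= b -> 0 < e ->
  exists2 d, 0 < d & forall y, a <= y <= b -> `|y - x| < d -> `|f y - f x| < e.
Proof.
split=> [|H].
  move=> /subspace_continuousP cu x e xab e0.
  have /cvgrPdist_lt/(_ e e0) : f @ within `[a, b] (nbhs x) --> f x.
    by apply: cu; rewrite /= in_itv.
  rewrite near_withinE => -[d /= d0 hd]; exists d => // y yab yxd.
  rewrite distrC; apply: hd; last by rewrite /= in_itv.
  by rewrite /ball_/= distrC.
apply/subspace_continuousP => x /=; rewrite in_itv/= => xab.
apply/cvgrPdist_lt => e e0; rewrite near_withinE.
have [d d0 hd] := H x e xab e0; exists d => // y /=; rewrite /ball_/= => yx.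
by rewrite in_itv/= => yab; rewrite distrC; apply: hd => //; rewrite distrC.
Qed.

Lemma within_continuous_bounded a b f : a <= b -> {within `[a, b], continuous f} ->
  exists C, forall x, a <= x <= b -> `|f x| <= C.
Proof.
move=> ab cf.
have cnf : {within `[a, b], continuous (fun x => `|f x|)}.
  by move=> x; apply: cvg_norm; exact: cf.
have [c _ hc] := EVT_max ab cnf.
by exists `|f c| => x xab; apply: hc; rewrite in_itv.
Qed.

Lemma integrable_funZl D C f : measurable D -> mu.-integrable D (EFin \o f) ->
  mu.-integrable D (EFin \o (fun x => C * f x)).
Proof. by move=> mD; exact: (integrableZl mD C). Qed.

Lemma integrable_funD D f g : measurable D ->
  mu.-integrable D (EFin \o f) -> mu.-integrable D (EFin \o g) ->
  mu.-integrable D (EFin \o (fun x => f x + g x)).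
Proof. by move=> mD; exact: (integrableD mD). Qed.

Lemma integrable_funM D C f g : measurable D -> measurable_fun D f ->
  (forall x, D x -> `|f x| <= C) -> mu.-integrable D (EFin \o g) ->
  mu.-integrable D (EFin \o (fun x => f x * g x)).
Proof.
move=> mD mf fC; apply: (integrableMr mD mf); exists C; split; first exact: num_real.
by move=> B CB x Dx; exact: le_trans (fC x Dx) (ltW CB).
Qed.

Lemma continuous_integrable_itv f a b : continuous f -> mu.-integrable `[a, b] (EFin \o f).
Proof.
move=> cf; apply: continuous_compact_integrable; first exact: segment_compact.
exact: continuous_subspaceT.
Qed.

Lemma Rintegral_itv_cat a b c f : a <= b -> b <= c ->
  mu.-integrable `[a, c] (EFin \o f) ->
  \int[mu]_(t in `[a, c]) f t = \int[mu]_(t in `[a, b]) f t + \int[mu]_(t in `[b, c]) f t.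
Proof.
move=> ab bc fac; apply/eqP; rewrite addrC -subr_eq Rintegral_itvB ?bnd_simp//; apply/eqP.
apply: Rintegral_itv_obnd_cbnd; apply: integrableS fac => //.
by apply: subset_itvr; rewrite bnd_simp.
Qed.

Lemma Rintegral_itv_cst a b C : a <= b -> \int[mu]_(_ in `[a, b]) C = C * (b - a).
Proof.
move=> ab; rewrite Rintegral_cst//=; congr (_ * _).
rewrite lebesgue_measure_itv/= lte_fin.
by case: ltgtP ab => [||->] // _; rewrite subrr.
Qed.

Lemma ge0_subset_Rintegral (D D' : set (measurableTypeR R)) f :
  measurable D -> measurable D' -> D `<=` D' ->
  (forall x, D' x -> 0 <= f x) -> mu.-integrable D' (EFin \o f) ->
  \int[mu]_(x in D) f x <= \int[mu]_(x in D') f x.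
Proof.
move=> mD mD' sub f0 if_; rewrite fine_le//.
- by apply: integrable_fin_num => //; exact: integrableS if_.
- exact: integrable_fin_num.
- by apply: ge0_subset_integral => //; exact: measurable_int if_.
Qed.

End RealAnalysis.

Section DerivativeRules.
Context {R : realType}.
Implicit Types (f g : R -> R) (x a b c : R).

(* The library states these rules for the ring operations on functions; here
   they are restated pointwise. *)
Lemma is_derive_funD f g x a b : is_derive x 1 f a -> is_derive x 1 g b ->
  is_derive x 1 (fun y => f y + g y) (a + b).
Proof. by move=> df dg; exact: is_deriveD. Qed.

Lemma is_derive_funB f g x a b : is_derive x 1 f a -> is_derive x 1 g b ->
  is_derive x 1 (fun y => f y - g y) (a - b).
Proof. by move=> df dg; exact: is_deriveB. Qed.

Lemma is_derive_funM f g x a b : is_derive x 1 f a -> is_derive x 1 g b ->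
  is_derive x 1 (fun y => f y * g y) (a * g x + f x * b).
Proof.
move=> df dg; have := @is_deriveM _ _ f g x 1 a b df dg.
by move=> /is_derive_eq; apply; rewrite /GRing.scale/=; ring.
Qed.

Lemma is_derive_funZ c f x a : is_derive x 1 f a -> is_derive x 1 (fun y => c * f y) (c * a).
Proof. by move=> df; exact: is_deriveZ. Qed.

Lemma is_derive_funX n f x a : is_derive x 1 f a ->
  is_derive x 1 (fun y => f y ^+ n) (n%:R * f x ^+ n.-1 * a).
Proof. by move=> df; have := @is_deriveX _ _ f n x 1 a df; rewrite exprfctE. Qed.

Lemma is_derive_fun_comp f g x a b : is_derive (g x) 1 f a -> is_derive x 1 g b ->
  is_derive x 1 (fun y => f (g y)) (a * b).
Proof. by move=> df dg; exact: is_derive1_comp. Qed.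

Lemma is_derive_funV f x a : f x != 0 -> is_derive x 1 f a ->
  is_derive x 1 (fun y => (f y)^-1) (- a / f x ^+ 2).
Proof.
move=> fx0 df; have := is_deriveV fx0 df.
by move=> /is_derive_eq; apply; rewrite /GRing.scale/=; field.
Qed.

Lemma is_derive_fun_sqrt f x a : 0 < f x -> is_derive x 1 f a ->
  is_derive x 1 (fun y => Num.sqrt (f y)) (a / (2 * Num.sqrt (f x))).
Proof.
move=> fx0 df; have := is_derive_fun_comp (is_derive1_sqrt fx0) df.
by move=> /is_derive_eq; apply; rewrite mulrC.
Qed.

Lemma is_derive_continuous f x a : is_derive x 1 f a -> {for x, continuous f}.
Proof. by move=> df; apply/differentiable_continuous/derivable1_diffP; exact: ex_derive. Qed.

End DerivativeRules.

Section WeakPrimitive.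
Context {R : realType}.
Notation mu := (@lebesgue_measure R).
Implicit Types (a b x y M : R) (u g Phi psi : R -> R).

Definition weak_primitive a b u g : Prop :=
  mu.-integrable `[a, b] (EFin \o g) /\
  forall x, a <= x <= b -> u x = u a + \int[mu]_(t in `[a, x]) g t.

Lemma weak_primitiveB a b u g x y : weak_primitive a b u g -> a <= x -> x <= y -> y <= b ->
  u y - u x = \int[mu]_(t in `[x, y]) g t.
Proof.
move=> [ig uE] ax xy yb.
have xab : a <= x <= b by rewrite ax (le_trans xy).
have yab : a <= y <= b by rewrite yb (le_trans ax).
rewrite (uE y yab) (uE x xab) (Rintegral_itv_cat ax xy); first by ring.
by apply: integrableS ig => //; apply: subset_itvScc; rewrite bnd_simp.
Qed.

Lemma weak_primitiveS a b u g x y : weak_primitive a b u g -> a <= x -> y <= b ->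
  weak_primitive x y u g.
Proof.
move=> up ax yb; split.
  by case: up => ig _; apply: integrableS ig => //; apply: subset_itvScc; rewrite bnd_simp.
move=> z /andP[xz zy]; rewrite -(weak_primitiveB up ax xz); first by rewrite addrC subrK.
exact: le_trans yb.
Qed.

Lemma weak_primitive_continuous a b u g : a <= b -> weak_primitive a b u g ->
  {within `[a, b], continuous u}.
Proof.
move=> ab [ig uE].
apply: (@subspace_eq_continuous _ _ _ (fun x => u a + \int[mu]_(t in `[a, x]) g t)).
  by move=> x; rewrite inE/= in_itv/= => xab; rewrite -uE.
move=> x; apply: cvgD; first exact: cvg_cst.
exact: (parameterized_integral_continuous ab ig).
Qed.

Definition slope_bound M Phi psi : Prop :=
  [/\ continuous psi, forall s, 0 <= psi s &
      forall p q, - M <= p -> p < q -> q <= M ->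
        exists2 s, p <= s <= q & `|Phi q - Phi p| <= psi s * (q - p)].

Lemma is_derive_slope_bound M Phi dPhi psi : continuous psi -> (forall s, 0 <= psi s) ->
  {within `[- M, M], continuous Phi} ->
  (forall s, - M < s < M -> is_derive s 1 Phi (dPhi s)) ->
  (forall s, - M < s < M -> `|dPhi s| <= psi s) -> slope_bound M Phi psi.
Proof.
move=> cpsi psi0 cPhi dPhiE dPhi_le; split=> // p q Mp pq qM.
have in_M s : s \in `]p, q[ -> - M < s < M.
  by rewrite in_itv/= => /andP[ps sq]; rewrite (le_lt_trans Mp ps) (lt_le_trans sq qM).
have [||s spq ->] := @MVT _ Phi dPhi _ _ pq.
- by move=> s /in_M; exact: dPhiE.
- by apply: continuous_subspaceW cPhi; apply: subset_itvScc; rewrite bnd_simp.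
exists s; first by move: spq; rewrite in_itv/= => /andP[ps sq]; rewrite !ltW.
have qp : 0 < q - p by rewrite subr_gt0.
by rewrite normrM (gtr0_norm qp) ler_wpM2r ?(ltW qp)// dPhi_le ?in_M.
Qed.

Lemma slope_bound_near M Phi psi s0 e : slope_bound M Phi psi -> 0 < e ->
  exists2 d, 0 < d & forall p q, `|p| <= M -> `|q| <= M -> `|p - s0| < d -> `|q - s0| < d ->
    `|Phi q - Phi p| <= (psi s0 + e) * `|q - p|.
Proof.
move=> [cpsi psi0 mvt] e0.
have /cvgrPdist_lt/(_ _ e0)[d /= d0 hd] := cpsi s0; exists d => // p q.
wlog pq : p q / p <= q.
  move=> W; have [/W//|/ltW qp pM qM pd qd] := leP p q.
  by rewrite distrC (distrC q); exact: W.
move: pq; rewrite le_eqVlt => /predU1P[->|pq]; first by rewrite !subrr !normr0 mulr0.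
rewrite 2!ler_norml 2!ltr_distl => /andP[p1 p2] /andP[q1 q2] /andP[p3 p4] /andP[q3 q4].
have [s /andP[ps sq]] := mvt p q p1 pq q2.
move=> /le_trans; apply; rewrite (@gtr0_norm _ (q - p)) ?subr_gt0//.
rewrite ler_wpM2r ?subr_ge0 1?ltW//.
have : `|s0 - s| < d by rewrite ltr_distl; apply/andP; split; lra.
by move=> /hd /=; rewrite ltr_distl => /andP[]; lra.
Qed.

Section ChainRule.
Variables (M a b : R) (Phi psi u g : R -> R).
Hypotheses (ab : a <= b) (sb : slope_bound M Phi psi) (up : weak_primitive a b u g).
Hypothesis uM : forall x, a <= x <= b -> `|u x| <= M.

Let within_psiu : {within `[a, b], continuous (psi \o u)}.
Proof.
case: sb => cpsi _ _ x; apply: (@continuous_comp (subspace `[a, b]) _ _ u psi).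
  exact: (weak_primitive_continuous ab up).
exact: cpsi.
Qed.

Lemma integrable_weighted_slope :
  mu.-integrable `[a, b] (EFin \o (fun x => psi (u x) * `|g x|)).
Proof.
have [C psiC] := within_continuous_bounded ab within_psiu.
apply: (@integrable_funM _ _ C) => //.
- exact: subspace_continuous_measurable_fun.
- by case: up => ig _; exact: integrable_norm.
Qed.

Let integrable_weight e :
  mu.-integrable `[a, b] (EFin \o (fun x => (psi (u x) + e) * `|g x|)).
Proof.
have inorm : mu.-integrable `[a, b] (EFin \o (fun x => `|g x|)).
  by case: up => ig _; exact: integrable_norm.
rewrite (_ : (fun x => _) = (fun x => psi (u x) * `|g x| + e * `|g x|)).
  by apply: integrable_funD => //; [exact: integrable_weighted_slope|exact: integrable_funZl].
by apply/funext => x; rewrite mulrDl.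
Qed.

Let local_increment e x : 0 < e -> a <= x <= b ->
  exists2 d, 0 < d & forall y z, a <= y -> y <= x -> x <= z -> z <= b -> x - d < y -> z < x + d ->
    `|Phi (u z) - Phi (u y)| <= \int[mu]_(t in `[y, z]) ((psi (u t) + e) * `|g t|).
Proof.
move=> e0 xab; have e20 : 0 < e / 2 by rewrite divr_gt0.
have [r r0 Phir] := slope_bound_near (u x) sb e20.
have [d1 d10 ud1] := (within_itv_continuousP a b u).1 (weak_primitive_continuous ab up) x r xab r0.
have [d2 d20 psid2] := (within_itv_continuousP a b _).1 within_psiu x (e / 2) xab e20.
exists (Num.min d1 d2) => [|y z ay yx xz zb]; first by rewrite lt_min d10.
rewrite ltrBlDr -ltrBlDl -ltrBlDl !lt_min => /andP[y1 y2] /andP[z1 z2].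
have near t : y <= t <= z -> [/\ a <= t <= b, `|t - x| < d1 & `|t - x| < d2].
  by move=> /andP[yt tz]; split; rewrite ?ltr_norml; apply/andP; split; lra.
have yz : y <= z by exact: le_trans xz.
have [|yab yd1 _] := near y; rewrite ?lexx//.
have [|zab zd1 _] := near z; rewrite ?lexx ?andbT//.
have sub : `[y, z] `<=` `[a, b] by apply: subset_itvScc; rewrite bnd_simp.
have ig : mu.-integrable `[y, z] (EFin \o g) by case: up => ig _; exact: integrableS ig.
apply: (le_trans (Phir _ _ (uM yab) (uM zab) (ud1 y yab yd1) (ud1 z zab zd1))).
case: (sb) => _ psi0 _; rewrite (weak_primitiveB up ay yz zb).
apply: (@le_trans _ _ (\int[mu]_(t in `[y, z]) ((psi (u x) + e / 2) * `|g t|))).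
  rewrite RintegralZl//; last exact: integrable_norm.
  by rewrite ler_wpM2l ?le_normr_Rintegral// addr_ge0// ltW.
apply: le_Rintegral => //.
- by apply: integrable_funZl => //; exact: integrable_norm.
- exact: integrableS (integrable_weight e).
- move=> t /=; rewrite in_itv/= => /near[tab _ td2]; rewrite ler_wpM2r//.
  by have := psid2 t tab td2; rewrite /= ltr_distl => /andP[]; lra.
Qed.

Lemma chain_rule_le : `|Phi (u b) - Phi (u a)| <= \int[mu]_(x in `[a, b]) (psi (u x) * `|g x|).
Proof.
have inorm : mu.-integrable `[a, b] (EFin \o (fun x => `|g x|)).
  by case: up => ig _; exact: integrable_norm.
have I0 : 0 <= \int[mu]_(x in `[a, b]) `|g x| by apply: Rintegral_ge0.
apply/ler_addgt0Pr => e e0; set I := \int[mu]_(x in _) `|g x| in I0.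
have d0 : 0 < e / (I + 1) by rewrite divr_gt0// ltr_wpDl.
have : `|Phi (u b) - Phi (u a)| <= \int[mu]_(x in `[a, b]) ((psi (u x) + e / (I + 1)) * `|g x|).
  apply: (itv_local_to_global (P := fun x y => `|Phi (u y) - Phi (u x)| <=
      \int[mu]_(t in `[x, y]) ((psi (u t) + e / (I + 1)) * `|g t|)) ab); last first.
    by move=> x; exact: local_increment.
  move=> x y z ax xy yz zb Pxy Pyz; rewrite (Rintegral_itv_cat xy yz).
    by apply: (le_trans (ler_distD (Phi (u y)) _ _)); rewrite addrC lerD.
  by apply: integrableS (integrable_weight _) => //; apply: subset_itvScc; rewrite bnd_simp.
move=> /le_trans; apply; under eq_Rintegral do rewrite mulrDl.
rewrite RintegralD//; [|exact: integrable_weighted_slope|exact: integrable_funZl].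
by rewrite RintegralZl// lerD2l -/I mulrAC ler_pdivrMr ?ltr_wpDl// ler_wpM2l ?ltW// ltrDl.
Qed.

End ChainRule.
End WeakPrimitive.

Section Tails.
Context {R : realType}.
Notation mu := (@lebesgue_measure R).
Implicit Types (f : R -> R) (x y e X : R).

Lemma Rintegral_tail_small f e : (forall x, 0 <= x -> 0 <= f x) ->
  mu.-integrable `[0, +oo[ (EFin \o f) -> 0 < e ->
  exists2 X, 0 <= X & forall x y, X <= x -> x <= y -> \int[mu]_(t in `[x, y]) f t <= e.
Proof.
move=> f0 if_ e0; pose A y := \int[mu]_(t in `[0, y]) f t.
have ifS x y : 0 <= x -> mu.-integrable `[x, y] (EFin \o f).
  by move=> x0; apply: integrableS if_ => // t /=; rewrite !in_itv/= andbT => /andP[/(le_trans x0)].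
have Acat x y : 0 <= x -> x <= y -> A y = A x + \int[mu]_(t in `[x, y]) f t.
  by move=> x0 xy; rewrite /A (Rintegral_itv_cat x0 xy)//; exact: ifS.
pose S := [set A x | x in [set x | 0 <= x]].
have Sub : ubound S (\int[mu]_(t in `[0, +oo[) f t).
  move=> _ [y /= y0 <-]; apply: ge0_subset_Rintegral => //.
    by move=> t /=; rewrite !in_itv/= andbT => /andP[].
  by move=> t /=; rewrite in_itv/= andbT; exact: f0.
have S0 : S !=set0 by exists (A 0), 0 => //=.
have [_ [X /= X0 <-] supX] := sup_adherent e0 (conj S0 (ex_intro _ _ Sub)).
exists X => // x y Xx xy; have x0 := le_trans X0 Xx.
have : A y <= sup S.
  by apply: ub_le_sup; [exists (\int[mu]_(t in `[0, +oo[) f t)|exists y => //=; exact: le_trans xy].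
have : A X <= A x.
  rewrite (Acat X x)// lerDl; apply: Rintegral_ge0 => t /=; rewrite in_itv/= => /andP[Xt _].
  by apply: f0; exact: le_trans Xt.
by rewrite (Acat x y)//; lra.
Qed.

Lemma integrable_small_value f e X : (forall x, 0 <= x -> 0 <= f x) ->
  mu.-integrable `[0, +oo[ (EFin \o f) -> 0 < e ->
  exists y, [/\ 0 <= y, X <= y & f y < e].
Proof.
move=> f0 if_ e0; have e20 : 0 < e / 2 by rewrite divr_gt0.
have [Y Y0 small] := Rintegral_tail_small f0 if_ e20.
apply: contrapT => large; pose a := Num.max X Y.
have aY : Y <= a by rewrite le_max lexx orbT.
have a0 : 0 <= a by exact: le_trans aY.
suff : e <= e / 2 by lra.
apply: le_trans (small a (a + 1) aY (ltac:(by rewrite lerDl))).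
rewrite -[leLHS]mulr1 -[X in _ * X](addrK a) (addrC 1) -Rintegral_itv_cst ?lerDl//.
apply: le_Rintegral => //.
- by apply: continuous_integrable_itv => x; exact: cvg_cst.
- by apply: integrableS if_ => // t /=; rewrite !in_itv/= andbT => /andP[/(le_trans a0)].
- move=> x /=; rewrite in_itv/= => /andP[ax _]; rewrite leNgt; apply/negP => fx.
  apply: large; exists x; split => //; first exact: le_trans ax.
  by apply: le_trans ax; rewrite le_max lexx.
Qed.

End Tails.

(** * Sobolev functions on one edge *)

Section EdgeDomain.
Context {R : realType}.
Notation mu := (@lebesgue_measure R).
Implicit Types (l b : option R) (a x y z : R) (f : R -> R).

Definition edge_dom l : set (measurableTypeR R) :=
  [set` Interval (BLeft 0) (if l is Some l then BRight l else +oo%O)].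

Definition pos_length l : bool := if l is Some l then 0 < l else true.

Definition open_itv a (b : option R) : interval R :=
  Interval (BRight a) (if b is Some b then BLeft b else +oo%O).

Lemma in_open_itv a b x : (x \in open_itv a b) = (a < x) && (if b is Some b then x < b else true).
Proof. by case: b => [b|]; rewrite in_itv/= ?andbT. Qed.

Lemma open_itv_convex a b x y z : x \in open_itv a b -> y \in open_itv a b -> x <= z <= y ->
  z \in open_itv a b.
Proof.
rewrite !in_open_itv => /andP[ax _] /andP[_ yb] /andP[xz zy]; rewrite (lt_le_trans ax xz) /=.
by case: b yb => [b|//]; exact: le_lt_trans.
Qed.

Lemma open_itv_nbhs a b x : x \in open_itv a b ->
  exists2 d, 0 < d & forall y, `|y - x| <= d -> y \in open_itv a b.
Proof.
rewrite in_open_itv; case: b => [b|] /andP[ax xb].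
  exists (Num.min (x - a) (b - x) / 2) => [|y].
    by rewrite divr_gt0// lt_min !subr_gt0 ax.
  have : Num.min (x - a) (b - x) <= x - a by rewrite ge_min lexx.
  have : Num.min (x - a) (b - x) <= b - x by rewrite ge_min lexx orbT.
  by rewrite in_open_itv ler_distl => left_gap right_gap /andP[xy yx]; apply/andP; split; lra.
exists ((x - a) / 2) => [|y]; first by rewrite divr_gt0// subr_gt0.
by rewrite in_open_itv andbT ler_distl => /andP[y1 _]; lra.
Qed.

Lemma edge_domE l x : edge_dom l x = ((0 <= x) && (if l is Some l then x <= l else true)) :> Prop.
Proof. by case: l => [l|] /=; rewrite /edge_dom/= in_itv. Qed.

Lemma open_itv_edge_dom l x : x \in open_itv 0 l -> edge_dom l x.
Proof.
rewrite in_open_itv edge_domE => /andP[/ltW-> xl] /=.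
by case: l xl => // l /ltW.
Qed.

Lemma measurable_edge_dom l : measurable (edge_dom l).
Proof. exact: measurable_itv. Qed.

Lemma edge_dom_ge0 l x : edge_dom l x -> 0 <= x.
Proof. by rewrite edge_domE => /andP[]. Qed.

Lemma edge_dom0 l : pos_length l -> edge_dom l 0.
Proof. by rewrite edge_domE lexx; case: l => //= l /ltW. Qed.

Lemma edge_dom_le l x y : edge_dom l y -> 0 <= x -> x <= y -> edge_dom l x.
Proof.
rewrite !edge_domE => /andP[_ yl] -> xy /=.
by case: l yl => [l|//] yl; exact: le_trans yl.
Qed.

Lemma edge_dom_sub l x y : edge_dom l y -> 0 <= x -> `[x, y] `<=` edge_dom l.
Proof.
move=> yl x0 z /=; rewrite in_itv/= => /andP[xz zy].
by apply: (edge_dom_le yl) => //; exact: le_trans xz.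
Qed.

Lemma measurable_fun_edge_dom l f :
  (forall x, edge_dom l x -> measurable_fun (`[0, x] : set (measurableTypeR R)) f) ->
  measurable_fun (edge_dom l) f.
Proof.
case: l => [l|] H.
  have [l0|l0] := leP 0 l; first by apply: (H l); rewrite edge_domE l0 lexx.
  rewrite (_ : edge_dom _ = set0); first exact: measurable_fun_set0.
  apply/seteqP; split=> // x; rewrite edge_domE => /andP[x0 xl].
  by move: (le_trans x0 xl); rewrite leNgt l0.
rewrite /edge_dom itv_bndy_bigcup_BRight; apply/measurable_fun_bigcup => // n; apply: H.
by rewrite edge_domE add0r ler0n.
Qed.

End EdgeDomain.

Section SobolevEdge.
Context {R : realType}.
Notation mu := (@lebesgue_measure R).
Implicit Types (x y e M C X : R) (Phi psi : R -> R).

Definition H1_edge (l : option R) (u g : R -> R) : Prop :=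
  [/\ mu.-integrable (edge_dom l) (EFin \o (fun x => u x ^+ 2)),
      mu.-integrable (edge_dom l) (EFin \o (fun x => g x ^+ 2)) &
      forall x, edge_dom l x -> weak_primitive 0 x u g].

Variables (l : option R) (u g : R -> R).
Hypothesis H : H1_edge l u g.

Lemma H1_edge_weak_primitive x y : 0 <= x -> edge_dom l y -> weak_primitive x y u g.
Proof. by move=> x0 Dy; case: H => _ _ up; exact: weak_primitiveS (up y Dy) x0 (lexx y). Qed.

Lemma H1_edge_continuous y : edge_dom l y -> {within `[0, y], continuous u}.
Proof.
by move=> Dy; exact: weak_primitive_continuous (edge_dom_ge0 Dy) (H1_edge_weak_primitive _ Dy).
Qed.

Lemma H1_edge_measurable : measurable_fun (edge_dom l) u.
Proof.
apply: measurable_fun_edge_dom => x Dx.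
by apply: subspace_continuous_measurable_fun => //; exact: H1_edge_continuous.
Qed.

Lemma H1_edge_measurable_grad : measurable_fun (edge_dom l) g.
Proof.
apply: measurable_fun_edge_dom => x Dx; apply/measurable_EFinP.
by case: (H1_edge_weak_primitive (lexx 0) Dx) => ig _; exact: measurable_int ig.
Qed.

(* 2 |u g| <= u ^ 2 + g ^ 2 *)
Lemma H1_edge_integrable_mul : mu.-integrable (edge_dom l) (EFin \o (fun x => `|u x| * `|g x|)).
Proof.
case: (H) => iu ig _; have mD := measurable_edge_dom l.
apply: (@le_integrable _ _ _ mu _ mD _ (EFin \o (fun x => u x ^+ 2 + g x ^+ 2))).
- apply/measurable_EFinP; apply: measurable_funM.
    by apply: measurableT_comp => //; exact: H1_edge_measurable.
  by apply: measurableT_comp => //; exact: H1_edge_measurable_grad.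
- move=> x _ /=; rewrite lee_fin normrM !normr_id (@ger0_norm _ (_ + _)) ?addr_ge0 ?sqr_ge0//.
  rewrite -(real_normK (num_real (u x))) -(real_normK (num_real (g x))).
  move: `|u x| `|g x| (normr_ge0 (u x)) (normr_ge0 (g x)) => a b a0 b0.
  by have := sqr_ge0 (a - b); nra.
- exact: integrable_funD.
Qed.

Section EdgeChainRule.
Variables (Phi psi : R -> R) (M C : R).
Hypotheses (sb : slope_bound M Phi psi) (psiC : forall s, `|s| <= M -> psi s <= C * `|s|).
Hypothesis uM : forall x, edge_dom l x -> `|u x| <= M.

Lemma H1_edge_integrable_slope :
  mu.-integrable (edge_dom l) (EFin \o (fun x => psi (u x) * `|g x|)).
Proof.
case: (sb) => cpsi psi0 _; have mD := measurable_edge_dom l.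
apply: (le_integrable mD _ _ (integrable_funZl C mD H1_edge_integrable_mul)).
- apply/measurable_EFinP; apply: measurable_funM.
    apply: (measurableT_comp (f := psi)); last exact: H1_edge_measurable.
    exact: continuous_measurable_fun.
  by apply: measurableT_comp => //; exact: H1_edge_measurable_grad.
- move=> x Dx /=; rewrite lee_fin !normrM !normr_id mulrA ler_wpM2r//.
  rewrite ger0_norm// (le_trans (psiC (uM Dx)))//.
  by rewrite ler_wpM2r// ler_norm.
Qed.

Lemma H1_edge_chain_rule_le x y : 0 <= x -> x <= y -> edge_dom l y ->
  `|Phi (u y) - Phi (u x)| <= \int[mu]_(t in `[x, y]) (psi (u t) * `|g t|).
Proof.
move=> x0 xy Dy; apply: (chain_rule_le xy sb (H1_edge_weak_primitive x0 Dy)).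
by move=> z /andP[xz zy]; apply: uM; apply: (edge_dom_le Dy) => //; exact: le_trans xz.
Qed.

Lemma H1_edge_variation_le x y : 0 <= x -> x <= y -> edge_dom l y ->
  `|Phi (u x) - Phi (u 0)| + `|Phi (u y) - Phi (u x)| <=
  \int[mu]_(t in edge_dom l) (psi (u t) * `|g t|).
Proof.
move=> x0 xy Dy; case: (sb) => _ psi0 _; have Dx := edge_dom_le Dy x0 xy.
apply: (le_trans (lerD (H1_edge_chain_rule_le (lexx 0) x0 Dx) (H1_edge_chain_rule_le x0 xy Dy))).
have sub := edge_dom_sub Dy (lexx 0); have mD := measurable_edge_dom l.
rewrite -Rintegral_itv_cat//; last exact: integrableS H1_edge_integrable_slope.
apply: ge0_subset_Rintegral => //; last exact: H1_edge_integrable_slope.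
by move=> t _; rewrite mulr_ge0.
Qed.

End EdgeChainRule.
End SobolevEdge.

Section SobolevMaximum.
Context {R : realType}.
Notation mu := (@lebesgue_measure R).
Implicit Types (l : option R) (u g : R -> R) (x y e X M : R).

Lemma slope_bound_sqr M : slope_bound M (fun s : R => s ^+ 2) (fun s => 2 * `|s|).
Proof.
apply: (is_derive_slope_bound (dPhi := fun s => 2 * s)) => [s|s||s _|s _].
- by apply: cvgM; [exact: cvg_cst|exact: cvg_norm].
- by rewrite mulr_ge0.
- exact/continuous_subspaceT/exprn_continuous.
- by apply: is_derive_eq (is_derive_funX 2 (is_derive_id s 1)) _; rewrite expr1 mulr1.
- by rewrite normrM ger0_norm.
Qed.

Lemma H1_edge_sqr_increment l u g x y : H1_edge l u g -> 0 <= x -> x <= y -> edge_dom l y ->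
  `|u y ^+ 2 - u x ^+ 2| <= \int[mu]_(t in `[x, y]) (2 * `|u t| * `|g t|).
Proof.
move=> H x0 xy Dy; have y0 := edge_dom_ge0 Dy.
have [M uM] := within_continuous_bounded y0 (H1_edge_continuous H Dy).
apply: (chain_rule_le xy (slope_bound_sqr M) (H1_edge_weak_primitive H x0 Dy)).
by move=> z /andP[xz zy]; apply: uM; rewrite (le_trans x0 xz).
Qed.

Lemma H1_halfline_small_value u g X e : H1_edge None u g -> 0 < e ->
  exists y, [/\ 0 <= y, X <= y & `|u y| < e].
Proof.
move=> [iu _ _] e0.
have [|y [y0 Xy uy]] := integrable_small_value X _ iu (exprn_gt0 2 e0).
  by move=> x _; exact: sqr_ge0.
by exists y; split => //; rewrite -(@ltr_pXn2r _ 2) ?nnegrE ?(ltW e0)// real_normK ?num_real.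
Qed.

Lemma H1_halfline_decay u g e : H1_edge None u g -> 0 < e ->
  exists2 X, 0 <= X & forall y, X <= y -> `|u y| <= e.
Proof.
move=> H e0; have mD := measurable_edge_dom (None : option R).
have ih : mu.-integrable (edge_dom None) (EFin \o (fun t => 2 * `|u t| * `|g t|)).
  rewrite (_ : (fun t => _) = (fun t => 2 * (`|u t| * `|g t|))).
    by apply: integrable_funZl => //; exact: H1_edge_integrable_mul H.
  by apply/funext => t; rewrite mulrA.
have e20 : 0 < e ^+ 2 / 2 by rewrite divr_gt0 ?exprn_gt0.
have [|X X0 tail] := Rintegral_tail_small _ ih e20; first by move=> t _; rewrite !mulr_ge0.
case: (H) => iu _ _.
have [|x [x0 Xx ux]] := integrable_small_value X _ iu e20; first by move=> t _; exact: sqr_ge0.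
exists x => // y xy; have Dy : edge_dom None y by rewrite edge_domE (le_trans x0).
rewrite -(@ler_pXn2r _ 2) ?nnegrE ?(ltW e0)// real_normK ?num_real//.
have := H1_edge_sqr_increment H x0 xy Dy; have := tail x y Xx xy.
by have := ler_norm (u y ^+ 2 - u x ^+ 2); lra.
Qed.

Lemma H1_edge_max l u g : pos_length l -> H1_edge l u g ->
  exists2 x, edge_dom l x & forall y, edge_dom l y -> `|u y| <= `|u x|.
Proof.
move=> l0 H.
have segment_max y : edge_dom l y ->
    exists2 x, edge_dom l x & forall z, 0 <= z <= y -> `|u z| <= `|u x|.
  move=> Dy; have y0 := edge_dom_ge0 Dy.
  have cu : {within `[0, y], continuous (fun x => `|u x|)}.
    by move=> x; apply: cvg_norm; exact: (H1_edge_continuous H Dy).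
  have [c + hc] := EVT_max y0 cu; rewrite in_itv/= => /andP[c0 cy].
  by exists c => [|z zy]; [exact: edge_dom_le cy|apply: hc; rewrite in_itv].
case: l l0 H segment_max => [l|] l0 H segment_max.
  have [|x Dx hx] := segment_max l; first by rewrite edge_domE lexx ltW.
  by exists x => // y; rewrite edge_domE => yl; exact: hx.
have [[x x0 ux]|u0] := pselect (exists2 x, 0 <= x & u x != 0); last first.
  exists 0; first exact: edge_dom0.
  move=> y /edge_dom_ge0 y0; have [->|uy] := eqVneq (u y) 0; first by rewrite normr0.
  by exfalso; apply: u0; exists y.
have ux0 : 0 < `|u x| by rewrite normr_gt0.
have [X X0 decay] := H1_halfline_decay H ux0.
have [|z Dz hz] := segment_max (Num.max X x); first by rewrite edge_domE le_max X0.
exists z => // y /edge_dom_ge0 y0; have [yX|Xy] := leP y X.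
  by apply: hz; rewrite y0 le_max yX.
by apply: (le_trans (decay _ (ltW Xy))); apply: hz; rewrite x0 le_max lexx orbT.
Qed.

End SobolevMaximum.

(** * The Gagliardo-Nirenberg weight and its primitive *)

Section GagliardoNirenbergWeight.
Context {R : realType}.
Variable M : R.
Hypothesis M0 : 0 < M.
Implicit Types (s : R).

Definition quartic_gap s := Num.sqrt (M ^+ 4 - s ^+ 4).

Definition gn_weight s := `|s| * quartic_gap s.

(* Half of the arcsine of s ^ 2 / M ^ 2, in a form that is continuous up to
   the end points s = M and s = - M. *)
Definition gn_angle s := atan (s ^+ 2 / (M ^+ 2 + quartic_gap s)).

Definition gn_prim s := 4^-1 * (s ^+ 2 * quartic_gap s + 2 * M ^+ 4 * gn_angle s).

Lemma quartic_gap_sqr s : `|s| <= M -> quartic_gap s ^+ 2 = M ^+ 4 - s ^+ 4.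
Proof.
move=> sM; rewrite sqr_sqrtr// subr_ge0 -[s ^+ 4]ger0_norm ?exprn_even_ge0// normrX.
by rewrite lerXn2r ?nnegrE// ltW.
Qed.

Lemma quartic_gap_gt0 s : - M < s < M -> 0 < quartic_gap s.
Proof.
rewrite -ltr_norml => sM; rewrite sqrtr_gt0 subr_gt0 -[s ^+ 4]ger0_norm ?exprn_even_ge0// normrX.
by rewrite ltr_pXn2r ?nnegrE// ltW.
Qed.

Lemma gap_denominator_gt0 s : 0 < M ^+ 2 + quartic_gap s.
Proof. by rewrite ltr_pwDl ?exprn_gt0 ?sqrtr_ge0. Qed.

Lemma continuous_quartic_gap : continuous quartic_gap.
Proof.
move=> s; apply: (@continuous_comp _ _ _ (fun s : R => M ^+ 4 - s ^+ 4) Num.sqrt).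
  by apply: cvgB; [exact: cvg_cst|exact: exprn_continuous].
exact: sqrt_continuous.
Qed.

Lemma continuous_gn_weight : continuous gn_weight.
Proof. by move=> s; apply: cvgM; [exact: cvg_norm|exact: continuous_quartic_gap]. Qed.

Lemma gn_weight_ge0 s : 0 <= gn_weight s.
Proof. by rewrite mulr_ge0// sqrtr_ge0. Qed.

Lemma gn_weight_le s : gn_weight s <= M ^+ 2 * `|s|.
Proof.
rewrite /gn_weight mulrC ler_wpM2r// -[M ^+ 2]ger0_norm ?sqr_ge0// -sqrtr_sqr -exprM.
by rewrite ler_wsqrtr// gerBl exprn_even_ge0.
Qed.

Lemma continuous_gn_prim : continuous gn_prim.
Proof.
move=> s; apply: cvgM; first exact: cvg_cst.
have csqr : continuous (fun s : R => s ^+ 2) by exact: exprn_continuous.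
apply: cvgD; first by apply: cvgM; [exact: csqr|exact: continuous_quartic_gap].
apply: cvgM; first exact: cvg_cst.
apply: (@continuous_comp _ _ _ (fun s => s ^+ 2 / (M ^+ 2 + quartic_gap s)) atan).
  apply: cvgM; first exact: csqr.
  apply: cvgV; first by rewrite gt_eqF// gap_denominator_gt0.
  by apply: cvgD; [exact: cvg_cst|exact: continuous_quartic_gap].
exact: continuous_atan.
Qed.

Lemma is_derive_quartic_gap s : - M < s < M ->
  is_derive s 1 quartic_gap (- 2 * s ^+ 3 / quartic_gap s).
Proof.
move=> sM; have gap0 := quartic_gap_gt0 sM.
have := is_derive_funB (is_derive_cst (M ^+ 4) s 1) (is_derive_funX 4 (is_derive_id s 1)).
move=> /(is_derive_fun_sqrt (f := fun s => M ^+ 4 - s ^+ 4)) /is_derive_eq; apply.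
  by move: gap0; rewrite sqrtr_gt0.
by rewrite -/(quartic_gap s) /= mulr1 sub0r; field; rewrite gt_eqF.
Qed.

Lemma is_derive_gn_angle s : - M < s < M -> is_derive s 1 gn_angle (s / quartic_gap s).
Proof.
move=> sM; have gap0 := lt0r_neq0 (quartic_gap_gt0 sM).
have den0 := lt0r_neq0 (gap_denominator_gt0 s); have M0' := lt0r_neq0 M0.
have gapE : s ^+ 4 = M ^+ 4 - quartic_gap s ^+ 2.
  by rewrite quartic_gap_sqr ?ler_norml; [ring|case/andP: sM => *; rewrite !ltW].
have dden := is_derive_funD (is_derive_cst (M ^+ 2) s 1) (is_derive_quartic_gap sM).
have dquot := is_derive_funM (is_derive_funX 2 (is_derive_id s 1))
  (is_derive_funV (f := fun s => M ^+ 2 + quartic_gap s) den0 dden).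
apply: is_derive_eq (is_derive_fun_comp (is_derive1_atan _) dquot) _ => /=.
move: (quartic_gap s) gap0 den0 gapE => r r0 den0 gapE.
have -> : 1 + (s ^+ 2 / (M ^+ 2 + r)) ^+ 2 = 2 * M ^+ 2 / (M ^+ 2 + r).
  by field: gapE; rewrite den0.
by field: gapE; rewrite M0' den0 r0.
Qed.

Lemma is_derive_gn_prim s : - M < s < M -> is_derive s 1 gn_prim (s * quartic_gap s).
Proof.
move=> sM; have gap0 := lt0r_neq0 (quartic_gap_gt0 sM).
have gapE : s ^+ 4 = M ^+ 4 - quartic_gap s ^+ 2.
  by rewrite quartic_gap_sqr ?ler_norml; [ring|case/andP: sM => *; rewrite !ltW].
have d1 := is_derive_funM (is_derive_funX 2 (is_derive_id s 1)) (is_derive_quartic_gap sM).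
have d2 := is_derive_funZ (2 * M ^+ 4) (is_derive_gn_angle sM).
apply: is_derive_eq (is_derive_funZ 4^-1 (is_derive_funD d1 d2)) _ => /=.
by move: (quartic_gap s) gap0 gapE => r r0 gapE; field: gapE; rewrite r0.
Qed.

Lemma slope_bound_gn_prim : slope_bound M gn_prim gn_weight.
Proof.
apply: (is_derive_slope_bound continuous_gn_weight gn_weight_ge0 _ is_derive_gn_prim).
  exact/continuous_subspaceT/continuous_gn_prim.
by move=> s _; rewrite normrM (@ger0_norm _ (quartic_gap s)) ?sqrtr_ge0.
Qed.

Lemma gn_prim0 : gn_prim 0 = 0.
Proof. by rewrite /gn_prim /gn_angle expr0n /= !mul0r atan0 mulr0 addr0 mulr0. Qed.

Lemma gn_primN s : gn_prim (- s) = gn_prim s.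
Proof. by rewrite /gn_prim /gn_angle /quartic_gap sqrrN (_ : (- s) ^+ 4 = s ^+ 4) //; ring. Qed.

Lemma gn_prim_max s : `|s| = M -> gn_prim s = pi / 8 * M ^+ 4.
Proof.
have -> : gn_prim s = gn_prim `|s| by case: (ger0P s) => // _; rewrite gn_primN.
move=> ->; rewrite /gn_prim /gn_angle /quartic_gap subrr sqrtr0 addr0 mulr0 add0r.
by rewrite divff ?expf_neq0 ?gt_eqF// atan1; field.
Qed.

End GagliardoNirenbergWeight.

(** * Metric graphs and variation along trails *)

Section MetricGraph.
Context {R : realType}.
Variable G : mgraph R.
Implicit Types (e : 'I_(nE G)) (p q r : gpoint G) (s : 'I_(nE G) * bool).

Definition edge_len e : option R := if gtl G e is Some _ then Some (glen G e) else None.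

Lemma edomE e : edom e = edge_dom (edge_len e).
Proof. by rewrite /edom /edge_dom /edge_len; case: (gtl G e). Qed.

Lemma pos_edge_len e : pos_length (edge_len e).
Proof. by rewrite /edge_len; case: (gtl G e) => // _; exact: glen_gt0. Qed.

Lemma in_domE p : in_dom p = edge_dom (edge_len p.1) p.2 :> Prop.
Proof. by rewrite edge_domE /in_dom /edge_len; case: (gtl G p.1). Qed.

Lemma in_dom0 e : in_dom (e, 0).
Proof. by rewrite in_domE; exact/edge_dom0/pos_edge_len. Qed.

Lemma in_dom_len e : in_dom (e, glen G e).
Proof. by rewrite /in_dom/= ltW ?glen_gt0//=; case: (gtl G e). Qed.

Lemma vtx_of0 e : vtx_of (e, 0) = Some (ghd G e).
Proof. by rewrite /vtx_of eqxx. Qed.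

Lemma vtx_of_len e w : gtl G e = Some w -> vtx_of (e, glen G e) = Some w.
Proof. by move=> ew; rewrite /vtx_of/= gt_eqF ?glen_gt0// ew eqxx. Qed.

Lemma vtx_ofP p v : vtx_of p = Some v ->
  (p.2 = 0 /\ v = ghd G p.1) \/ (p.2 = glen G p.1 /\ gtl G p.1 = Some v).
Proof.
rewrite /vtx_of; case: eqP => [-> [<-]|_]; first by left.
by case: (gtl G p.1) => // w; case: eqP => // -> [->]; right.
Qed.

Lemma vtx_of_in_dom p v : vtx_of p = Some v -> in_dom p.
Proof.
by case: p => e x /vtx_ofP /= [[-> _]|[-> _]]; [exact: in_dom0|exact: in_dom_len].
Qed.

Lemma same_pt_refl p : same_pt p p.
Proof. by rewrite /same_pt eqxx. Qed.

Lemma same_ptP p q :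
  reflect (p = q \/ exists2 v, vtx_of p = Some v & vtx_of q = Some v) (same_pt p q).
Proof.
apply: (iffP orP) => [[/eqP|/andP[]]|[->|[v -> ->]]]; rewrite ?eqxx; auto.
by case: (vtx_of p) => // v _ /eqP; right; exists v.
Qed.

Lemma same_pt_vtx p q v : vtx_of p = Some v -> vtx_of q = Some v -> same_pt p q.
Proof. by move=> pv qv; apply/same_ptP; right; exists v. Qed.

Lemma same_pt_sym p q : same_pt p q -> same_pt q p.
Proof. by move=> /same_ptP[->|[v pv qv]]; [exact: same_pt_refl|exact: same_pt_vtx qv pv]. Qed.

Lemma same_pt_trans p q r : same_pt p q -> same_pt q r -> same_pt p r.
Proof.
move=> /same_ptP[->//|[v pv qv]] /same_ptP[<-|[w]]; first exact: same_pt_vtx pv qv.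
by rewrite qv => -[<-]; exact: same_pt_vtx.
Qed.

Lemma on_trailP p s0 ss : in_dom p -> on_trail p s0 ss ->
  exists q, [/\ in_dom q, same_pt p q & q.1 \in map fst (s0 :: ss)].
Proof.
move=> pd [pin|[v [pv /hasP[s sin sv]]]]; first by exists p; rewrite same_pt_refl.
have s_in : s.1 \in map fst (s0 :: ss) by apply/mapP; exists s.
have [hv|tv] : Some (ghd G s.1) = Some v \/ gtl G s.1 = Some v.
  by move: sv; rewrite /step_ends; case: (s.2) => /= /orP[] /eqP; auto.
- exists (s.1, 0); rewrite in_dom0; split => //.
  by apply: same_pt_vtx pv _; rewrite vtx_of0.
- exists (s.1, glen G s.1); rewrite in_dom_len; split => //.
  by apply: same_pt_vtx pv _; rewrite (vtx_of_len tv).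
Qed.

Definition edge_ends : seq (gpoint G) :=
  [seq (e, 0) | e <- enum 'I_(nE G)] ++ [seq (e, glen G e) | e <- enum 'I_(nE G)].

Lemma edge_ends_in_dom p : p \in edge_ends -> in_dom p.
Proof. by rewrite mem_cat => /orP[] /mapP[e _ ->]; [exact: in_dom0|exact: in_dom_len]. Qed.

Lemma vtx_of_edge_ends p v : vtx_of p = Some v -> p \in edge_ends.
Proof.
case: p => e x /vtx_ofP /= [[-> _]|[-> _]]; rewrite mem_cat; apply/orP; [left|right];
  by apply/mapP; exists e; rewrite ?mem_enum.
Qed.

Definition vertex_values (u : 'I_(nE G) -> R -> R) (phi : 'I_(nV G) -> R) : Prop :=
  forall e, u e 0 = phi (ghd G e) /\ forall w, gtl G e = Some w -> u e (glen G e) = phi w.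

Lemma vertex_valuesE u phi p v : vertex_values u phi -> vtx_of p = Some v -> u p.1 p.2 = phi v.
Proof.
by move=> uphi /vtx_ofP[[-> ->]|[-> pv]]; have [u0 ulen] := uphi p.1 => //; exact: ulen.
Qed.

Lemma vertex_valuesP u : (exists phi, vertex_values u phi) <->
  forall p q, in_dom p -> in_dom q -> same_pt p q -> u p.1 p.2 = u q.1 q.2.
Proof.
split=> [[phi uphi] p q _ _ /same_ptP[->//|[v pv qv]]|u_same].
  by rewrite (vertex_valuesE uphi pv) (vertex_valuesE uphi qv).
pose values v := [set y | exists p, vtx_of p = Some v /\ y = u p.1 p.2].
have valuesE p v : vtx_of p = Some v -> u p.1 p.2 = xget 0 (values v).
  move=> pv; case: xgetP => [_ _ [q [qv ->]]|/(_ (u p.1 p.2))]; last by case; exists p.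
  by apply: u_same; [exact: vtx_of_in_dom pv|exact: vtx_of_in_dom qv|exact: same_pt_vtx pv qv].
exists (fun v => xget 0 (values v)) => e; split; first by rewrite -(valuesE _ _ (vtx_of0 e)).
by move=> w /vtx_of_len/valuesE <-.
Qed.

End MetricGraph.

Section TrailVariation.
Context {R : realType}.
Variables (G : mgraph R) (F : gpoint G -> R) (Fend : option 'I_(nV G) -> R) (W : 'I_(nE G) -> R).
Hypothesis edge_variation : forall e x, in_dom (e, x) ->
  `|F (e, x) - Fend (Some (ghd G e))| + `|Fend (gtl G e) - F (e, x)| <= W e.
Implicit Types (s : 'I_(nE G) * bool) (ss : seq ('I_(nE G) * bool)) (p : gpoint G).

Definition step_adj s s' := ((step_ends s).2 == (step_ends s').1) && ((step_ends s).2 != None).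

Let step_variation s x : in_dom (s.1, x) ->
  `|F (s.1, x) - Fend (step_ends s).1| + `|Fend (step_ends s).2 - F (s.1, x)| <= W s.1.
Proof.
move=> /edge_variation; rewrite /step_ends; case: (s.2) => //=.
by rewrite addrC distrC [X in _ + X]distrC.
Qed.

Lemma walk_variation s ss t x : path step_adj s ss -> t \in s :: ss -> in_dom (t.1, x) ->
  `|F (t.1, x) - Fend (step_ends s).1| + `|Fend (step_ends (last s ss)).2 - F (t.1, x)| <=
  \sum_(r <- s :: ss) W r.1.
Proof.
elim: ss s t x => [|s' ss IH] s t x /=.
  by rewrite inE big_seq1 => _ /eqP->; exact: step_variation.
rewrite big_cons inE => /andP[/andP[/eqP ss' _] pth] /predU1P[->|tin] td.
  have := step_variation td; have := IH s' s' 0 pth (mem_head _ _) (in_dom0 _).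
  have := ler_distD (Fend (step_ends s).2) (Fend (step_ends (last s' ss)).2) (F (s.1, x)).
  have := ler_distD (F (s'.1, 0)) (Fend (step_ends (last s' ss)).2) (Fend (step_ends s').1).
  by rewrite ss'; lra.
have := step_variation (in_dom0 s.1); have := IH s' t x pth tin td.
have := ler_distD (Fend (step_ends s').1) (F (t.1, x)) (Fend (step_ends s).1).
have := ler_distD (F (s.1, 0)) (Fend (step_ends s').1) (Fend (step_ends s).1).
by rewrite ss'; lra.
Qed.

Lemma trail_variation s0 ss p : Fend None = 0 -> (forall e, 0 <= W e) ->
  trail2 s0 ss -> in_dom p -> p.1 \in map fst (s0 :: ss) -> 2 * `|F p| <= \sum_(e < nE G) W e.
Proof.
move=> FN W0 /and4P[pth unq /eqP s0N /eqP lstN] pd /mapP[t tin pt].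
case: p pt pd => _ x /= -> pd.
have := walk_variation pth tin pd; rewrite s0N lstN FN sub0r normrN subr0.
rewrite -mulr2n mulr_natl => /le_trans; apply.
rewrite -(big_map fst predT W) -[X in \sum_(_ <- X | _) _]/(map fst (s0 :: ss)).
by rewrite big_uniq//= [leRHS](bigID (mem (map fst (s0 :: ss))))/= lerDl sumr_ge0.
Qed.

End TrailVariation.

Section SobolevGraph.
Context {R : realType}.
Notation mu := (@lebesgue_measure R).
Variable G : mgraph R.
Implicit Types (e : 'I_(nE G)) (p q : gpoint G) (u g F : 'I_(nE G) -> R -> R).

Definition graph_integral F : R := \sum_(e < nE G) \int[mu]_(x in edge_dom (edge_len e)) F e x.

Lemma graph_integral_ge0 F : (forall e x, 0 <= F e x) -> 0 <= graph_integral F.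
Proof. by move=> F0; apply: sumr_ge0 => e _; apply: Rintegral_ge0 => x _; exact: F0. Qed.

Lemma normk_ge0 k u : 0 <= normk k u.
Proof. by apply: sumr_ge0 => e _; apply: Rintegral_ge0 => x _; rewrite exprn_ge0. Qed.

Lemma normk_even k u : ~~ odd k -> normk k u = graph_integral (fun e x => u e x ^+ k).
Proof.
move=> k_even; apply: eq_bigr => e _; rewrite edomE; apply: eq_Rintegral => x _.
by rewrite -normrX ger0_norm// exprn_even_ge0.
Qed.

Lemma H1P u g : H1 u g <->
  (forall e, H1_edge (edge_len e) (u e) (g e)) /\ exists phi, vertex_values u phi.
Proof.
have primP e : (forall x, edge_dom (edge_len e) x -> mu.-integrable `[0, x] (EFin \o g e) /\
      u e x = u e 0 + \int[mu]_(t in `[0, x]) g e t) <->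
    (forall x, edge_dom (edge_len e) x -> weak_primitive 0 x (u e) (g e)).
  split=> up x Dx; have [ig uE] := up x Dx; split=> //.
    by move=> y /andP[y0 yx]; have [] := up y (edge_dom_le Dx y0 yx).
  by apply: uE; rewrite lexx (edge_dom_ge0 Dx).
split=> [[iu [ig [up cont]]]|[H cont]].
  split=> // e; rewrite /H1_edge -edomE; split; [exact: iu|exact: ig|].
  by rewrite edomE; apply/primP => x; rewrite -edomE; exact: up.
split=> [e|]; first by rewrite edomE; case: (H e).
split=> [e|]; first by rewrite edomE; case: (H e).
by split=> // e x; rewrite edomE; apply/primP: x; case: (H e).
Qed.

Lemma H1_H1_edge u g e : H1 u g -> H1_edge (edge_len e) (u e) (g e).
Proof. by move=> /H1P[]. Qed.

Lemma H1_same_pt u g p q : H1 u g -> in_dom p -> in_dom q -> same_pt p q -> u p.1 p.2 = u q.1 q.2.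
Proof. by move=> /H1P[_ /vertex_valuesP]; apply. Qed.

Definition max_point u p : Prop :=
  in_dom p /\ forall q, in_dom q -> `|u q.1 q.2| <= `|u p.1 p.2|.

Lemma H1_max_point u g : noncompact G -> H1 u g -> exists p, max_point u p.
Proof.
move=> [e0 _] H.
have /choice[x hx] e : exists x, edge_dom (edge_len e) x /\
    forall y, edge_dom (edge_len e) y -> `|u e y| <= `|u e x|.
  by have [x] := H1_edge_max (pos_edge_len e) (H1_H1_edge e H); exists x.
have [i _ hi] := @arg_maxP _ _ _ e0 predT (fun e => `|u e (x e)|) isT.
exists (i, x i); split; first by rewrite in_domE; case: (hx i).
move=> [e y]; rewrite in_domE /= => Dy.
by apply: le_trans (hi e isT); case: (hx e) => _; apply.
Qed.

Section GagliardoNirenbergVariation.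
Variables (u g : 'I_(nE G) -> R -> R) (M : R).
Hypotheses (H : H1 u g) (M0 : 0 < M) (uM : forall p, in_dom p -> `|u p.1 p.2| <= M).

Let W e := \int[mu]_(x in edge_dom (edge_len e)) (gn_weight M (u e x) * `|g e x|).

Lemma edge_bound e x : edge_dom (edge_len e) x -> `|u e x| <= M.
Proof. by move=> Dx; apply: (uM (p := (e, x))); rewrite in_domE. Qed.

Lemma integrable_gn_weight e :
  mu.-integrable (edge_dom (edge_len e)) (EFin \o (fun x => gn_weight M (u e x) * `|g e x|)).
Proof.
apply: (H1_edge_integrable_slope (H1_H1_edge e H) (slope_bound_gn_prim M0) (C := M ^+ 2)).
  by move=> s _; exact: gn_weight_le.
exact: edge_bound.
Qed.

Let edge_variation phi e x : vertex_values u phi -> in_dom (e, x) ->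
  let Fend o := if o is Some v then gn_prim M (phi v) else 0 in
  `|gn_prim M (u e x) - Fend (Some (ghd G e))| + `|Fend (gtl G e) - gn_prim M (u e x)| <= W e.
Proof.
move=> uphi; rewrite in_domE /= => Dx; have [u0 ulen] := uphi e.
have variation y : x <= y -> edge_dom (edge_len e) y ->
    `|gn_prim M (u e x) - gn_prim M (u e 0)| + `|gn_prim M (u e y) - gn_prim M (u e x)| <= W e.
  move=> xy Dy; apply: (H1_edge_variation_le (H1_H1_edge e H) (slope_bound_gn_prim M0)
    (C := M ^+ 2) _ (@edge_bound e) (edge_dom_ge0 Dx) xy Dy).
  by move=> s _; exact: gn_weight_le.
rewrite -u0; case E : (gtl G e) => [w|].
  have Dlen : edge_dom (edge_len e) (glen G e) by have := in_dom_len e; rewrite in_domE.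
  rewrite -(ulen w E); apply: variation => //.
  by move: Dx; rewrite edge_domE /edge_len E => /andP[].
apply/ler_addgt0Pr => d d0.
have /cvgrPdist_lt/(_ d d0)[d' /= d'0 near0] := @continuous_gn_prim R M M0 0.
have uN : H1_edge None (u e) (g e) by have := H1_H1_edge e H; rewrite /edge_len E.
have [y [y0 xy uy]] := H1_halfline_small_value x uN d'0.
have := near0 (u e y); rewrite /ball_/= sub0r normrN gn_prim0 => /(_ uy).
have := variation y xy (ltac:(by rewrite edge_domE /edge_len E y0)).
by have := ler_distD (gn_prim M (u e y)) 0 (gn_prim M (u e x)); lra.
Qed.

Lemma gn_prim_variation s0 ss p : trail2 s0 ss -> in_dom p -> on_trail p s0 ss ->
  2 * gn_prim M (u p.1 p.2) <= graph_integral (fun e x => gn_weight M (u e x) * `|g e x|).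
Proof.
move=> tr pd /(on_trailP pd)[q [qd pq qin]]; rewrite (H1_same_pt H pd qd pq).
have [_ [phi uphi]] := (H1P u g).1 H.
have W0 e : 0 <= W e by apply: Rintegral_ge0 => x _; rewrite mulr_ge0// gn_weight_ge0.
have := trail_variation (F := fun p => gn_prim M (u p.1 p.2))
  (fun e x => edge_variation uphi) erefl W0 tr qd qin.
by apply: le_trans; rewrite ler_pM2l// ler_norm.
Qed.

End GagliardoNirenbergVariation.
End SobolevGraph.

(** * The sharp Gagliardo-Nirenberg inequality *)

Section GagliardoNirenberg.
Context {R : realType}.
Notation mu := (@lebesgue_measure R).
Variables (G : mgraph R) (u g : 'I_(nE G) -> R -> R).
Hypothesis H : H1 u g.
Implicit Types (e : 'I_(nE G)) (c M : R) (p : gpoint G).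

Definition gn_defect_density c M e x := (2 * `|g e x| - c * gn_weight M (u e x)) ^+ 2.

Definition gn_defect c M := graph_integral (gn_defect_density c M).

Lemma gn_defect_ge0 c M : 0 <= gn_defect c M.
Proof. by apply: graph_integral_ge0 => e x; exact: sqr_ge0. Qed.

Section Bounded.
Variable M : R.
Hypotheses (M0 : 0 < M) (uM : forall p, in_dom p -> `|u p.1 p.2| <= M).

Lemma integrable_exp6 e : mu.-integrable (edge_dom (edge_len e)) (EFin \o (fun x => u e x ^+ 6)).
Proof.
have mD := measurable_edge_dom (edge_len e); case: (H1_H1_edge e H) => iu _ _.
rewrite (_ : (fun x => u e x ^+ 6) = (fun x => u e x ^+ 4 * u e x ^+ 2)); last first.
  by apply/funext => x; rewrite -exprD.
apply: (@integrable_funM _ _ (M ^+ 4)) => //.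
  by apply: measurable_funX; exact: H1_edge_measurable (H1_H1_edge e H).
by move=> x Dx; rewrite normrX lerXn2r ?nnegrE ?(ltW M0)// (edge_bound uM).
Qed.

Let defect_density_expand c e : {in edge_dom (edge_len e), gn_defect_density c M e =1 fun x =>
  (4 * (g e x ^+ 2) + - (4 * c) * (gn_weight M (u e x) * `|g e x|)) +
  (c ^+ 2 * M ^+ 4 * u e x ^+ 2 + - c ^+ 2 * u e x ^+ 6)}.
Proof.
move=> x; rewrite inE => Dx; rewrite /gn_defect_density /gn_weight.
have gap2 := quartic_gap_sqr M0 (edge_bound uM Dx).
have u2 : `|u e x| ^+ 2 = u e x ^+ 2 by rewrite real_normK ?num_real.
have g2 : `|g e x| ^+ 2 = g e x ^+ 2 by rewrite real_normK ?num_real.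
by ring: gap2 u2 g2.
Qed.

Lemma gn_defect_edge c e :
  mu.-integrable (edge_dom (edge_len e)) (EFin \o gn_defect_density c M e) /\
  \int[mu]_(x in edge_dom (edge_len e)) gn_defect_density c M e x =
    4 * \int[mu]_(x in edge_dom (edge_len e)) (g e x ^+ 2)
    - 4 * c * \int[mu]_(x in edge_dom (edge_len e)) (gn_weight M (u e x) * `|g e x|)
    + c ^+ 2 * (M ^+ 4 * \int[mu]_(x in edge_dom (edge_len e)) (u e x ^+ 2)
                - \int[mu]_(x in edge_dom (edge_len e)) (u e x ^+ 6)).
Proof.
have mD := measurable_edge_dom (edge_len e); case: (H1_H1_edge e H) => iu ig _.
have iw := integrable_gn_weight H M0 uM e; have iu6 := integrable_exp6 e.
have ig4 := integrable_funZl 4 mD ig; have iwc := integrable_funZl (- (4 * c)) mD iw.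
have iuM := integrable_funZl (c ^+ 2 * M ^+ 4) mD iu.
have iu6c := integrable_funZl (- c ^+ 2) mD iu6.
split.
  apply: (eq_integrable mD) (integrable_funD mD (integrable_funD mD ig4 iwc)
    (integrable_funD mD iuM iu6c)) => x Dx.
  by rewrite /= defect_density_expand.
rewrite (eq_Rintegral _ (defect_density_expand c (e := e))) RintegralD//.
- by rewrite !RintegralD// !RintegralZl//; ring.
- exact: integrable_funD.
- exact: integrable_funD.
Qed.

Lemma gn_defectE c : gn_defect c M =
  4 * normk 2 g - 4 * c * graph_integral (fun e x => gn_weight M (u e x) * `|g e x|)
  + c ^+ 2 * (M ^+ 4 * normk 2 u - normk 6 u).
Proof.
rewrite !normk_even// /gn_defect /graph_integral (eq_bigr _ (fun e _ => (gn_defect_edge c e).2)).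
by rewrite big_split/= sumrB -!mulr_sumr sumrB -mulr_sumr.
Qed.

End Bounded.

Lemma max_point_gt0 p : max_point u p -> 0 < normk 2 u -> 0 < `|u p.1 p.2|.
Proof.
move=> [_ up] m0; rewrite lt0r normr_ge0 andbT; apply: contraTneq m0 => u0.
rewrite normk_even// /graph_integral big1 ?ltxx// => e _.
rewrite (@eq_Rintegral _ _ _ mu _ (fun=> 0)); first by rewrite /Rintegral integral0.
move=> x; rewrite inE => Dx; apply/eqP; rewrite sqrf_eq0 -normr_le0 -u0.
by apply: (up (e, x)); rewrite in_domE.
Qed.

Lemma gn_defect_le p : assumptionH G -> max_point u p -> 0 < normk 2 u ->
  gn_defect (pi / normk 2 u) `|u p.1 p.2| <= 4 * normk 2 g - (pi / normk 2 u) ^+ 2 * normk 6 u.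
Proof.
move=> HG pmax m0; set c := pi / _; have M0 := max_point_gt0 pmax m0; case: pmax => pd uM.
have [s0 [ss [tr onp]]] := HG p pd.
have := gn_prim_variation H M0 uM tr pd onp.
rewrite (gn_defectE M0 uM) (gn_prim_max M0 erefl); set M := `|_| => varM.
have cm : c * normk 2 u = pi by rewrite /c divfK// gt_eqF.
have : 4 * c * (2 * (pi / 8 * M ^+ 4)) <=
    4 * c * graph_integral (fun e x => gn_weight M (u e x) * `|g e x|).
  by rewrite ler_wpM2l// mulr_ge0// divr_ge0 ?pi_ge0 ?normk_ge0.
have -> : 4 * c * (2 * (pi / 8 * M ^+ 4)) = c ^+ 2 * (M ^+ 4 * normk 2 u).
  by rewrite -cm; field.
by rewrite mulrBr; lra.
Qed.

Theorem gagliardo_nirenberg : noncompact G -> assumptionH G -> 0 < normk 2 u ->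
  pi ^+ 2 * normk 6 u <= 4 * normk 2 u ^+ 2 * normk 2 g.
Proof.
move=> ncG HG m0; have [p pmax] := H1_max_point ncG H.
have := le_trans (gn_defect_ge0 _ _) (gn_defect_le HG pmax m0).
rewrite subr_ge0 exprMn exprVn mulrAC ler_pdivrMr ?exprn_gt0//.
by rewrite [leRHS]mulrAC.
Qed.

End GagliardoNirenberg.

(** * Solitons *)

Section FundamentalTheorem.
Context {R : realType}.
Notation mu := (@lebesgue_measure R).
Implicit Types (F f : R -> R) (a b l : R).

Lemma Rintegral_FTC F f a b : a <= b -> (forall x : R, is_derive x 1 F (f x)) -> continuous f ->
  \int[mu]_(x in `[a, b]) f x = F b - F a.
Proof.
rewrite le_eqVlt => /predU1P[<- _ _|ab dF cf]; first by rewrite set_itv1 Rintegral_set1 subrr.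
have cF : continuous F by move=> x; exact: is_derive_continuous (dF x).
rewrite /Rintegral (continuous_FTC2 (F := F) ab)//.
- exact: continuous_subspaceT.
- split; [by move=> x _; case: (dF x)|exact/cvg_at_right_filter/cF|exact/cvg_at_left_filter/cF].
- by move=> x _; rewrite derive1E; case: (dF x).
Qed.

Lemma integral_even_FTC F f l : (forall x : R, 0 <= f x) -> (forall x : R, f (- x) = f x) ->
  (forall x : R, is_derive x 1 F (f x)) -> continuous f -> F x @[x --> +oo] --> l ->
  (\int[mu]_x (f x)%:E = (2 * (l - F 0))%:E)%E.
Proof.
move=> f0 fN dF cf Fl; rewrite ge0_symfun_integralT//; last by move=> x /=; rewrite fN.
have cF : continuous F by move=> x; exact: is_derive_continuous (dF x).
rewrite -set_itvcy (@ge0_continuous_FTC2y R f F 0 l)// -?EFinM//.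
- exact: continuous_subspaceT.
- exact/cvg_at_right_filter/cF.
- by move=> x _; rewrite derive1E; case: (dF x).
Qed.

End FundamentalTheorem.

Section HyperbolicSecant.
Context {R : realType}.
Notation mu := (@lebesgue_measure R).
Implicit Types (k t x y : R).

Definition sech x := 2 / (expR x + expR (- x)).
Definition tanh x := (expR x - expR (- x)) / (expR x + expR (- x)).

Let den_gt0 x : 0 < expR x + expR (- x).
Proof. by rewrite addr_gt0 ?expR_gt0. Qed.

Let den_neq0 x : expR x + expR (- x) != 0.
Proof. by rewrite gt_eqF. Qed.

Lemma sech_gt0 x : 0 < sech x.
Proof. by rewrite divr_gt0. Qed.

Lemma sech_ge0 x : 0 <= sech x.
Proof. exact/ltW/sech_gt0. Qed.

Lemma sechN x : sech (- x) = sech x.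
Proof. by rewrite /sech opprK addrC. Qed.

Lemma sech_norm x : sech `|x| = sech x.
Proof. by case: (ger0P x) => // _; rewrite sechN. Qed.

Lemma tanhN x : tanh (- x) = - tanh x.
Proof. by rewrite /tanh opprK -mulNr opprB (addrC (expR (- x)) (expR x)). Qed.

Lemma sech_sqrD_tanh_sqr x : sech x ^+ 2 + tanh x ^+ 2 = 1.
Proof.
rewrite /sech /tanh; have := expRxMexpNx_1 x; have := den_neq0 x.
by move: (expR x) (expR (- x)) => a b ab E; field: E.
Qed.

Lemma tanh_sqr x : tanh x ^+ 2 = 1 - sech x ^+ 2.
Proof. by rewrite -(sech_sqrD_tanh_sqr x) addrAC subrr add0r. Qed.

Lemma tanh_le1 x : `|tanh x| <= 1.
Proof.
rewrite -(@ler_pXn2r _ 2) ?nnegrE// expr1n real_normK ?num_real//.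
by rewrite -(sech_sqrD_tanh_sqr x) lerDr sqr_ge0.
Qed.

Lemma tanh_ge0 x : 0 <= x -> 0 <= tanh x.
Proof. by move=> x0; apply: divr_ge0; [rewrite subr_ge0 ler_expR; lra|exact/ltW/den_gt0]. Qed.

(* cosh y - cosh x = (e ^ y - e ^ x) (1 - e ^ - (x + y)) / 2 *)
Lemma ler_sech x y : (sech x <= sech y) = (`|y| <= `|x|).
Proof.
rewrite -(sech_norm x) -(sech_norm y).
have sech_decr : {in Num.nneg &, {mono (@sech) : a b /~ a <= b}}.
  apply: le_nmono_in => a b; rewrite !nnegrE => a0 b0 ba.
  rewrite /sech ltr_pM2l// ltf_pV2 ?posrE// -subr_gt0.
  have -> : expR a + expR (- a) - (expR b + expR (- b)) =
      (expR a - expR b) * (1 - expR (- a) * expR (- b)).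
    have := expRxMexpNx_1 a; have := expRxMexpNx_1 b.
    by move: (expR a) (expR (- a)) (expR b) (expR (- b)) => p p' q q' qq' pp'; ring: pp' qq'.
  by rewrite mulr_gt0// subr_gt0 ?ltr_expR// -expRD expR_lt1; lra.
by rewrite sech_decr ?nnegrE.
Qed.

Lemma sech_inj_norm x y : sech x = sech y -> `|x| = `|y|.
Proof. by move=> /eqP; rewrite eq_le !ler_sech => /le_anti/esym. Qed.

Lemma sech_le1 x : sech x <= 1.
Proof.
have -> : 1 = sech 0 by rewrite /sech oppr0 expR0 divff.
by rewrite ler_sech normr0.
Qed.

(* The left-hand side is exp (arsech t) * t. *)
Lemma sech_le_profile t x : t <= 1 -> 1 + Num.sqrt (1 - t ^+ 2) <= expR x * t -> sech x <= t.
Proof.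
move=> t1; set p := Num.sqrt _ => profile; have p0 : 0 <= p by exact: sqrtr_ge0.
have t0 : 0 < t by rewrite -(pmulr_rgt0 t (expR_gt0 x)); lra.
have p2 : p ^+ 2 = 1 - t ^+ 2 by rewrite sqr_sqrtr// subr_ge0 expr_le1// ltW.
rewrite /sech ler_pdivrMr//; have := expRxMexpNx_1 x; have := expR_gt0 x.
move: (expR x) (expR (- x)) profile => a b profile a0 ab.
rewrite -subr_ge0 -(pmulr_rge0 _ (mulr_gt0 a0 t0)).
have -> : a * t * (t * (a + b) - 2) = (a * t - 1 - p) * (a * t - 1 + p) by ring: ab p2.
by rewrite mulr_ge0//; lra.
Qed.

Let is_derive_expN x : is_derive x 1 (fun y : R => expR (- y)) (- expR (- x)).
Proof.
by apply: is_derive_eq (is_derive_fun_comp (is_derive_expR _) (is_deriveNid x 1)) _; rewrite mulrN1.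
Qed.

Let is_derive_den x :
  is_derive x 1 (fun y => expR y + expR (- y)) (expR x - expR (- x)).
Proof. exact: is_derive_funD (is_derive_expR x) (is_derive_expN x). Qed.

Lemma is_derive_sech x : is_derive x 1 sech (- (sech x * tanh x)).
Proof.
have dV := is_derive_funV (f := fun y => expR y + expR (- y)) (den_neq0 x) (is_derive_den x).
apply: is_derive_eq (is_derive_funZ 2 dV) _.
by rewrite /sech /tanh; have := den_neq0 x; move: (expR x) (expR (- x)) => a b ab; field.
Qed.

Lemma is_derive_tanh x : is_derive x 1 tanh (sech x ^+ 2).
Proof.
have dV := is_derive_funV (f := fun y => expR y + expR (- y)) (den_neq0 x) (is_derive_den x).
apply: is_derive_eq (is_derive_funM (is_derive_funB (is_derive_expR x) (is_derive_expN x)) dV) _.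
rewrite /sech; have := expRxMexpNx_1 x; have := den_neq0 x.
by move: (expR x) (expR (- x)) => a b ab E; field: E.
Qed.

Lemma continuous_sech : continuous sech.
Proof. by move=> x; exact: is_derive_continuous (is_derive_sech x). Qed.

Lemma continuous_tanh : continuous tanh.
Proof. by move=> x; exact: is_derive_continuous (is_derive_tanh x). Qed.

Definition sech_prim x := 2 * atan (expR x).

Lemma is_derive_sech_prim x : is_derive x 1 sech_prim (sech x).
Proof.
have datan := is_derive_fun_comp (is_derive1_atan _) (is_derive_expR x).
apply: is_derive_eq (is_derive_funZ 2 datan) _.
rewrite /sech; have := expRxMexpNx_1 x; have := den_neq0 x; have := expR_gt0 x.
move: (expR x) (expR (- x)) => a b a0 ab E.
have -> : b = a^-1 by apply: (mulfI (lt0r_neq0 a0)); rewrite E divff// gt_eqF.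
have -> : a + a^-1 = (1 + a ^+ 2) / a by field; rewrite gt_eqF.
by rewrite invf_div; ring.
Qed.

Definition sech3_prim x := 2^-1 * (sech x * tanh x + sech_prim x).

Lemma is_derive_sech3_prim x : is_derive x 1 sech3_prim (sech x ^+ 3).
Proof.
have dM := is_derive_funM (is_derive_sech x) (is_derive_tanh x).
apply: is_derive_eq (is_derive_funZ 2^-1 (is_derive_funD dM (is_derive_sech_prim x))) _.
by have := tanh_sqr x; move: (sech x) (tanh x) => a b E; field: E.
Qed.

Lemma cvgy_expR : @expR R x @[x --> +oo] --> +oo.
Proof.
apply/cvgryPge => A; near=> x; apply: le_trans (expR_ge1Dx x).
have : A <= x by near: x; apply: nbhs_pinfty_ge; rewrite num_real.
by move=> /le_trans; apply; rewrite lerDr.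
Unshelve. all: by end_near. Qed.

Lemma sech_le_expRN x : sech x <= 2 * expR (- x).
Proof.
rewrite /sech ler_wpM2l// -[leRHS]invrK lef_pV2 ?posrE ?invr_gt0 ?expR_gt0//.
by rewrite expRN invrK lerDl invr_ge0 expR_ge0.
Qed.

Lemma cvgy_sech : sech x @[x --> +oo] --> 0.
Proof.
apply: (@squeeze_cvgr _ _ _ _ (fun=> 0) (fun x => 2 * expR (- x))).
- by near=> x; rewrite sech_le_expRN sech_ge0.
- exact: cvg_cst.
- by rewrite -[0](mulr0 2); apply: cvgM; [exact: cvg_cst|exact: cvgr_expR].
Unshelve. all: by end_near. Qed.

Lemma cvgy_sech_prim : sech_prim x @[x --> +oo] --> pi.
Proof.
have -> : pi = 2 * (pi / 2) :> R by field.
by apply: cvgM; [exact: cvg_cst|exact: (cvg_comp _ _ cvgy_expR (@cvgy_atan R))].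
Qed.

Lemma sech_prim_bound x : 0 <= sech_prim x <= pi.
Proof.
have := atan_ltpi2 (expR x); have : 0 <= atan (expR x).
  by rewrite -[leLHS]atan0; apply: le_atan; exact: expR_ge0.
by rewrite /sech_prim; lra.
Qed.

Lemma cvgy_sech3_prim : sech3_prim x @[x --> +oo] --> pi / 2.
Proof.
rewrite mulrC -[X in _ * X]add0r; apply: cvgM; first exact: cvg_cst.
apply: cvgD; last exact: cvgy_sech_prim.
apply/norm_cvg0P; apply: (@squeeze_cvgr _ _ _ _ (fun=> 0) sech).
- near=> x; rewrite normr_ge0/= normrM (ger0_norm (sech_ge0 x)).
  by rewrite ler_piMr ?tanh_le1// sech_ge0.
- exact: cvg_cst.
- exact: cvgy_sech.
Unshelve. all: by end_near. Qed.

Lemma integral_sech k : 0 < k -> (\int[mu]_x (sech (k * x))%:E = (pi / k)%:E)%E.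
Proof.
move=> k0.
have dk x : is_derive x 1 (fun y => k^-1 * sech_prim (k * y)) (sech (k * x)).
  have := is_derive_fun_comp (is_derive_sech_prim (k * x)) (is_derive_funZ k (is_derive_id x 1)).
  by move=> /(is_derive_funZ k^-1)/is_derive_eq; apply; field; rewrite gt_eqF.
have lim : k^-1 * sech_prim (k * x) @[x --> +oo] --> k^-1 * pi.
  apply: cvgM; first exact: cvg_cst.
  apply: (cvg_comp (fun x : R => k * x) sech_prim _ cvgy_sech_prim).
  by apply: gt0_cvgMry => //; exact: cvg_id.
rewrite (integral_even_FTC _ _ dk _ lim).
- by rewrite mulr0 /sech_prim expR0 atan1; congr EFin; field; rewrite gt_eqF.
- by move=> x; exact: sech_ge0.
- by move=> x; rewrite mulrN sechN.
- by apply: continuous_fun_comp continuous_sech; exact: mulrl_continuous.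
Qed.

Lemma integral_sech3 : (\int[mu]_x (sech x ^+ 3)%:E = (pi / 2)%:E)%E.
Proof.
rewrite (integral_even_FTC _ _ is_derive_sech3_prim _ cvgy_sech3_prim).
- have tanh0 : tanh 0 = 0 by rewrite /tanh oppr0 subrr mul0r.
  by rewrite /sech3_prim tanh0 /sech_prim expR0 atan1; congr EFin; field.
- by move=> x; rewrite exprn_ge0// sech_ge0.
- by move=> x; rewrite sechN.
- exact/continuous_funX/continuous_sech.
Qed.

End HyperbolicSecant.

Section Soliton.
Context {R : realType}.
Notation mu := (@lebesgue_measure R).
Implicit Types x : R.

Definition soliton x := Num.sqrt (sech x).
Definition dsoliton x := - 2^-1 * (soliton x * tanh x).

Lemma soliton_gt0 x : 0 < soliton x.
Proof. by rewrite sqrtr_gt0 sech_gt0. Qed.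

Lemma soliton_sqr x : soliton x ^+ 2 = sech x.
Proof. by rewrite sqr_sqrtr// sech_ge0. Qed.

Lemma soliton_exp6 x : soliton x ^+ 6 = sech x ^+ 3.
Proof. by rewrite -soliton_sqr -exprM. Qed.

Lemma soliton_le1 x : soliton x <= 1.
Proof. by rewrite -sqrtr1 ler_wsqrtr// sech_le1. Qed.

Lemma solitonN x : soliton (- x) = soliton x.
Proof. by rewrite /soliton sechN. Qed.

Lemma is_derive_soliton x : is_derive x 1 soliton (dsoliton x).
Proof.
apply: is_derive_eq (is_derive_fun_sqrt (sech_gt0 x) (is_derive_sech x)) _.
rewrite /dsoliton -/(soliton x) -soliton_sqr.
by have := soliton_gt0 x; move: (soliton x) (tanh x) => a b a0; field; rewrite gt_eqF.
Qed.

Lemma continuous_soliton : continuous soliton.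
Proof. by move=> x; exact: is_derive_continuous (is_derive_soliton x). Qed.

Lemma continuous_dsoliton : continuous dsoliton.
Proof.
move=> x; apply: cvgM; first exact: cvg_cst.
by apply: cvgM; [exact: continuous_soliton|exact: continuous_tanh].
Qed.

Lemma dsoliton_sqr x : dsoliton x ^+ 2 = 4^-1 * (sech x - sech x ^+ 3).
Proof.
rewrite /dsoliton; have := tanh_sqr x; have := soliton_sqr x.
by move: (soliton x) (sech x) (tanh x) => a b c ab bc; field: ab bc.
Qed.

Lemma integral_soliton_sqr : (\int[mu]_x (soliton x ^+ 2)%:E = pi%:E)%E.
Proof.
have := integral_sech (@ltr01 R); rewrite divr1 => <-.
by apply: eq_integral => x _; rewrite mul1r soliton_sqr.
Qed.

Lemma integral_soliton_exp6 : (\int[mu]_x (soliton x ^+ 6)%:E = (pi / 2)%:E)%E.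
Proof. by rewrite -integral_sech3; apply: eq_integral => x _; rewrite soliton_exp6. Qed.

Lemma integral_dsoliton_sqr : (\int[mu]_x (dsoliton x ^+ 2)%:E = (pi / 8)%:E)%E.
Proof.
have integrableT (F : R -> R) I : continuous F -> (forall x, 0 <= F x) ->
    (\int[mu]_x (F x)%:E = I%:E)%E -> mu.-integrable [set: R] (EFin \o F).
  move=> cF F0 FI; apply/integrableP; split.
    by apply/measurable_EFinP; exact: continuous_measurable_fun.
  by under eq_integral do rewrite /= ger0_norm//; rewrite FI ltry.
have isech := integrableT _ _ (continuous_funX (n := 2) continuous_soliton)
  (fun x => sqr_ge0 _) integral_soliton_sqr.
have isech3 := integrableT _ _ (continuous_funX (n := 6) continuous_soliton)
  (fun x => exprn_ge0 6 (ltW (soliton_gt0 x))) integral_soliton_exp6.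
under eq_integral do rewrite dsoliton_sqr -soliton_exp6 -soliton_sqr mulrBr EFinB
  (EFinM _ (_ ^+ 2)) (EFinM _ (_ ^+ 6)).
rewrite integralB//; [|exact: integrableZl|exact: integrableZl].
rewrite !integralZl// integral_soliton_sqr integral_soliton_exp6 -!EFinM -EFinB.
by congr EFin; field.
Qed.

End Soliton.

Section TruncatedSoliton.
Context {R : realType}.
Notation mu := (@lebesgue_measure R).
Variable T : R.
Hypothesis T0 : 0 < T.
Implicit Types (f : R -> R) (x : R).

Let P : set (measurableTypeR R) := `[0, 2 * T].

Let lifted x := soliton (x - T) - soliton T.
Let dlifted x := dsoliton (x - T).

(* The soliton centred at T, lowered so as to vanish at 0 and 2 T. *)
Definition truncated_soliton : R -> R := lifted \_ P.
Definition dtruncated_soliton : R -> R := dlifted \_ P.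

Let mP : measurable P. Proof. exact: measurable_itv. Qed.

Let T20 : 0 <= 2 * T. Proof. by rewrite mulr_ge0// ltW. Qed.

Let inP x : P x -> 0 <= x <= 2 * T. Proof. by rewrite /P/= in_itv. Qed.

Let sub_halfline : P `<=` edge_dom None.
Proof. by move=> x /inP/andP[x0 _]; rewrite edge_domE x0. Qed.

Let continuous_shift f : continuous f -> continuous (fun x => f (x - T)).
Proof. by apply: continuous_fun_comp => x; apply: cvgB; [exact: cvg_id|exact: cvg_cst]. Qed.

Let is_derive_shift f f' : (forall x, is_derive x 1 f (f' x)) ->
  forall x, is_derive x 1 (fun y => f (y - T)) (f' (x - T)).
Proof.
move=> df x; have := is_derive_funB (is_derive_id x 1) (is_derive_cst T x 1).
move=> /(is_derive_fun_comp (g := fun y => y - T) (df (x - T)))/is_derive_eq; apply.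
by rewrite subr0 mulr1.
Qed.

Let continuous_lifted : continuous lifted.
Proof. by move=> x; apply: cvgB; [exact: (continuous_shift continuous_soliton)|exact: cvg_cst]. Qed.

Let continuous_dlifted : continuous dlifted.
Proof. exact: (continuous_shift continuous_dsoliton). Qed.

Let integrable_patch f : continuous f -> mu.-integrable (edge_dom None) (EFin \o (f \_ P)).
Proof.
move=> cf; rewrite -restrict_EFin; apply/integrable_restrict; rewrite ?(setIidr sub_halfline)//.
- exact: measurable_edge_dom.
- exact: continuous_integrable_itv.
Qed.

Let patch_exp f n : (fun x => (f \_ P) x ^+ n.+1) = (fun x => f x ^+ n.+1) \_ P.
Proof. by apply/funext => x; rewrite /patch; case: ifP => // _; rewrite expr0n. Qed.

Let Rintegral_patch_exp f n :
  \int[mu]_(x in edge_dom None) ((f \_ P) x ^+ n.+1) = \int[mu]_(x in P) (f x ^+ n.+1).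
Proof. by rewrite patch_exp -Rintegral_mkcondr (setIidr sub_halfline). Qed.

Let truncated_solitonE x : truncated_soliton x = if 0 <= x <= 2 * T then lifted x else 0.
Proof.
rewrite /truncated_soliton /patch; congr (if _ then _ else _).
by apply/idP/idP; rewrite inE /P/= in_itv.
Qed.

Lemma truncated_soliton0 : truncated_soliton 0 = 0.
Proof. by rewrite truncated_solitonE lexx T20 /lifted sub0r solitonN subrr. Qed.

Lemma H1_truncated_soliton : H1_edge None truncated_soliton dtruncated_soliton.
Proof.
split.
- by rewrite (patch_exp lifted 1); apply: integrable_patch; exact: continuous_funX.
- by rewrite (patch_exp dlifted 1); apply: integrable_patch; exact: continuous_funX.
move=> x Dx; split.
  apply: integrableS (integrable_patch continuous_dlifted) => //; first exact: measurable_edge_dom.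
  exact: edge_dom_sub.
move=> y /andP[y0 _]; rewrite truncated_soliton0 add0r -Rintegral_mkcondr.
pose z := Num.min y (2 * T).
have z0 : 0 <= z by rewrite le_min y0.
have -> : `[0, y] `&` P = `[0, z]%classic.
  apply/seteqP; split => t; rewrite /P/= !in_itv/= le_min.
    by move=> [/andP[-> ->] /andP[_ ->]].
  by move=> /andP[-> /andP[-> ->]].
rewrite (Rintegral_FTC z0 (is_derive_shift is_derive_soliton) continuous_dlifted).
rewrite truncated_solitonE y0 /= /lifted sub0r solitonN /z minElt.
have [yT|Ty] := ltP y (2 * T); first by rewrite (ltW yT).
have -> : 2 * T - T = T by ring.
rewrite subrr; case: ifP => // yT.
have -> : y = 2 * T by apply/eqP; rewrite eq_le yT Ty.
by rewrite (_ : 2 * T - T = T) ?subrr//; ring.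
Qed.

Let lifted_bound x : 0 <= x <= 2 * T -> 0 <= lifted x <= soliton (x - T).
Proof.
move=> xT; rewrite subr_ge0 lerBlDr lerDl (ltW (soliton_gt0 _)) andbT ler_wsqrtr// ler_sech.
by rewrite (gtr0_norm T0) ler_norml; lra.
Qed.

Let mass := @sech_prim R T - sech_prim (- T).

Let mass_le_pi : mass <= pi.
Proof. by have := sech_prim_bound T; have := sech_prim_bound (- T); rewrite /mass; lra. Qed.

Let integral_sech_shift : \int[mu]_(x in P) sech (x - T) = mass.
Proof.
rewrite (Rintegral_FTC T20 (is_derive_shift is_derive_sech_prim)
  (continuous_shift continuous_sech)).
by rewrite sub0r (_ : 2 * T - T = T)//; ring.
Qed.

Let integral_sech3_shift :
  \int[mu]_(x in P) (sech (x - T) ^+ 3) = sech T * tanh T + 2^-1 * mass.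
Proof.
rewrite (Rintegral_FTC T20 (is_derive_shift is_derive_sech3_prim)); last first.
  exact: continuous_funX (continuous_shift continuous_sech).
rewrite sub0r (_ : 2 * T - T = T); last by ring.
by rewrite /sech3_prim sechN tanhN /mass; field.
Qed.

Let edge_correction_ge0 : 0 <= @sech R T * tanh T.
Proof. by rewrite mulr_ge0 ?sech_ge0 ?tanh_ge0// ltW. Qed.

Lemma truncated_soliton_norm2 : \int[mu]_(x in edge_dom None) (truncated_soliton x ^+ 2) <= pi.
Proof.
rewrite Rintegral_patch_exp (le_trans _ mass_le_pi)// -integral_sech_shift.
apply: le_Rintegral => //.
- exact/continuous_integrable_itv/continuous_funX/continuous_lifted.
- exact/continuous_integrable_itv/(continuous_shift continuous_sech).
move=> x /inP/lifted_bound/andP[u0 us].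
by rewrite -soliton_sqr lerXn2r ?nnegrE// (ltW (soliton_gt0 _)).
Qed.

Lemma truncated_soliton_norm6_le : \int[mu]_(x in edge_dom None) (truncated_soliton x ^+ 6) <=
  \int[mu]_(x in edge_dom None) (truncated_soliton x ^+ 2).
Proof.
have cX n := continuous_integrable_itv 0 (2 * T) (continuous_funX (n := n) continuous_lifted).
rewrite !Rintegral_patch_exp; apply: le_Rintegral => // x /inP/lifted_bound/andP[u0 us].
by apply: ler_wiXn2l => //; exact: le_trans us (soliton_le1 _).
Qed.

Let exprB_ge n (a b : R) : 0 <= b -> b <= a ->
  a ^+ n.+1 - n.+1%:R * b * a ^+ n <= (a - b) ^+ n.+1.
Proof.
move=> b0 ba; have a0 := le_trans b0 ba.
elim: n => [|n IH]; first by rewrite !expr1 expr0 mulr1 mul1r.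
have := ler_wpM2l (_ : 0 <= a - b) IH; rewrite subr_ge0 => /(_ ba).
rewrite -exprS; apply: le_trans; rewrite -[in leLHS]natr1 -subr_ge0.
have -> : (a - b) * (a ^+ n.+1 - n.+1%:R * b * a ^+ n) -
    (a ^+ n.+2 - (n.+1%:R + 1) * b * a ^+ n.+1) = n.+1%:R * b ^+ 2 * a ^+ n.
  by rewrite !exprS; ring.
by rewrite !mulr_ge0 ?exprn_ge0.
Qed.

Lemma truncated_soliton_norm6_ge : 2^-1 * mass - 6 * pi * soliton T <=
  \int[mu]_(x in edge_dom None) (truncated_soliton x ^+ 6).
Proof.
rewrite Rintegral_patch_exp.
have csech := continuous_shift (@continuous_sech R).
have isech3 := continuous_integrable_itv 0 (2 * T) (continuous_funX (n := 3) csech).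
have isech := continuous_integrable_itv 0 (2 * T) csech.
have s0 := ltW (@soliton_gt0 R T).
apply: (@le_trans _ _ (\int[mu]_(x in P) (sech (x - T) ^+ 3 + - (6 * soliton T) * sech (x - T)))).
  rewrite RintegralD//; last exact: integrable_funZl.
  rewrite RintegralZl//.
  rewrite integral_sech3_shift integral_sech_shift.
  have := ler_wpM2l s0 mass_le_pi; have := edge_correction_ge0.
  by move: (sech T * tanh T) (soliton T) => a b; lra.
apply: le_Rintegral => //.
- by apply: integrable_funD => //; exact: integrable_funZl.
- exact/continuous_integrable_itv/continuous_funX/continuous_lifted.
move=> x /inP/lifted_bound; rewrite subr_ge0 => /andP[sx _].
rewrite -soliton_exp6 -soliton_sqr mulNr; apply: le_trans (exprB_ge 5 s0 sx).
rewrite lerD2l lerN2 ler_wpM2l ?mulr_ge0//.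
by apply: ler_wiXn2l => //; [exact: ltW (soliton_gt0 _)|exact: soliton_le1].
Qed.

Lemma dtruncated_soliton_norm2 :
  \int[mu]_(x in edge_dom None) (dtruncated_soliton x ^+ 2) <= pi / 8.
Proof.
have csech := continuous_shift (@continuous_sech R).
have isech3 := continuous_integrable_itv 0 (2 * T) (continuous_funX (n := 3) csech).
have isech := continuous_integrable_itv 0 (2 * T) csech.
rewrite Rintegral_patch_exp; under eq_Rintegral do rewrite dsoliton_sqr.
rewrite RintegralZl//; last first.
  apply: continuous_integrable_itv => x.
  by apply: cvgB; [exact: csech|exact: (continuous_funX (n := 3) csech)].
rewrite RintegralB// integral_sech_shift integral_sech3_shift.
by have := mass_le_pi; have := edge_correction_ge0; lra.
Qed.

End TruncatedSoliton.

Section Approximation.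
Context {R : realType}.
Notation mu := (@lebesgue_measure R).
Variable G : mgraph R.
Implicit Types (e : 'I_(nE G)) (w dw : R -> R) (d : R).

Definition on_edge e0 w e : R -> R := if e == e0 then w else fun=> 0.

Lemma H1_on_edge e0 w dw : gtl G e0 = None -> H1_edge None w dw -> w 0 = 0 ->
  H1 (on_edge e0 w) (on_edge e0 dw).
Proof.
move=> e0N H w0; apply/H1P; split=> [e|]; last first.
  exists (fun=> 0) => e; rewrite /on_edge; case: eqP => // ->.
  by rewrite w0 e0N.
rewrite /on_edge; case: eqP => [->|_]; first by rewrite /edge_len e0N.
have sqr0 : (fun _ : R => 0 ^+ 2) = (fun=> 0 : R) by rewrite expr0n.
split; [by rewrite sqr0; exact: integrable0|by rewrite sqr0; exact: integrable0|].
move=> x _; split=> [|y _]; first exact: integrable0.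
by rewrite /Rintegral integral0 addr0.
Qed.

Lemma normk_on_edge k e0 w : ~~ odd k -> (0 < k)%N -> gtl G e0 = None ->
  normk k (on_edge e0 w) = \int[mu]_(x in edge_dom None) (w x ^+ k).
Proof.
move=> k_even k0 e0N; rewrite normk_even// /graph_integral (bigD1 e0)//= big1 => [|e /negPf ee0].
  by rewrite /on_edge eqxx /edge_len e0N addr0.
rewrite /on_edge ee0; under eq_Rintegral do rewrite expr0n gtn_eqF//.
by rewrite /Rintegral integral0.
Qed.

Lemma cvg_truncated_mass :
  2^-1 * (@sech_prim R T - sech_prim (- T)) - 6 * pi * soliton T @[T --> +oo] --> pi / 2.
Proof.
have -> : pi / 2 = 2^-1 * (pi - 2 * atan 0) - 6 * pi * 0 :> R by rewrite atan0; field.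
apply: cvgB; apply: cvgM; [exact: cvg_cst| |exact: cvg_cst|].
  apply: cvgB; first exact: cvgy_sech_prim.
  apply: cvgM; first exact: cvg_cst.
  exact: (cvg_comp _ _ (@cvgr_expR R) (@continuous_atan R 0)).
rewrite -(@sqrtr0 R); exact: (cvg_comp _ _ cvgy_sech (@sqrt_continuous R 0)).
Qed.

Lemma gn_approximation d : noncompact G -> 0 < d -> exists u g : 'I_(nE G) -> R -> R,
  [/\ H1 u g, normk 2 u <= pi, normk 2 g <= pi / 8, normk 6 u <= normk 2 u &
      pi / 2 - d <= normk 6 u].
Proof.
move=> [e0 e0N] d0.
have [T [T0 Td]] : exists T, 0 < T /\
    pi / 2 - d <= 2^-1 * (@sech_prim R T - sech_prim (- T)) - 6 * pi * soliton T.
  suff : \forall T \near +oo, 0 < T /\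
      pi / 2 - d <= 2^-1 * (@sech_prim R T - sech_prim (- T)) - 6 * pi * soliton T.
    by move=> /filter_ex.
  near=> T; split; first by near: T; apply: nbhs_pinfty_gt; rewrite num_real.
  near: T; have /cvgrPdist_le/(_ d d0) := cvg_truncated_mass; apply: filterS => T.
  by rewrite ler_distl => /andP[]; lra.
exists (on_edge e0 (truncated_soliton T)), (on_edge e0 (dtruncated_soliton T)).
rewrite !normk_on_edge//; split.
- by apply: H1_on_edge => //; [exact: H1_truncated_soliton|exact: truncated_soliton0].
- exact: truncated_soliton_norm2.
- exact: dtruncated_soliton_norm2.
- exact: truncated_soliton_norm6_le.
- exact: le_trans Td (truncated_soliton_norm6_ge T0).
Unshelve. all: by end_near. Qed.

End Approximation.

(** * The critical mass and the energy level *)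

Section Scaling.
Context {R : realType}.
Notation mu := (@lebesgue_measure R).
Variable G : mgraph R.
Implicit Types (u g : 'I_(nE G) -> R -> R) (k : nat) (a : R).

Lemma H1_scale a u g : H1 u g -> H1 (fun e x => a * u e x) (fun e x => a * g e x).
Proof.
move=> /H1P[H [phi uphi]]; apply/H1P; split=> [e|]; last first.
  exists (fun v => a * phi v) => e; have [u0 ulen] := uphi e.
  by split=> [|w ew]; [rewrite u0|rewrite (ulen w ew)].
have mD := measurable_edge_dom (edge_len e); case: (H e) => iu ig up.
have sqrE (f : R -> R) : (fun x => (a * f x) ^+ 2) = (fun x => a ^+ 2 * f x ^+ 2).
  by apply/funext => x; rewrite exprMn.
split=> [||x /up[igx uE]]; [by rewrite sqrE; exact: integrable_funZl| |].
  by rewrite sqrE; exact: integrable_funZl.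
split=> [|y xy]; first exact: integrable_funZl.
rewrite RintegralZl//; first by rewrite (uE y xy) mulrDr.
by apply: integrableS igx => //; apply: subset_itvScc; rewrite bnd_simp//; case/andP: xy.
Qed.

Lemma normk_scale k a u : (forall e, measurable_fun (edge_dom (edge_len e)) (u e)) ->
  normk k (fun e x => a * u e x) = `|a| ^+ k * normk k u.
Proof.
move=> mu_; rewrite /normk mulr_sumr; apply: eq_bigr => e _; rewrite edomE.
have mD := measurable_edge_dom (edge_len e).
have muk : measurable_fun (edge_dom (edge_len e)) (fun x => (`|u e x| ^+ k)%:E).
  by apply/measurable_EFinP; apply: measurable_funX; exact: measurableT_comp.
have uk0 x : (0 <= (`|u e x| ^+ k)%:E)%E by rewrite lee_fin exprn_ge0.
under eq_integral do rewrite normrM exprMn EFinM.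
rewrite (@ge0_integralZl _ _ _ mu _ mD _ muk)// ?lee_fin ?exprn_ge0//.
have [->|a0] := eqVneq (`|a| ^+ k) 0; first by rewrite mul0e mul0r.
have ak0 : 0 < `|a| ^+ k by rewrite lt0r a0 exprn_ge0.
have : (0 <= \int[mu]_(x in edge_dom (edge_len e)) (`|u e x| ^+ k)%:E)%E by exact: integral_ge0.
by case: (integral _ _ _) => [r| |]//= _; rewrite gt0_muley ?lte_fin//= mulr0.
Qed.

End Scaling.

Section CriticalMass.
Context {R : realType}.
Implicit Types (G : mgraph R) (d : R).

Definition mass_crit : R := pi * Num.sqrt 3 / 2.

Let pi0 : 0 < pi :> R. Proof. exact: pi_gt0. Qed.

Let pin0 : pi != 0 :> R. Proof. exact: lt0r_neq0. Qed.

Lemma mass_crit_gt0 : 0 < mass_crit.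
Proof. by rewrite divr_gt0// mulr_gt0// sqrtr_gt0. Qed.

Lemma mass_crit_sqr : mass_crit ^+ 2 = 3 / 4 * pi ^+ 2.
Proof.
by rewrite /mass_crit expr_div_n exprMn sqr_sqrtr//; field.
Qed.

Lemma gn_ratio_le G (u g : 'I_(nE G) -> R -> R) : noncompact G -> assumptionH G ->
  H1 u g -> 0 < normk 2 u -> normk 6 u / (normk 2 u ^+ 2 * normk 2 g) <= 4 / pi ^+ 2.
Proof.
move=> ncG HG H m0; have := gagliardo_nirenberg H ncG HG m0.
have [->|g0] := eqVneq (normk 2 g) 0.
  by rewrite !mulr0 invr0 mulr0 => _; rewrite divr_ge0// exprn_ge0// ltW.
have {}g0 : 0 < normk 2 g by rewrite lt0r g0 normk_ge0.
move=> gn; rewrite ler_pdivrMr ?mulr_gt0 ?exprn_gt0// mulrAC ler_pdivlMr ?exprn_gt0//.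
by rewrite mulrC mulrA.
Qed.

Lemma gn_ratio_approximation G d : noncompact G -> assumptionH G -> 0 < d ->
  exists u g : 'I_(nE G) -> R -> R, [/\ H1 u g, 0 < normk 2 u &
    4 / pi ^+ 2 - d <= normk 6 u / (normk 2 u ^+ 2 * normk 2 g)].
Proof.
move=> ncG HG d0; pose e := Num.min (pi / 4) (d * pi ^+ 3 / 8).
have e0 : 0 < e by rewrite lt_min !divr_gt0 ?mulr_gt0 ?exprn_gt0.
have [epi ed] : e <= pi / 4 /\ e <= d * pi ^+ 3 / 8 by rewrite !ge_min !lexx orbT.
have [u [g [H m_pi g_pi m6 n6]]] := gn_approximation ncG e0; exists u, g.
have n60 : 0 < normk 6 u by move: pi0; lra.
have m0 : 0 < normk 2 u by exact: lt_le_trans m6.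
have g0 : 0 < normk 2 g.
  rewrite lt0r normk_ge0 andbT; apply/negP => /eqP g0.
  have := gagliardo_nirenberg H ncG HG m0; rewrite g0 mulr0 leNgt => /negP; apply.
  by rewrite mulr_gt0// exprn_gt0.
split => //; apply: (@le_trans _ _ (normk 6 u / (pi ^+ 2 * (pi / 8)))).
  have -> : 4 / pi ^+ 2 - d = (pi / 2 - d * pi ^+ 3 / 8) / (pi ^+ 2 * (pi / 8)).
    by move: (pi : R) pin0 => p p0; field.
  by rewrite ler_wpM2r ?invr_ge0 ?mulr_ge0 ?exprn_ge0 ?divr_ge0 ?(ltW pi0)// (le_trans _ n6)// lerB.
rewrite ler_wpM2l ?normk_ge0// lef_pV2 ?posrE ?mulr_gt0 ?exprn_gt0 ?divr_gt0//.
by rewrite ler_pM ?normk_ge0 ?exprn_ge0 ?normk_ge0// lerXn2r ?nnegrE ?normk_ge0 ?(ltW pi0).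
Qed.

Lemma KconstE G : noncompact G -> assumptionH G -> Kconst G = (4 / pi ^+ 2)%:E.
Proof.
move=> ncG HG; apply/eqP; rewrite eq_le; apply/andP; split.
  apply: ge_ereal_sup => _ [u [g [H [m0 ->]]]]; rewrite lee_fin.
  exact: gn_ratio_le.
apply/lee_addgt0Pr => d d0; have [u [g [H m0 ratio]]] := gn_ratio_approximation ncG HG d0.
rewrite -leeBlDr// -EFinB.
apply: le_trans (_ : (_ <= (normk 6 u / (normk 2 u ^+ 2 * normk 2 g))%:E)%E) _.
  by rewrite lee_fin.
by apply: ereal_sup_ubound; exists u, g.
Qed.

Lemma mucritE G : noncompact G -> assumptionH G -> mucrit G = mass_crit.
Proof.
move=> ncG HG; rewrite /mucrit KconstE//= invf_div -[RHS]ger0_norm ?(ltW mass_crit_gt0)//.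
by rewrite -sqrtr_sqr mass_crit_sqr; congr Num.sqrt; field.
Qed.

Lemma noncompact_Rline : noncompact (Rline R).
Proof. by exists ord0. Qed.

Lemma assumptionH_Rline : assumptionH (Rline R).
Proof.
move=> [e x] _; exists (ord0, false), [:: (lift ord0 ord0, true)]; split => //.
by left => /=; rewrite !inE; case: e => -[|[|//]] i.
Qed.

Lemma energy_crit_ge0 G (u g : 'I_(nE G) -> R -> R) : noncompact G -> assumptionH G ->
  H1 u g -> normk 2 u = mass_crit -> 0 <= energy u g.
Proof.
move=> ncG HG H um; have := gagliardo_nirenberg H ncG HG.
rewrite um mass_crit_sqr => /(_ mass_crit_gt0).
have -> : 4 * (3 / 4 * pi ^+ 2) * normk 2 g = pi ^+ 2 * (3 * normk 2 g) by field.
by rewrite ler_pM2l ?exprn_gt0// /energy; lra.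
Qed.

Lemma energy_rescaled G (u g : 'I_(nE G) -> R -> R) : H1 u g -> 0 < normk 2 u ->
  exists a, [/\ a ^+ 2 = mass_crit / normk 2 u,
    H1 (fun e x => a * u e x) (fun e x => a * g e x),
    normk 2 (fun e x => a * u e x) = mass_crit &
    energy (fun e x => a * u e x) (fun e x => a * g e x) =
      a ^+ 2 / 2 * (normk 2 g - pi ^+ 2 * normk 6 u / (4 * normk 2 u ^+ 2))].
Proof.
move=> H m0; exists (Num.sqrt (mass_crit / normk 2 u)); set a := Num.sqrt _.
have aE : a ^+ 2 = mass_crit / normk 2 u.
  by rewrite sqr_sqrtr// divr_ge0 ?normk_ge0// ltW// mass_crit_gt0.
have meas_u e := H1_edge_measurable (H1_H1_edge e H).
have meas_g e := H1_edge_measurable_grad (H1_H1_edge e H).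
have norma : `|a| = a by rewrite ger0_norm// sqrtr_ge0.
split => //; first exact: H1_scale.
  by rewrite normk_scale// norma aE divfK// gt_eqF.
rewrite /energy !normk_scale// norma.
have -> : a ^+ 6 = a ^+ 2 * (3 / 4 * pi ^+ 2 / normk 2 u ^+ 2).
  by rewrite -mass_crit_sqr -expr_div_n -aE -exprM -exprD.
by field; rewrite gt_eqF.
Qed.

Lemma energy_approximation G d : noncompact G -> 0 < d ->
  exists u g : 'I_(nE G) -> R -> R, [/\ H1 u g, normk 2 u = mass_crit & energy u g <= d].
Proof.
move=> ncG d0; have mc0 := mass_crit_gt0.
pose e := Num.min (pi / 4) (d * 2 * pi / mass_crit).
have e0 : 0 < e by rewrite lt_min !divr_gt0 ?mulr_gt0.
have [epi ed] : e <= pi / 4 /\ e <= d * 2 * pi / mass_crit by rewrite !ge_min !lexx orbT.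
have [u [g [H m_pi g_pi m6 n6]]] := gn_approximation ncG e0.
have m4 : pi / 4 <= normk 2 u by apply: le_trans m6; move: pi0; lra.
have m0 : 0 < normk 2 u by apply: lt_le_trans m4; rewrite divr_gt0.
have [a [aE Ha ma Ea]] := energy_rescaled H m0.
exists (fun e x => a * u e x), (fun e x => a * g e x); split; rewrite ?Ea//.
have gap : normk 2 g - pi ^+ 2 * normk 6 u / (4 * normk 2 u ^+ 2) <= e / 4.
  suff : normk 6 u / 4 <= pi ^+ 2 * normk 6 u / (4 * normk 2 u ^+ 2) by lra.
  rewrite ler_pdivlMr ?mulr_gt0 ?exprn_gt0//.
  have -> : normk 6 u / 4 * (4 * normk 2 u ^+ 2) = normk 2 u ^+ 2 * normk 6 u by field.
  by rewrite ler_wpM2r ?normk_ge0// lerXn2r ?nnegrE ?normk_ge0 ?(ltW pi0).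
have a_le : a ^+ 2 <= 4 * mass_crit / pi.
  have -> : 4 * mass_crit / pi = mass_crit / (pi / 4).
    by move: (pi : R) pin0 => p p0; field.
  by rewrite aE ler_wpM2l ?(ltW mc0)// lef_pV2 ?posrE ?divr_gt0.
have -> : d = 4 * mass_crit / pi / 2 * ((d * 2 * pi / mass_crit) / 4).
  by move: mass_crit mc0 (pi : R) pin0 => c c0 p p0; field; rewrite p0 gt_eqF.
apply: (le_trans (ler_wpM2l _ gap)); first by rewrite divr_ge0 ?sqr_ge0.
by rewrite ler_pM ?divr_ge0 ?sqr_ge0 ?(ltW e0)//; lra.
Qed.

Lemma Elevel_crit G : noncompact G -> assumptionH G -> Elevel G mass_crit = 0%E.
Proof.
move=> ncG HG; apply/eqP; rewrite eq_le; apply/andP; split; last first.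
  by apply: le_ereal_inf_tmp => _ [u [g [H [um ->]]]]; rewrite lee_fin energy_crit_ge0.
apply/lee_addgt0Pr => d d0; rewrite add0e; have [u [g [H um ud]]] := energy_approximation ncG d0.
apply: le_trans (_ : ((energy u g)%:E <= d%:E)%E); last by rewrite lee_fin.
by apply: ereal_inf_lbound; exists u, g.
Qed.

Definition gn_optimizer G (u g : 'I_(nE G) -> R -> R) : Prop :=
  [/\ H1 u g, 0 < normk 2 u & pi ^+ 2 * normk 6 u = 4 * normk 2 u ^+ 2 * normk 2 g].

Lemma attained_crit G : noncompact G -> assumptionH G ->
  attained G mass_crit <-> exists u g, @gn_optimizer G u g.
Proof.
move=> ncG HG; split=> [[u [g [H [um]]]]|[u [g [H m0 opt]]]].
  rewrite Elevel_crit// => -[E0]; exists u, g; split; rewrite ?um ?mass_crit_gt0//.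
  rewrite mass_crit_sqr; have -> : normk 6 u = 3 * normk 2 g by move: E0; rewrite /energy; lra.
  by field.
have [a [_ Ha ma Ea]] := energy_rescaled H m0.
exists (fun e x => a * u e x), (fun e x => a * g e x); split => //; split => //.
by rewrite Elevel_crit// Ea opt; congr EFin; field; rewrite gt_eqF.
Qed.

End CriticalMass.

(** * Path distances *)

Section Chains.
Context {R : realType} {T : Type}.
Variables (step : T * T -> bool) (cost : T * T -> R) (glue : T -> T -> bool).
Implicit Types (s t : T) (h : T -> R).

Definition chain s t (c : R) : Prop := exists c0 cs,
  [/\ c0.1 = s, (last c0 cs).2 = t, all step (c0 :: cs),
      path (fun a b => glue a.2 b.1) c0 cs & c = \sum_(a <- c0 :: cs) cost a].

Definition chain_dist s t : R := inf [set c | chain s t c].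

Lemma chain_step s t : step (s, t) -> chain s t (cost (s, t)).
Proof. by move=> st; exists (s, t), [::]; rewrite /= st big_seq1. Qed.

Lemma chain_cat s t t' r c d : chain s t c -> glue t t' -> chain t' r d -> chain s r (c + d).
Proof.
move=> [c0 [cs [<- <- oc pc ->]]] tt' [d0 [ds [h <- od pd ->]]].
exists c0, (cs ++ d0 :: ds); split => //.
- by rewrite last_cat.
- by rewrite -cat_cons all_cat oc.
- by rewrite cat_path pc /= h tt'.
- by rewrite -cat_cons big_cat.
Qed.

Lemma chain_ind (P : T -> T -> R -> Prop) :
  (forall s t, step (s, t) -> P s t (cost (s, t))) ->
  (forall s t t' r c, step (s, t) -> glue t t' -> chain t' r c -> P t' r c ->
     P s r (cost (s, t) + c)) ->
  forall s t c, chain s t c -> P s t c.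
Proof.
move=> Pstep Pcat s t c [c0 [cs [<- <- oc pc ->]]].
elim: cs c0 oc pc => [|c1 cs IH] [a b] /=.
  by rewrite andbT => oc _; rewrite big_seq1; exact: Pstep.
case/andP => oc occ /andP[gc pc]; rewrite big_cons; apply: (Pcat a b c1.1) => //.
  by exists c1, cs.
exact: IH.
Qed.

Lemma chain_potential h s t c :
  (forall a b, step (a, b) -> `|h a - h b| <= cost (a, b)) ->
  (forall a b b' d, step (a, b) -> step (b', d) -> glue b b' -> h b = h b') ->
  chain s t c -> `|h s - h t| <= c.
Proof.
move=> hcost hglue; elim/chain_ind => {s t c} [s t|s t t' r c st tt' ch IH]; first exact: hcost.
apply: (le_trans (ler_distD (h t) _ _)); apply: lerD; first exact: hcost.
case: ch tt' IH => -[a b] [cs [/= <- _ /andP[ab _] _ _]] tt'.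
by rewrite (hglue s t a b).
Qed.

Lemma chain_dist_ge s t d : (exists c, chain s t c) ->
  (forall c, chain s t c -> d <= c) -> d <= chain_dist s t.
Proof. by move=> ex hd; apply: lb_le_inf. Qed.

Hypothesis cost_ge0 : forall a, 0 <= cost a.

Lemma chain_dist_le s t c : chain s t c -> chain_dist s t <= c.
Proof.
move=> ch; apply: ge_inf => //; exists 0 => d /=.
by move=> /(chain_potential (h := fun=> 0)); rewrite subrr normr0; apply.
Qed.

Hypothesis step_sym : forall s t, step (s, t) = step (t, s).
Hypothesis cost_sym : forall s t, cost (s, t) = cost (t, s).
Hypothesis glue_sym : forall s t, glue s t = glue t s.

Lemma chain_sym s t c : chain s t c -> chain t s c.
Proof.
elim/chain_ind => {s t c} [s t st|s t t' r c st tt' _ IH].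
  by rewrite cost_sym; apply: chain_step; rewrite step_sym.
rewrite addrC cost_sym; apply: (chain_cat IH (t' := t)); first by rewrite glue_sym.
by apply: chain_step; rewrite step_sym.
Qed.

Lemma chain_dist_sym s t : chain_dist s t = chain_dist t s.
Proof. by congr inf; apply/seteqP; split => c; exact: chain_sym. Qed.

End Chains.

Section Tent.
Context {R : realType}.
Implicit Types (d r s t x y : R).

Definition tent s d r : R := Num.max 0 (d - `|r - s|).

Lemma tent_lipschitz s d x y : `|tent s d x - tent s d y| <= `|x - y|.
Proof.
rewrite /tent; have := ler_distD y x s; have := ler_distD x y s; rewrite (distrC y x).
move: `|x - s| `|y - s| `|x - y| => a b c ba ab.
by rewrite ler_norml; case: (leP 0 (d - a)) => ?; case: (leP 0 (d - b)) => ?; lra.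
Qed.

Lemma tent_far s d r : d <= `|r - s| -> tent s d r = 0.
Proof. by move=> h; rewrite /tent max_l// subr_le0. Qed.

Lemma tent_top s d : 0 <= d -> tent s d s = d.
Proof. by move=> d0; rewrite /tent subrr normr0 subr0 max_r. Qed.

Lemma tent_drop s d t : 0 <= d -> `|tent s d s - tent s d t| = Num.min d `|s - t|.
Proof.
move=> d0; rewrite tent_top// /tent (distrC t); move: `|s - t| (normr_ge0 (s - t)) => a a0.
case: (leP 0 (d - a)) => da; case: (leP d a) => da'; try lra.
- by rewrite ger0_norm; lra.
- by rewrite ger0_norm; lra.
- by rewrite subr0 ger0_norm.
Qed.

End Tent.

Section GraphDistance.
Context {R : realType}.
Variable G : mgraph R.
Implicit Types (e : 'I_(nE G)) (p q r : gpoint G) (c d x y z : R) (h : gpoint G -> R).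

Definition edge_step (a : gpoint G * gpoint G) := (a.1.1 == a.2.1) && in_dom a.1 && in_dom a.2.
Definition edge_cost (a : gpoint G * gpoint G) : R := `|a.1.2 - a.2.2|.
Definition reach := chain edge_step edge_cost (@same_pt R G).

Let edge_cost_ge0 a : 0 <= edge_cost a. Proof. exact: normr_ge0. Qed.

Lemma gdistE p q : gdist p q = chain_dist edge_step edge_cost (@same_pt R G) p q.
Proof.
congr inf; apply/seteqP; split => r /=.
  by move=> [c0 [cs [[c0p [csq [steps pth]]] ->]]]; exists c0, cs.
by move=> [c0 [cs [c0p csq steps pth ->]]]; exists c0, cs.
Qed.

Lemma edge_stepP p q :
  reflect (exists e x y, [/\ p = (e, x), q = (e, y), in_dom (e, x) & in_dom (e, y)])
          (edge_step (p, q)).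
Proof.
apply: (iffP idP) => [|[e [x [y [-> -> xd yd]]]]]; last by rewrite /edge_step /= eqxx xd.
by case: p q => [e x] [e' y] /andP[/andP[/= /eqP <- xd] yd]; exists e, x, y.
Qed.

Lemma reach_edge e x y : in_dom (e, x) -> in_dom (e, y) -> reach (e, x) (e, y) `|x - y|.
Proof.
move=> xd yd; apply: (chain_step edge_cost (@same_pt R G) (s := (e, x)) (t := (e, y))).
by rewrite /edge_step /= eqxx xd.
Qed.

Lemma reach_cat p q q' r c d : reach p q c -> same_pt q q' -> reach q' r d -> reach p r (c + d).
Proof. exact: chain_cat. Qed.

Lemma reach_same p q : in_dom p -> in_dom q -> same_pt p q -> reach p q 0.
Proof.
case: p q => [e x] [e' y] pd qd pq; rewrite -[0]addr0; apply: reach_cat pq _.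
  by have := reach_edge pd pd; rewrite subrr normr0.
by have := reach_edge qd qd; rewrite subrr normr0.
Qed.

Lemma reach_sym p q c : reach p q c -> reach q p c.
Proof.
apply: chain_sym => [a b|a b|a b].
- by rewrite /edge_step /= eq_sym andbAC.
- by rewrite /edge_cost distrC.
- by apply/idP/idP; exact: same_pt_sym.
Qed.

Lemma gconnected_reach p q : gconnected G -> in_dom p -> in_dom q -> exists c, reach p q c.
Proof.
move=> cG pd qd; have [c0 [cs [c0p [csq [steps pth]]]]] := cG p q pd qd.
by exists (\sum_(a <- c0 :: cs) edge_cost a), c0, cs.
Qed.

Lemma gdist_le p q c : reach p q c -> gdist p q <= c.
Proof. by move=> pq; rewrite gdistE; exact: chain_dist_le edge_cost_ge0 _ _ _ pq. Qed.

Lemma gdist_edge_le e x y : in_dom (e, x) -> in_dom (e, y) -> gdist (e, x) (e, y) <= `|x - y|.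
Proof. by move=> xd yd; apply: gdist_le; exact: reach_edge. Qed.

Lemma reach_potential h p q c :
  (forall e x y, in_dom (e, x) -> in_dom (e, y) -> `|h (e, x) - h (e, y)| <= `|x - y|) ->
  (forall a b, in_dom a -> in_dom b -> same_pt a b -> h a = h b) ->
  reach p q c -> `|h p - h q| <= c.
Proof.
move=> hedge hsame; apply: chain_potential.
  by move=> a b /edge_stepP[e [x [y [-> -> xd yd]]]]; exact: hedge.
by move=> a b b' d /andP[_ bd] /andP[/andP[_ b'd] _]; exact: hsame.
Qed.

Lemma gdist_potential h p q : gconnected G -> in_dom p -> in_dom q ->
  (forall e x y, in_dom (e, x) -> in_dom (e, y) -> `|h (e, x) - h (e, y)| <= `|x - y|) ->
  (forall a b, in_dom a -> in_dom b -> same_pt a b -> h a = h b) ->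
  `|h p - h q| <= gdist p q.
Proof.
move=> cG pd qd hedge hsame; rewrite gdistE; apply: chain_dist_ge.
  exact: gconnected_reach.
by move=> c; exact: reach_potential.
Qed.

Definition interior_pt e x := x \in open_itv 0 (edge_len e).

Lemma interior_in_dom e x : interior_pt e x -> in_dom (e, x).
Proof. by rewrite in_domE; exact: open_itv_edge_dom. Qed.

Lemma vtx_of_interior e x : interior_pt e x -> vtx_of (e, x) = None.
Proof.
rewrite /interior_pt in_open_itv /edge_len /vtx_of /= => /andP[x0 xl]; rewrite gt_eqF//.
by case: (gtl G e) xl => // w xl; rewrite lt_eqF.
Qed.

Lemma vtx_of_eq_None e x : in_dom (e, x) -> vtx_of (e, x) = None -> interior_pt e x.
Proof.
rewrite in_domE edge_domE /interior_pt in_open_itv /vtx_of /edge_len /= => /andP[x0 xl].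
case: eqP => // /eqP xn0; rewrite lt0r xn0 x0 /=.
by case: (gtl G e) xl => // w xl; case: eqP => // /eqP xnl _; rewrite lt_neqAle xnl.
Qed.

(* The potential is a tent on the edge e, extended by 0 to the other edges. *)
Lemma gdist_interior_ge e x d q : gconnected G -> 0 < d ->
  (forall y, `|y - x| < d -> interior_pt e y) -> in_dom q ->
  (if q.1 == e then Num.min d `|x - q.2| else d) <= gdist (e, x) q.
Proof.
move=> cG d0 inner qd; have xi : interior_pt e x by apply: inner; rewrite subrr normr0.
pose h p := if p.1 == e then tent x d p.2 else 0.
have := @gdist_potential h (e, x) q cG (interior_in_dom xi) qd.
have -> : `|h (e, x) - h q| = if q.1 == e then Num.min d `|x - q.2| else d.
  rewrite /h /= eqxx; case: ifP => // _; first exact/tent_drop/ltW.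
  by rewrite subr0 tent_top ?gtr0_norm ?ltW.
apply.
  move=> e' y z _ _; rewrite /h /=; case: ifP => // _; first exact: tent_lipschitz.
  by rewrite subrr normr0.
have h_vtx p v : vtx_of p = Some v -> h p = 0.
  case: p => e' y pv; rewrite /h /=; case: eqP => // ee; apply: tent_far.
  rewrite leNgt; apply/negP => /inner/vtx_of_interior.
  by rewrite -ee pv.
by move=> a b _ _ /same_ptP[->//|[v av bv]]; rewrite (h_vtx a v)// (h_vtx b v).
Qed.

Lemma gdist_interior_eq0 e x q : gconnected G -> interior_pt e x -> in_dom q ->
  gdist (e, x) q = 0 -> q = (e, x).
Proof.
move=> cG xi qd xq; have [d d0 inner] := open_itv_nbhs xi.
have := gdist_interior_ge cG d0 (fun y yx => inner y (ltW yx)) qd; rewrite xq.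
case: q qd xq => e' y _ _ /=; case: eqP => [->|_]; last by rewrite leNgt d0.
by rewrite ge_min leNgt d0 /= normr_le0 subr_eq0 => /eqP ->.
Qed.

Lemma gdist_interior_isometry e x : gconnected G -> interior_pt e x ->
  exists2 d, 0 < d & forall y z, `|y - x| < d -> `|z - x| < d ->
    [/\ in_dom (e, y), in_dom (e, z) & gdist (e, y) (e, z) = `|y - z|].
Proof.
move=> cG xi; have [r r0 inner] := open_itv_nbhs xi.
exists (r / 4) => [|y z]; first by rewrite divr_gt0.
move=> yx zx; have yz := ler_distD x y z; rewrite (distrC x) in yz.
have yi : interior_pt e y by apply: inner; lra.
have zi : interior_pt e z by apply: inner; lra.
have [yd zd] := (interior_in_dom yi, interior_in_dom zi); split => //.
have r20 : 0 < r / 2 by rewrite divr_gt0.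
have near_y t : `|t - y| < r / 2 -> interior_pt e t.
  by move=> ty; apply: inner; have := ler_distD y t x; lra.
have := gdist_interior_ge cG r20 near_y zd; rewrite /= eqxx ge_min => /orP[far|ge].
  by have := gdist_edge_le yd zd; lra.
by apply/eqP; rewrite eq_le ge gdist_edge_le.
Qed.

End GraphDistance.

Section GluedLine.
Context {R : realType}.
Implicit Types (s t a b x d : R) (xs : seq R) (h : R -> R).

Definition line_cost (c : R * R) : R := `|c.1 - c.2|.

Definition glue_reach xs := chain predT line_cost (glued xs).

Let line_cost_ge0 c : 0 <= line_cost c. Proof. exact: normr_ge0. Qed.

Lemma glue_reach_step xs s t : glue_reach xs s t `|s - t|.
Proof. exact: (chain_step line_cost (glued xs) (s := s) (t := t)). Qed.

Lemma glue_distE xs s t : glue_dist xs s t = chain_dist predT line_cost (glued xs) s t.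
Proof.
congr inf; apply/seteqP; split => r /=.
  by move=> [c0 [cs [c0s [cst [pth ->]]]]]; exists c0, cs; split => //; exact/allP.
by move=> [c0 [cs [c0s cst _ pth ->]]]; exists c0, cs.
Qed.

Lemma glue_dist_le xs s t : glue_dist xs s t <= `|s - t|.
Proof. by rewrite glue_distE; exact: chain_dist_le line_cost_ge0 _ _ _ (glue_reach_step _ _ _). Qed.

Lemma glued_sym xs s t : glued xs s t = glued xs t s.
Proof.
rewrite /glued eq_sym; congr orb; apply: eq_has => x.
by rewrite orbC andbC [X in _ || X]andbC.
Qed.

Lemma glue_dist_sym xs s t : glue_dist xs s t = glue_dist xs t s.
Proof.
rewrite !glue_distE; apply: chain_dist_sym => [|a b|a b] //; first by rewrite /line_cost distrC.
exact: glued_sym.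
Qed.

Lemma glue_dist_potential h xs s t : (forall a b, `|h a - h b| <= `|a - b|) ->
  (forall x, x \in xs -> h x = h (- x)) -> `|h s - h t| <= glue_dist xs s t.
Proof.
move=> hlip hglue; rewrite glue_distE; apply: chain_dist_ge.
  by exists `|s - t|; exact: glue_reach_step.
move=> c; apply: chain_potential => [a b _|a b b' d _ _]; first exact: hlip.
by case/orP => [/eqP->//|/hasP[x /hglue hx /orP[] /andP[/eqP-> /eqP->]]].
Qed.

Lemma glue_dist_nil s t : glue_dist [::] s t = `|s - t|.
Proof.
by apply/eqP; rewrite eq_le glue_dist_le /=; exact: (@glue_dist_potential id).
Qed.

Lemma glue_distxx xs s : glue_dist xs s s = 0.
Proof.
apply/eqP; rewrite eq_le; apply/andP; split.
  by have := glue_dist_le xs s s; rewrite subrr normr0.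
by have := @glue_dist_potential (fun=> 0) xs s s; rewrite subrr normr0; apply.
Qed.

Lemma glue_dist_norm xs s t : `| `|s| - `|t| | <= glue_dist xs s t.
Proof.
apply: (@glue_dist_potential (fun r => `|r|)) => [a b|x _]; last by rewrite normrN.
exact: ler_dist_dist.
Qed.

Lemma glue_dist_ge_min xs s t d : 0 <= d ->
  (forall x, x \in xs -> d <= `|x - s| /\ d <= `|x + s|) ->
  Num.min d `|s - t| <= glue_dist xs s t.
Proof.
move=> d0 far; rewrite -tent_drop//.
apply: (@glue_dist_potential (tent s d)) => [a b|x /far[xs1 xs2]]; first exact: tent_lipschitz.
by rewrite !tent_far// -opprD normrN.
Qed.

Let notin_gap (P : seq R) s : s \notin P ->
  exists2 d, 0 < d & forall x, x \in P -> d <= `|x - s|.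
Proof.
elim: P => [|p P IH]; first by exists 1.
rewrite inE negb_or => /andP[sp /IH[d d0 hd]].
exists (Num.min d `|p - s|); first by rewrite lt_min d0 normr_gt0 subr_eq0 eq_sym.
move=> x; rewrite inE => /orP[/eqP->|/hd h]; first by rewrite ge_min lexx orbT.
by rewrite ge_min h.
Qed.

Lemma unglued_gap xs s : s \notin xs -> - s \notin xs ->
  exists2 d, 0 < d & forall x, x \in xs -> d <= `|x - s| /\ d <= `|x + s|.
Proof.
move=> /notin_gap[d d0 hd] /notin_gap[d' d'0 hd'].
exists (Num.min d d') => [|x xin]; first by rewrite lt_min d0.
rewrite !ge_min hd//; split => //.
by have := hd' x xin; rewrite opprK => ->; rewrite orbT.
Qed.

Lemma glue_dist_eq0_unglued xs s t : s \notin xs -> - s \notin xs -> glue_dist xs s t = 0 -> t = s.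
Proof.
move=> s1 s2 st; have [d d0 far] := unglued_gap s1 s2.
have := glue_dist_ge_min t (ltW d0) far; rewrite st ge_min leNgt d0 /=.
by rewrite normr_le0 subr_eq0 => /eqP.
Qed.

Lemma glue_dist_isometry xs s : s \notin xs -> - s \notin xs -> exists2 d, 0 < d &
  forall a b, glue_dist xs s a < d -> glue_dist xs s b < d -> glue_dist xs a b = `|a - b|.
Proof.
move=> s1 s2; have [r r0 far] := unglued_gap s1 s2.
exists (r / 4) => [|a b]; first by rewrite divr_gt0.
have near_s t : glue_dist xs s t < r / 4 -> `|s - t| < r / 4.
  by move=> /(le_lt_trans (glue_dist_ge_min t (ltW r0) far)); rewrite gt_min => /orP[]//; lra.
move=> /near_s sa /near_s sb; have ab := ler_distD s a b; rewrite (distrC a s) in ab.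
have r20 : 0 <= r / 2 by rewrite divr_ge0// ltW.
have far_a x : x \in xs -> r / 2 <= `|x - a| /\ r / 2 <= `|x + a|.
  move=> /far[xs1 xs2]; have := ler_distD a x s; have := ler_distD (- a) x (- s).
  rewrite !opprK (distrC a s) (_ : `|- a + s| = `|s - a|); last by rewrite addrC.
  by move=> xNa xa; split; lra.
have := glue_dist_ge_min b r20 far_a; rewrite ge_min => /orP[h|h].
  by have := glue_dist_le xs a b; lra.
by apply/eqP; rewrite eq_le h glue_dist_le.
Qed.

End GluedLine.

(** * Unfolding a trail onto the line *)

Section Charts.
Context {R : realType}.
Variable G : mgraph R.
Implicit Types (A B : seq 'I_(nE G)) (f g : gpoint G -> R) (p q r : gpoint G).
Implicit Types (s : 'I_(nE G) * bool) (ss : seq ('I_(nE G) * bool)) (o a t x : R) (J : interval R).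

Definition over A p := in_dom p && (p.1 \in A).

(* The edges of A are laid isometrically end to end along the interval J. *)
Record chart A f J : Prop := Chart {
  chart_affine : forall e, e \in A -> exists k c : R,
    `|k| = 1 /\ forall x, f (e, x) = k * x + c;
  chart_reach : forall p q, over A p -> over A q -> reach p q `|f p - f q|;
  chart_inj : forall p q, over A p -> over A q -> f p = f q -> same_pt p q;
  chart_in : forall p, over A p -> f p \in J;
  chart_onto : forall t, t \in J -> exists2 p, over A p & f p = t }.

Definition step_pos s x : R := if s.2 then x else glen G s.1 - x.

Definition entry_pt s : gpoint G := (s.1, if s.2 then 0 else glen G s.1).
Definition exit_pt s : gpoint G := (s.1, if s.2 then glen G s.1 else 0).

Lemma in_dom_entry s : in_dom (entry_pt s).
Proof. by rewrite /entry_pt; case: (s.2); [exact: in_dom0|exact: in_dom_len]. Qed.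

Lemma in_dom_exit s : in_dom (exit_pt s).
Proof. by rewrite /exit_pt; case: (s.2); [exact: in_dom_len|exact: in_dom0]. Qed.

Lemma vtx_of_entry s v : (step_ends s).1 = Some v -> vtx_of (entry_pt s) = Some v.
Proof.
rewrite /step_ends /entry_pt; case: (s.2) => /=; last exact: vtx_of_len.
by rewrite vtx_of0.
Qed.

Lemma vtx_of_exit s v : (step_ends s).2 = Some v -> vtx_of (exit_pt s) = Some v.
Proof.
rewrite /step_ends /exit_pt; case: (s.2) => /=; first exact: vtx_of_len.
by rewrite vtx_of0.
Qed.

Lemma step_pos_entry s : step_pos s (entry_pt s).2 = 0.
Proof. by rewrite /step_pos /entry_pt; case: (s.2) => //=; rewrite subrr. Qed.

Lemma step_pos_exit s : step_pos s (exit_pt s).2 = glen G s.1.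
Proof. by rewrite /step_pos /exit_pt; case: (s.2) => //=; rewrite subr0. Qed.

Lemma step_posB s x y : `|step_pos s x - step_pos s y| = `|x - y|.
Proof. by rewrite /step_pos; case: (s.2) => //; rewrite -normrN; congr `|_|; ring. Qed.

Lemma step_posK s x : step_pos s (step_pos s x) = x.
Proof. by rewrite /step_pos; case: (s.2) => //; rewrite opprB addrC subrK. Qed.

(* A halfline entered from infinity occupies ]-oo, o + glen], whatever its
   irrelevant length glen is. *)
Definition step_itv o s : interval R :=
  Interval (if (step_ends s).1 is Some _ then BLeft o else -oo%O)
           (if (step_ends s).2 is Some _ then BRight (o + glen G s.1) else +oo%O).

Lemma in_step_itv o s x : (o + step_pos s x \in step_itv o s) = in_dom (s.1, x).
Proof.
rewrite /step_itv /step_pos /step_ends /in_dom in_itv; case: (s.2) => /=.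
  by rewrite lerDl; case: (gtl G s.1) => [w|] //=; rewrite lerD2l.
by case: (gtl G s.1) => [w|]; rewrite /= ?lerDl ?lerD2l ?gerDl ?oppr_le0 ?subr_ge0 ?andbT 1?andbC.
Qed.

Lemma step_chart o s : chart [:: s.1] (fun p => o + step_pos s p.2) (step_itv o s).
Proof.
have overE p : over [:: s.1] p -> exists2 x, p = (s.1, x) & in_dom (s.1, x).
  by case: p => e x; rewrite /over inE /= => /andP[pd /eqP ee]; exists x; rewrite -ee.
split.
- move=> e _; rewrite /step_pos; case: (s.2) => /=.
    by exists 1, o; rewrite normr1; split=> // x; rewrite mul1r addrC.
  by exists (-1), (o + glen G s.1); rewrite normrN normr1; split=> // x; ring.
- move=> p q /overE[x -> xd] /overE[y -> yd] /=.
  by rewrite opprD addrACA subrr add0r step_posB; exact: reach_edge.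
- move=> p q /overE[x -> _] /overE[y -> _] /= /addrI /(congr1 (step_pos s)).
  by rewrite !step_posK => ->; exact: same_pt_refl.
- by move=> p /overE[x -> xd]; rewrite in_step_itv.
- move=> t tJ; exists (s.1, step_pos s (t - o)); last by rewrite /= step_posK addrC subrK.
  by rewrite /over inE eqxx andbT -(in_step_itv o) step_posK addrC subrK.
Qed.

Section Concatenation.
Variables (A B : seq 'I_(nE G)) (f g : gpoint G -> R) (i j : itv_bound R) (a : R) (p q : gpoint G).
Hypotheses (cA : chart A f (Interval i (BRight a))) (cB : chart B g (Interval (BLeft a) j)).
Hypotheses (disj : ~~ has (mem A) B) (pA : over A p) (qB : over B q).
Hypotheses (fp : f p = a) (gq : g q = a) (pq : same_pt p q).

Let h r := if r.1 \in A then f r else g r.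

Let hA r : over A r -> h r = f r.
Proof. by rewrite /h => /andP[_ ->]. Qed.

Let hB r : over B r -> h r = g r.
Proof.
by rewrite /h => /andP[_ rB]; case: ifP => // rA; move/hasPn: disj => /(_ _ rB) /=; rewrite rA.
Qed.

Let over_cat r : over (A ++ B) r -> over A r \/ over B r.
Proof. by rewrite /over mem_cat => /andP[-> /orP]; case; [left|right]. Qed.

Let le_a r : over A r -> f r <= a.
Proof. by move=> /(chart_in cA); rewrite itv_boundlr => /andP[]. Qed.

Let ge_a r : over B r -> a <= g r.
Proof. by move=> /(chart_in cB); rewrite itv_boundlr => /andP[]. Qed.

Let reach_across r r' : over A r -> over B r' -> reach r r' `|f r - g r'|.
Proof.
move=> rA r'B; have -> : `|f r - g r'| = `|f r - f p| + `|g q - g r'|.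
  have := le_a rA; have := ge_a r'B => ar' ra.
  by rewrite fp gq !ler0_norm ?subr_le0//; [ring|exact: le_trans ar'].
exact: reach_cat (chart_reach cA rA pA) pq (chart_reach cB qB r'B).
Qed.

Let inj_across r r' : over A r -> over B r' -> f r = g r' -> same_pt r r'.
Proof.
move=> rA r'B frr'.
have fr : f r = a by apply/eqP; rewrite eq_le le_a//= frr' ge_a.
apply: same_pt_trans (same_pt_trans _ pq) _.
  by apply: chart_inj cA _ _ rA pA _; rewrite fr fp.
by apply: chart_inj cB _ _ qB r'B _; rewrite gq -frr' fr.
Qed.

Lemma chart_cat : chart (A ++ B) (fun r => if r.1 \in A then f r else g r) (Interval i j).
Proof.
have ia : (i <= BLeft a)%O by have := chart_in cA pA; rewrite fp itv_boundlr => /andP[].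
have aj : (BRight a <= j)%O by have := chart_in cB qB; rewrite gq itv_boundlr => /andP[].
rewrite -/h; split.
- move=> e; have [eA _|eA] := boolP (e \in A).
    by have [k [c [k1 fE]]] := chart_affine cA eA; exists k, c; split=> // x; rewrite /h eA.
  rewrite mem_cat (negPf eA) /= => eB.
  by have [k [c [k1 gE]]] := chart_affine cB eB; exists k, c; split=> // x; rewrite /h (negPf eA).
- move=> r r' /over_cat[rA|rB] /over_cat[r'A|r'B].
  + by rewrite !hA//; exact: chart_reach cA _ _ rA r'A.
  + by rewrite hA// hB//; exact: reach_across.
  + by rewrite hB// hA// distrC; exact/reach_sym/reach_across.
  + by rewrite !hB//; exact: chart_reach cB _ _ rB r'B.
- move=> r r' /over_cat[rA|rB] /over_cat[r'A|r'B].
  + by rewrite !hA//; exact: chart_inj cA _ _ rA r'A.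
  + by rewrite hA// hB//; exact: inj_across.
  + by rewrite hB// hA// => rr'; apply: same_pt_sym; exact: inj_across.
  + by rewrite !hB//; exact: chart_inj cB _ _ rB r'B.
- move=> r /over_cat[rA|rB].
    by have := chart_in cA rA; rewrite hA// !itv_boundlr => /andP[-> /le_trans]; apply.
  by have := chart_in cB rB; rewrite hB// !itv_boundlr => /andP[/(le_trans ia) -> ->].
- move=> t; rewrite itv_boundlr => /andP[it tj]; have [ta|/ltW at_] := leP t a.
    have [|r rA <-] := chart_onto cA (t := t); first by rewrite itv_boundlr it.
    by exists r; rewrite ?hA//; move: rA; rewrite /over mem_cat => /andP[-> ->].
  have [|r rB <-] := chart_onto cB (t := t); first by rewrite itv_boundlr tj andbT.
  by exists r; rewrite ?hB//; move: rB; rewrite /over mem_cat => /andP[-> ->]; rewrite orbT.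
Qed.

End Concatenation.

Lemma walk_chart o s ss : path (@step_adj R G) s ss -> uniq (map fst (s :: ss)) ->
  (step_ends (last s ss)).2 = None -> exists2 f, f (entry_pt s) = o &
  chart (map fst (s :: ss)) f
    (Interval (if (step_ends s).1 is Some _ then BLeft o else -oo%O) +oo%O).
Proof.
elim: ss s o => [|s' ss IH] s o /=.
  move=> _ _ sN; exists (fun p => o + step_pos s p.2); first by rewrite step_pos_entry addr0.
  by have := step_chart o s; rewrite /step_itv sN.
move=> /andP[/andP[/eqP ss']]; case E : (step_ends s).2 => [v|//] _ pth /andP[s_notin unq] lstN.
have [g g_entry] := IH s' (o + glen G s.1) pth unq lstN; rewrite -ss' E => cg.
have cs := step_chart o s; rewrite /step_itv E in cs.
exists (fun r => if r.1 \in [:: s.1] then o + step_pos s r.2 else g r).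
  by rewrite inE eqxx step_pos_entry addr0.
apply: (chart_cat (A := [:: s.1]) (p := exit_pt s) (q := entry_pt s') cs cg) => //.
- apply/hasPn => e /= es; rewrite inE; apply: contraNneq s_notin => <-; exact: es.
- by rewrite /over in_dom_exit inE eqxx.
- by rewrite /over in_dom_entry inE eqxx.
- by rewrite step_pos_exit.
- by apply: same_pt_vtx (vtx_of_exit E) (vtx_of_entry _); rewrite -ss'.
Qed.

Definition line_chart A f := chart A f `]-oo, +oo[.

Lemma line_chart_shift A f a : line_chart A f -> line_chart A (fun p => f p - a).
Proof.
have subrB x y : x - a - (y - a) = x - y by ring.
move=> cf; split=> //.
- move=> e /(chart_affine cf)[k [c [k1 fE]]]; exists k, (c - a); split=> // x.
  by rewrite fE addrA.
- by move=> p q pA qA; rewrite subrB; exact: chart_reach cf _ _ pA qA.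
- by move=> p q pA qA /addIr; exact: chart_inj cf _ _ pA qA.
- move=> t _; have [//|p pA fp] := chart_onto cf (t := t + a).
  by exists p => //; rewrite fp addrK.
Qed.

Lemma trail_chart s0 ss p : trail2 s0 ss -> exists2 f,
  line_chart (map fst (s0 :: ss)) f & f p = 0.
Proof.
move=> /and4P[pth unq /eqP s0N /eqP lstN].
have [f _ cf] := walk_chart 0 pth unq lstN; rewrite s0N in cf.
by exists (fun q => f q - f p); [exact: line_chart_shift|rewrite subrr].
Qed.

End Charts.

(** * Piecewise isometric changes of variables *)

Section FiniteSets.
Context {R : realType}.
Notation mu := (@lebesgue_measure R).
Implicit Type s : seq R.

Lemma measurable_seq s : measurable ([set` s] : set (measurableTypeR R)).
Proof.
apply: countable_measurable; first by move=> x; exact: measurable_set1.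
exact/finite_set_countable/finite_seq.
Qed.

Lemma measure0_seq s : mu [set` s] = 0%E.
Proof. by apply: countable_lebesgue_measure0; exact/finite_set_countable/finite_seq. Qed.

End FiniteSets.

Lemma normr_eq1 (R : realDomainType) (k : R) : `|k| = 1 -> k = 1 \/ k = -1.
Proof. by move/eqP; rewrite eqr_norml ler01 andbT => /orP[]/eqP; auto. Qed.

Section AffineInvariance.
Context {R : realType}.
Notation mu := (@lebesgue_measure R).
Implicit Types (k c a b : R).

Definition affine_map k c : measurableTypeR R -> measurableTypeR R := fun x => k * x + c.

Let measurable_affine k c : measurable_fun setT (affine_map k c).
Proof. by apply: measurable_funD => //; exact: measurable_funM. Qed.

HB.instance Definition _ k c :=
  isMeasurableFun.Build _ _ _ _ (affine_map k c) (measurable_affine k c).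

Let measure_affine_itv k c a b : `|k| = 1 -> mu (affine_map k c @^-1` `]a, b]) = mu `]a, b].
Proof.
have measure_itv_eq (i j : bool) (x y : R) : y - x = b - a ->
    mu [set` Interval (BSide i x) (BSide j y)] = mu `]a, b].
  move=> yx; rewrite !lebesgue_measure_itv/= !lte_fin -subr_gt0 yx subr_gt0.
  by rewrite -!EFinB yx.
case/normr_eq1 => ->.
  rewrite (_ : _ @^-1` _ = `]a - c, b - c]%classic); first by apply: measure_itv_eq; ring.
  by apply/seteqP; split => x /=; rewrite /affine_map !in_itv/= mul1r; lra.
rewrite (_ : _ @^-1` _ = `[c - b, c - a[%classic); first by apply: measure_itv_eq; ring.
by apply/seteqP; split => x /=; rewrite /affine_map !in_itv/= mulN1r; lra.
Qed.

Lemma integral_affine k c (J : set (measurableTypeR R)) (F : R -> \bar R) :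
  `|k| = 1 -> measurable J -> measurable_fun [set: measurableTypeR R] F -> (forall x, 0 <= F x)%E ->
  measurable (affine_map k c @` J) /\
  (\int[mu]_(x in J) F (affine_map k c x) = \int[mu]_(y in affine_map k c @` J) F y)%E.
Proof.
move=> k1 mJ mF F0; have kk : k * k = 1 by case/normr_eq1: k1 => ->; ring.
have affineK : cancel (affine_map k c) (affine_map k (- (k * c))).
  by move=> x; rewrite /affine_map; ring: kk.
have affineVK : cancel (affine_map k (- (k * c))) (affine_map k c).
  by move=> x; rewrite /affine_map; ring: kk.
have imE : affine_map k c @` J = affine_map k (- (k * c)) @^-1` J.
  apply/seteqP; split => [_ [x Jx <-]|y Jy] /=; first by rewrite affineK.
  by exists (affine_map k (- (k * c)) y).
have mI : measurable (affine_map k c @` J).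
  by rewrite imE -[X in measurable X]setTI; exact: measurable_affine.
split => //; have preE : affine_map k c @^-1` (affine_map k c @` J) = J.
  by rewrite imE; apply/seteqP; split => x /=; rewrite affineK.
rewrite -[in LHS]preE.
transitivity (\int[pushforward mu (affine_map k c)]_(y in affine_map k c @` J) F y)%E.
  by rewrite ge0_integral_pushforward//; exact: measurable_funS mF.
apply: eq_measure_integral => B mB _.
apply/esym/(@lebesgue_measure_unique R (pushforward mu (affine_map k c))) => // X.
by move=> [[a b] _ <-]; rewrite /= /pushforward measure_affine_itv.
Qed.

End AffineInvariance.

Section LocalIsometry.
Context {R : realType}.
Notation mu := (@lebesgue_measure R).
Implicit Types (f : R -> R) (a x y k d : R) (b : option R) (Q : seq R).
Implicit Types (D : set (measurableTypeR R)).

Definition local_isom f x := exists2 d, 0 < d &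
  forall y z, `|y - x| < d -> `|z - x| < d -> `|f y - f z| = `|y - z|.

Lemma is_derive_near_affine f x k d : 0 < d ->
  (forall y, `|y - x| < d -> f y = f x + k * (y - x)) -> is_derive x 1 f k.
Proof.
move=> d0 fE; have daff : is_derive x 1 (fun y => k * y + (f x - k * x)) k.
  have := is_derive_funD (is_derive_funZ k (is_derive_id x 1)) (is_derive_cst (f x - k * x) x 1).
  by move=> /is_derive_eq; apply; rewrite mulr1 addr0.
apply: near_eq_is_derive daff; exists d => //= y; rewrite /ball_/= distrC => /fE ->.
by ring.
Qed.

Lemma local_isom_affine f x : local_isom f x -> exists d,
  [/\ `|derive1 f x| = 1, 0 < d & forall y, `|y - x| < d ->
      f y = f x + derive1 f x * (y - x) /\ derive1 f y = derive1 f x].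
Proof.
move=> [d d0 isom].
have [h h0 hd] : exists2 h, 0 < h & h < d by exists (d / 2); lra.
have xx : `|x - x| < d by rewrite subrr normr0.
have xh : `|x + h - x| < d by rewrite addrAC subrr add0r gtr0_norm.
pose k := (f (x + h) - f x) / h.
have fxh : f (x + h) = f x + k * h by rewrite /k divfK ?gt_eqF//; ring.
have isom_sqr y z : `|y - x| < d -> `|z - x| < d -> (f y - f z) ^+ 2 = (y - z) ^+ 2.
  by move=> yx zx; rewrite -real_normK ?num_real// isom// real_normK ?num_real.
have k2 : k ^+ 2 = 1.
  have := isom_sqr _ _ xh xx; rewrite fxh; have -> : x + h - x = h by ring.
  have -> : f x + k * h - f x = k * h by ring.
  by rewrite exprMn -[RHS]mul1r => /mulIf; apply; rewrite expf_neq0// gt_eqF.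
have fE y : `|y - x| < d -> f y = f x + k * (y - x).
  move=> yx; have := isom_sqr _ _ yx xx; have := isom_sqr _ _ yx xh; rewrite fxh => eh ex.
  have /eqP : 2 * h * ((f y - f x) * k - (y - x)) = 0.
    have -> : 2 * h * ((f y - f x) * k - (y - x)) =
        ((f y - f x) ^+ 2 - (f y - (f x + k * h)) ^+ 2) -
        ((y - x) ^+ 2 - (y - (x + h)) ^+ 2) + (k ^+ 2 - 1) * h ^+ 2 by ring.
    by rewrite ex eh k2; ring.
  rewrite !mulf_eq0 pnatr_eq0 (gt_eqF h0)/= subr_eq0 => /eqP E.
  by rewrite -E; ring: k2.
have dE y : `|y - x| < d -> derive1 f y = k.
  move=> yx; rewrite derive1E; have dy0 : 0 < d - `|y - x| by rewrite subr_gt0.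
  have [] := @is_derive_near_affine f y k _ dy0 => // z zy.
  rewrite (fE y yx) fE; first by ring.
  by have := ler_distD y z x; lra.
exists d; rewrite (dE x xx); split => //; last by move=> y yx; rewrite dE// fE.
by apply/eqP; rewrite -(@eqrXn2 _ 2)// real_normK ?num_real// k2 expr1n.
Qed.

Lemma is_derive_local_isom f x : local_isom f x -> is_derive x 1 f (derive1 f x).
Proof.
by move=> /local_isom_affine[d [_ d0 fE]]; apply: (is_derive_near_affine d0) => y /fE[].
Qed.

Lemma local_isom_itv f a b : (forall x, x \in open_itv a b -> local_isom f x) ->
  exists k c, `|k| = 1 /\ forall x, x \in open_itv a b -> f x = k * x + c /\ derive1 f x = k.
Proof.
move=> isom.
have [[x0 x0i]|empty] := pselect (exists x, x \in open_itv a b); last first.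
  by exists 1, 0; rewrite normr1; split=> // x xi; exfalso; apply: empty; exists x.
have affine x y : x \in open_itv a b -> y \in open_itv a b -> x <= y ->
    f y = f x + derive1 f x * (y - x) /\ derive1 f y = derive1 f x.
  move=> xi yi xy; apply: (itv_local_to_global (P := fun x y =>
      f y = f x + derive1 f x * (y - x) /\ derive1 f y = derive1 f x) xy).
    by move=> u v w _ _ _ _ [fv dv] [fw dw]; rewrite fw dw fv dv; split=> //; ring.
  move=> z xzy; have zi : z \in open_itv a b by exact: open_itv_convex xi yi xzy.
  have [d [_ d0 fE]] := local_isom_affine (isom z zi); exists d => // u v _ uz zv _ uzd vzd.
  have [|fu du] := fE u; first by rewrite ler0_norm; lra.
  have [|fv dv] := fE v; first by rewrite ger0_norm; lra.
  by rewrite dv du fv fu; split=> //; ring.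
exists (derive1 f x0), (f x0 - derive1 f x0 * x0).
split; first by have [d []] := local_isom_affine (isom x0 x0i).
move=> x xi; have [x0x|/ltW xx0] := leP x0 x.
  by have [-> ->] := affine x0 x x0i xi x0x; split=> //; ring.
by have [-> ->] := affine x x0 xi x0i xx0; split=> //; ring.
Qed.

Definition punctured a b Q : set (measurableTypeR R) := [set` open_itv a b] `\` [set` Q].

Lemma puncturedE a b Q x : punctured a b Q x = (x \in open_itv a b) && (x \notin Q) :> Prop.
Proof. by apply/propext; split=> [[xi /negP xQ]|/andP[xi /negP xQ]]; [apply/andP; split|split]. Qed.

Lemma punctured_nil a b : punctured a b [::] = [set` open_itv a b].
Proof. by apply/seteqP; split=> x; rewrite puncturedE /= andbT. Qed.

Lemma measurable_punctured a b Q : measurable (punctured a b Q).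
Proof. by apply: measurableD; [exact: measurable_itv|exact: measurable_seq]. Qed.

Lemma punctured_notin a b Q q : q \notin open_itv a b -> punctured a b (q :: Q) = punctured a b Q.
Proof.
move=> qi; apply/seteqP; split=> x; rewrite !puncturedE inE negb_or => /andP[xi].
  by rewrite xi => /andP[].
by rewrite xi => ->; rewrite andbT; apply: contraNneq qi => <-.
Qed.

Lemma punctured_split a b Q q : q \in open_itv a b ->
  punctured a b (q :: Q) = punctured a (Some q) Q `|` punctured q b Q.
Proof.
rewrite in_open_itv => /andP[aq qb]; apply/seteqP; split => x.
  rewrite /setU/= !puncturedE !in_open_itv inE negb_or => /andP[/andP[-> ->] /andP[xq ->]].
  by rewrite !andbT /=; apply/orP; rewrite -neq_lt.
case; rewrite !puncturedE !in_open_itv inE negb_or.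
  move=> /andP[/andP[-> xq] ->]; rewrite (lt_eqF xq) /=.
  by rewrite andbT; case: b qb => // b; exact: lt_trans.
by move=> /andP[/andP[qx ->] ->]; rewrite (gt_eqF qx) (lt_trans aq qx).
Qed.

Lemma punctured_ind (P : set (measurableTypeR R) -> Prop) :
  (forall a b, P [set` open_itv a b]) ->
  (forall A B, measurable A -> measurable B -> [disjoint A & B] -> P A -> P B -> P (A `|` B)) ->
  forall Q a b, P (punctured a b Q).
Proof.
move=> Pitv PU; elim=> [|q Q IH] a b; first by rewrite punctured_nil.
have [qi|qi] := boolP (q \in open_itv a b); last by rewrite punctured_notin.
rewrite punctured_split//; apply: PU => //; try exact: measurable_punctured.
apply/disj_setPS => x []; rewrite !puncturedE !in_open_itv.
by move=> /andP[/andP[_ xq] _] /andP[/andP[qx _] _]; move: (lt_trans xq qx); rewrite ltxx.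
Qed.

Lemma punctured_measurable_fun f Q a b : (forall x, punctured a b Q x -> local_isom f x) ->
  measurable_fun (punctured a b Q) f /\ measurable_fun (punctured a b Q) (derive1 f).
Proof.
elim/punctured_ind: (punctured a b Q) => [{}a {}b isom|A B mA mB _ IHA IHB isom].
  have [k [c [_ fE]]] := local_isom_itv isom; split.
    apply: (eq_measurable_fun (affine_map k c)); last exact: measurable_funP.
    by move=> x; rewrite inE => /fE[->].
  by apply: (eq_measurable_fun (fun=> k)) => // x; rewrite inE => /fE[_ ->].
have [fA dA] := IHA (fun x xA => isom x (or_introl xA)).
have [fB dB] := IHB (fun x xB => isom x (or_intror xB)).
by split; exact/measurable_funU.
Qed.

Lemma punctured_transport f Q a b : (forall x, punctured a b Q x -> local_isom f x) ->
  (forall x y, punctured a b Q x -> punctured a b Q y -> f x = f y -> x = y) ->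
  measurable (f @` punctured a b Q : set (measurableTypeR R)) /\
  forall F : R -> \bar R, measurable_fun [set: measurableTypeR R] F -> (forall x, 0 <= F x)%E ->
    (\int[mu]_(x in punctured a b Q) F (f x) = \int[mu]_(y in f @` punctured a b Q) F y)%E.
Proof.
move=> isom; have [mf _] := punctured_measurable_fun isom; move: isom mf.
elim/punctured_ind: (punctured a b Q) => [{}a {}b isom _ _|A B mA mB AB IHA IHB isom mf inj].
  have [k [c [k1 fE]]] := local_isom_itv isom.
  have mI : measurable ([set` open_itv a b] : set (measurableTypeR R)) by exact: measurable_itv.
  have imE : f @` [set` open_itv a b] = affine_map k c @` [set` open_itv a b].
    by apply/seteqP; split => _ [x /[dup] xi /fE[fx _] <-]; exists x => //; rewrite fx.
  rewrite imE; split=> [|F mF F0].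
    by case: (integral_affine (F := fun=> 0%E) c k1 mI).
  rewrite -(integral_affine c k1 mI mF F0).2.
  by apply: eq_integral => x; rewrite inE => /fE[->].
have [mfA mfB] := (measurable_funU f mA mB).1 mf.
have [mA' tA] := IHA (fun x xA => isom x (or_introl xA)) mfA
  (fun x y xA yA => inj x y (or_introl xA) (or_introl yA)).
have [mB' tB] := IHB (fun x xB => isom x (or_intror xB)) mfB
  (fun x y xB yB => inj x y (or_intror xB) (or_intror yB)).
rewrite image_setU; split=> [|F mF F0]; first exact: measurableU.
rewrite !ge0_integral_setU//; first by rewrite tA// tB.
- exact: measurable_funS mF.
- apply/disj_setPS => _ [[x xA <-] [y yB yx]].
  have xy := inj x y (or_introl xA) (or_intror yB) (esym yx).
  by move/disj_setPS : AB => /(_ x); apply; split => //; rewrite xy.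
- by apply: (measurable_comp (F := setT)).
Qed.

Lemma integral_edge_punctured b Q (F : R -> \bar R) : measurable_fun (edge_dom b) F ->
  (forall x, 0 <= F x)%E ->
  (\int[mu]_(x in edge_dom b) F x = \int[mu]_(x in punctured 0 b Q) F x)%E.
Proof.
move=> mF F0; pose N : set (measurableTypeR R) := [set` [:: 0, odflt 0 b & Q]].
have sub : punctured 0 b Q `<=` edge_dom b.
  by move=> x; rewrite puncturedE => /andP[/open_itv_edge_dom].
have eqN : edge_dom b `\` N = punctured 0 b Q `\` N.
  apply/seteqP; split => x [xd xN]; split => //; last exact: sub.
  move/negP : (xN); rewrite !inE !negb_or => /and3P[xn0 xnl xQ].
  move: xd; rewrite edge_domE puncturedE in_open_itv xQ andbT => /andP[x0 xl].
  rewrite lt_def xn0 x0 /=.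
  by case: (b) xl xnl => [c|//] /= xc xnc; rewrite lt_neqAle xnc xc.
have [mN N0] : measurable N /\ mu N = 0%E by split; [exact: measurable_seq|exact: measure0_seq].
rewrite (@ge0_negligible_integral _ _ _ mu _ N)//; last exact: measurable_edge_dom.
rewrite eqN -ge0_negligible_integral//; first exact: measurable_punctured.
by apply: measurable_funS mF => //; exact: measurable_edge_dom.
Qed.

End LocalIsometry.

Section ChangeOfVariables.
Context {R : realType} {E : finType}.
Notation mu := (@lebesgue_measure R).
Variables (A : {pred E}) (l : E -> option R) (f : E -> R -> R) (Q : E -> seq R) (P : seq R).
Hypothesis isom : forall e x, e \in A -> punctured 0 (l e) (Q e) x -> local_isom (f e) x.
Hypothesis inj : forall e e' x x', e \in A -> e' \in A ->
  punctured 0 (l e) (Q e) x -> punctured 0 (l e') (Q e') x' -> f e x = f e' x' ->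
  e = e' /\ x = x'.
Hypothesis onto : forall t, t \notin P ->
  exists e x, [/\ e \in A, punctured 0 (l e) (Q e) x & f e x = t].
Implicit Types (e : E) (F : R -> R) (I : R).

Let piece e : set (measurableTypeR R) :=
  if e \in A then f e @` punctured 0 (l e) (Q e) else set0.

Let transport e : e \in A -> measurable (piece e) /\
  forall F, continuous F -> (forall x, 0 <= F x) ->
    measurable_fun (edge_dom (l e)) (fun x => F (f e x)) ->
    (\int[mu]_(x in edge_dom (l e)) (F (f e x))%:E = \int[mu]_(y in piece e) (F y)%:E)%E.
Proof.
move=> eA; rewrite /piece eA; have [mI tF] := punctured_transport (fun x => isom eA)
  (fun x y hx hy fxy => (inj eA eA hx hy fxy).2); split=> // F cF F0 mFf.
rewrite (integral_edge_punctured (Q e)).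
- rewrite (tF (fun y => (F y)%:E)) => [//||x]; last by rewrite lee_fin.
  by apply/measurable_EFinP; exact: continuous_measurable_fun.
- exact/measurable_EFinP.
- by move=> x; rewrite lee_fin.
Qed.

Let measurable_piece e : measurable (piece e).
Proof.
by have [/transport[]//|eA] := boolP (e \in A); rewrite /piece (negPf eA).
Qed.

Let trivIset_piece : trivIset [set` enum A] piece.
Proof.
apply/trivIsetP => e e' _ _ ee'; apply/seteqP; split => // y [].
rewrite /piece; case: ifPn => // eA [x xp <-]; case: ifPn => // e'A [x' xp' /esym fxx'].
by have [eq_ee' _] := inj eA e'A xp xp' fxx'; move: ee'; rewrite eq_ee' eqxx.
Qed.

Let measure_missed : mu (~` \big[setU/set0]_(e <- enum A) piece e) = 0%E.
Proof.
apply: countable_lebesgue_measure0; apply: (@sub_countable _ _ _ [set` P]); last first.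
  exact/finite_set_countable/finite_seq.
apply: subset_card_le => t /= missed; apply: contrapT => /negP/onto[e [x [eA xp xt]]].
apply: missed; rewrite -bigcup_seq; exists e; first by rewrite /= mem_enum.
by rewrite /piece eA; exists x.
Qed.

Lemma change_of_variables F : continuous F -> (forall x, 0 <= F x) ->
  (forall e, e \in A -> measurable_fun (edge_dom (l e)) (fun x => F (f e x))) ->
  (\sum_(e in A) \int[mu]_(x in edge_dom (l e)) (F (f e x))%:E = \int[mu]_x (F x)%:E)%E.
Proof.
move=> cF F0 mFf; pose T := \big[setU/set0]_(e <- enum A) piece e.
have mF : measurable_fun [set: measurableTypeR R] (fun x => (F x)%:E).
  by apply/measurable_EFinP; exact: continuous_measurable_fun.
have F0' x : (0 <= (F x)%:E)%E by rewrite lee_fin.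
have mT : measurable T by apply: bigsetU_measurable => e _; exact: measurable_piece.
have mFT : measurable_fun T (fun x => (F x)%:E) by exact: measurable_funS mF.
transitivity (\sum_(e in A) \int[mu]_(y in piece e) (F y)%:E)%E.
  by apply: eq_bigr => e eA; have [_ ->//] := transport eA; exact: mFf.
rewrite -big_enum/= -(ge0_integral_bigsetU mu measurable_piece (enum_uniq _) trivIset_piece mFT)//.
rewrite [RHS](ge0_negligible_integral _ _ _ _ measure_missed)//; first by rewrite setTD setCK.
exact: measurableC.
Qed.

Lemma change_of_variables_integrable F I : continuous F -> (forall x, 0 <= F x) ->
  (forall e, e \in A -> measurable_fun (edge_dom (l e)) (fun x => F (f e x))) ->
  (\int[mu]_x (F x)%:E = I%:E)%E ->
  (forall e, e \in A -> mu.-integrable (edge_dom (l e)) (EFin \o (fun x => F (f e x)))) /\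
  \sum_(e in A) \int[mu]_(x in edge_dom (l e)) F (f e x) = I.
Proof.
move=> cF F0 mFf FI; have := change_of_variables cF F0 mFf; rewrite FI => sumI.
have int0 e : (0 <= \int[mu]_(x in edge_dom (l e)) (F (f e x))%:E)%E.
  by apply: integral_ge0 => x _; rewrite lee_fin.
have fin e : e \in A -> (\int[mu]_(x in edge_dom (l e)) (F (f e x))%:E \is a fin_num)%E.
  move=> eA; rewrite ge0_fin_numE//; apply: (@le_lt_trans _ _ I%:E); last exact: ltry.
  by rewrite -sumI (bigD1 e)//= leeDl// sume_ge0.
split=> [e eA|].
  apply/integrableP; split; first by apply/measurable_EFinP; exact: mFf.
  under eq_integral do rewrite /= ger0_norm//.
  by rewrite -ge0_fin_numE// fin.
apply: EFin_inj; rewrite -sumI -sumEFin; apply: eq_bigr => e eA.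
by rewrite fineK// fin.
Qed.

End ChangeOfVariables.

Section PiecewisePrimitive.
Context {R : realType}.
Notation mu := (@lebesgue_measure R).
Implicit Types (f v w : R -> R) (a b x y k : R) (Q : seq R).

Lemma eq_Rintegral_itvoo a b v w : mu.-integrable `[a, b] (EFin \o v) ->
  mu.-integrable `[a, b] (EFin \o w) -> {in `]a, b[, v =1 w} ->
  \int[mu]_(x in `[a, b]) v x = \int[mu]_(x in `[a, b]) w x.
Proof.
have drop_ends f : mu.-integrable `[a, b] (EFin \o f) ->
    \int[mu]_(x in `[a, b]) f x = \int[mu]_(x in `]a, b[) f x.
  move=> if_; rewrite -Rintegral_itv_obnd_cbnd; last first.
    by apply: integrableS if_ => //; exact: subset_itv_oc_cc.
  rewrite -Rintegral_itv_bndo_bndc//.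
  by apply: integrableS if_ => //; exact: subset_itv_oo_cc.
move=> iv iw vw; rewrite !drop_ends//; apply: eq_Rintegral => x; rewrite inE; exact: vw.
Qed.

Variables V V' : R -> R.
Hypotheses (dV : forall x : R, is_derive x 1 V (V' x)) (cV' : continuous V').

Lemma affine_piece_primitive a b f w : a < b ->
  (forall x, x \in open_itv a (Some b) -> local_isom f x) ->
  {within `[a, b], continuous (V \o f)} -> mu.-integrable `[a, b] (EFin \o w) ->
  (forall x, x \in open_itv a (Some b) -> w x = derive1 f x * V' (f x)) ->
  V (f b) - V (f a) = \int[mu]_(x in `[a, b]) w x.
Proof.
move=> ab isom cVf iw wE; have [k [c [_ fE]]] := local_isom_itv isom.
have cpiece : continuous (fun x => k * V' (k * x + c)).
  move=> x; apply: cvgM; first exact: cvg_cst.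
  exact: (continuous_fun_comp (@continuous_affine _ k c) cV').
have dVf x : x \in `]a, b[ -> is_derive x 1 (V \o f) (k * V' (k * x + c)).
  move=> xab; have [fx dfx] := fE x xab.
  have df := is_derive_local_isom (isom x xab); rewrite dfx in df.
  by apply: is_derive_eq (is_derive_fun_comp (dV (f x)) df) _; rewrite fx mulrC.
have [_ cVa cVb] := (continuous_within_itvP _ ab).1 cVf.
have FTC : (\int[mu]_(x in `[a, b]) (k * V' (k * x + c))%:E = (V (f b))%:E - (V (f a))%:E)%E.
  rewrite (continuous_FTC2 (F := V \o f) ab)//; first exact: continuous_subspaceT.
    by split=> // x /dVf[].
  by move=> x /dVf[_ <-]; rewrite derive1E.
transitivity (\int[mu]_(x in `[a, b]) (k * V' (k * x + c))).
  by rewrite /Rintegral FTC.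
apply: eq_Rintegral_itvoo => //; first exact: continuous_integrable_itv.
by move=> x xab; rewrite wE//; have [-> ->] := fE x xab.
Qed.

Lemma piecewise_primitive Q a b f w : a < b ->
  (forall x, punctured a (Some b) Q x -> local_isom f x) ->
  {within `[a, b], continuous (V \o f)} -> mu.-integrable `[a, b] (EFin \o w) ->
  (forall x, punctured a (Some b) Q x -> w x = derive1 f x * V' (f x)) ->
  V (f b) - V (f a) = \int[mu]_(x in `[a, b]) w x.
Proof.
elim: Q a b => [|q Q IH] a b ab; first by rewrite punctured_nil; exact: affine_piece_primitive.
have [qi|qi] := boolP (q \in open_itv a (Some b)); last first.
  by rewrite punctured_notin//; exact: IH.
rewrite (punctured_split Q qi); move: qi; rewrite in_open_itv => /andP[aq qb] isom cVf iw wE.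
have sub1 : `[a, q] `<=` `[a, b] by apply: subset_itvScc; rewrite bnd_simp// ltW.
have sub2 : `[q, b] `<=` `[a, b] by apply: subset_itvScc; rewrite bnd_simp// ltW.
have left_part : V (f q) - V (f a) = \int[mu]_(x in `[a, q]) w x.
  apply: IH => // [x xp|||x xp]; [by apply: isom; left| | |by apply: wE; left].
    exact: continuous_subspaceW cVf.
  exact: integrableS iw.
have right_part : V (f b) - V (f q) = \int[mu]_(x in `[q, b]) w x.
  apply: IH => // [x xp|||x xp]; [by apply: isom; right| | |by apply: wE; right].
    exact: continuous_subspaceW cVf.
  exact: integrableS iw.
by rewrite (Rintegral_itv_cat (ltW aq) (ltW qb) iw) -left_part -right_part; ring.
Qed.

End PiecewisePrimitive.

(** * Rigidity of optimizers *)

Section ArcoshRegularization.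
Context {R : realType}.
Variables M n : R.
Hypotheses (M0 : 0 < M) (n0 : 0 < n).
Implicit Types (s t : R).

Definition rel_sqr s : R := s ^+ 2 / M ^+ 2.

(* As n tends to 0 this tends to arcosh (M ^ 2 / s ^ 2), the profile coordinate
   of the soliton; the regularisation removes the singularities at 0 and M. *)
Definition arcosh_reg s :=
  ln (1 + Num.sqrt (1 - rel_sqr s ^+ 2 + n)) - ln (rel_sqr s + n).

Let root s := Num.sqrt (`|1 - rel_sqr s ^+ 2| + n).

Definition arcosh_reg_weight s :=
  2 * `|s| / M ^+ 2 * (rel_sqr s / (root s * (1 + root s)) + (rel_sqr s + n)^-1).

Lemma rel_sqr_ge0 s : 0 <= rel_sqr s.
Proof. by rewrite divr_ge0 ?sqr_ge0. Qed.

Lemma rel_sqr_le1 s : `|s| <= M -> rel_sqr s <= 1.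
Proof.
move=> sM; rewrite ler_pdivrMr ?exprn_gt0// mul1r -(real_normK (num_real s)).
by rewrite lerXn2r ?nnegrE ?(ltW M0).
Qed.

Lemma rel_sqr_max s : `|s| = M -> rel_sqr s = 1.
Proof. by move=> sM; rewrite /rel_sqr -(real_normK (num_real s)) sM divff// expf_neq0// gt_eqF. Qed.

Let rel_sqrN1 s : `|s| <= M -> 0 <= 1 - rel_sqr s ^+ 2.
Proof. by move=> /rel_sqr_le1 t1; rewrite subr_ge0 expr_le1// rel_sqr_ge0. Qed.

Let root_gt0 s : 0 < root s.
Proof. by rewrite sqrtr_gt0 ltr_wpDl. Qed.

Let den_gt0 s : 0 < rel_sqr s + n.
Proof. by rewrite ltr_wpDl// rel_sqr_ge0. Qed.

Let rootE s : `|s| <= M -> root s = Num.sqrt (1 - rel_sqr s ^+ 2 + n).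
Proof. by move=> /rel_sqrN1 t1; rewrite /root ger0_norm. Qed.

Let core_ge0 s : 0 <= rel_sqr s / (root s * (1 + root s)) + (rel_sqr s + n)^-1.
Proof.
rewrite addr_ge0 ?invr_ge0 ?(ltW (den_gt0 s))// divr_ge0 ?rel_sqr_ge0//.
by rewrite mulr_ge0 ?addr_ge0 ?sqrtr_ge0.
Qed.

Lemma arcosh_reg_weight_ge0 s : 0 <= arcosh_reg_weight s.
Proof.
by apply: mulr_ge0; [rewrite divr_ge0 ?sqr_ge0 ?mulr_ge0|exact: core_ge0].
Qed.

Let continuous_rel_sqr : continuous rel_sqr.
Proof. by move=> s; apply: cvgM; [exact: exprn_continuous|exact: cvg_cst]. Qed.

Let continuous_root : continuous root.
Proof.
move=> s; apply: (@continuous_comp _ _ _ (fun s => `|1 - rel_sqr s ^+ 2| + n) Num.sqrt).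
  apply: cvgD; last exact: cvg_cst.
  apply: cvg_norm; apply: cvgB; first exact: cvg_cst.
  exact: continuous_funX.
exact: sqrt_continuous.
Qed.

Lemma continuous_arcosh_reg_weight : continuous arcosh_reg_weight.
Proof.
move=> s; apply: cvgM.
  apply: cvgM; last exact: cvg_cst.
  by apply: cvgM; [exact: cvg_cst|exact: cvg_norm].
apply: cvgD.
  apply: cvgM; first exact: continuous_rel_sqr.
  apply: cvgV; first by rewrite mulf_neq0// gt_eqF// addr_gt0.
  apply: cvgM; first exact: continuous_root.
  by apply: cvgD; [exact: cvg_cst|exact: continuous_root].
apply: cvgV; first by rewrite gt_eqF.
by apply: cvgD; [exact: continuous_rel_sqr|exact: cvg_cst].
Qed.

Let is_derive_arcosh_reg s : `|s| <= M -> is_derive s 1 arcosh_reg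
  (- (2 * s / M ^+ 2 * (rel_sqr s / (root s * (1 + root s)) + (rel_sqr s + n)^-1))).
Proof.
move=> sM.
have dt : is_derive s 1 rel_sqr (2 * s / M ^+ 2).
  have := is_derive_funZ (M ^+ 2)^-1 (is_derive_funX 2 (is_derive_id s 1)).
  rewrite (_ : (fun y => _) = rel_sqr); last by apply/funext => y; rewrite /rel_sqr mulrC.
  by move=> /is_derive_eq; apply; rewrite /= expr1 mulr1 mulrC.
have gap0 : 0 < 1 - rel_sqr s ^+ 2 + n by rewrite ltr_wpDl// rel_sqrN1.
have dgap := is_derive_funD (is_derive_funB (is_derive_cst (1 : R) s 1) (is_derive_funX 2 dt))
  (is_derive_cst n s 1).
have droot := is_derive_funD (is_derive_cst (1 : R) s 1)
  (is_derive_fun_sqrt (f := fun s => 1 - rel_sqr s ^+ 2 + n) gap0 dgap).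
have root1 : 0 < 1 + Num.sqrt (1 - rel_sqr s ^+ 2 + n) by rewrite -rootE// addr_gt0.
have dnum := is_derive_fun_comp (g := fun s => 1 + Num.sqrt (1 - rel_sqr s ^+ 2 + n))
  (is_derive1_ln root1) droot.
have dden := is_derive_fun_comp (g := fun s => rel_sqr s + n)
  (is_derive1_ln (den_gt0 s)) (is_derive_funD dt (is_derive_cst n s 1)).
apply: is_derive_eq (is_derive_funB dnum dden) _.
rewrite -rootE//= expr1; have := lt0r_neq0 (root_gt0 s); have := lt0r_neq0 (den_gt0 s).
have : 1 + root s != 0 by rewrite gt_eqF// addr_gt0.
move: (root s) (rel_sqr s) => r t r1 tn r0; field.
by rewrite r1 r0 tn gt_eqF.
Qed.

Lemma slope_bound_arcosh_reg : slope_bound M arcosh_reg arcosh_reg_weight.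
Proof.
apply: (is_derive_slope_bound continuous_arcosh_reg_weight arcosh_reg_weight_ge0).
- apply/subspace_continuousP => s /=; rewrite in_itv/= -ler_norml => sM.
  by apply: cvg_within_filter; exact: is_derive_continuous (is_derive_arcosh_reg sM).
- by move=> s sM; apply: is_derive_arcosh_reg; rewrite ltW// ltr_norml.
- move=> s _; rewrite normrN !normrM (@ger0_norm _ (M ^+ 2)^-1) ?invr_ge0 ?sqr_ge0//.
  by rewrite (@ger0_norm _ 2)// (@ger0_norm _ (_ + _)).
Qed.

Let weight_core_le t (p := Num.sqrt (1 - t ^+ 2)) (r := Num.sqrt (1 - t ^+ 2 + n)) : 0 <= t <= 1 ->
  t * p * (t / (r * (1 + r)) + (t + n)^-1) <= 1.
Proof.
move=> /andP[t0 t1]; have t2 : 0 <= 1 - t ^+ 2 by rewrite subr_ge0 expr_le1.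
have p0 : 0 <= p by exact: sqrtr_ge0.
have r0 : 0 < r by rewrite sqrtr_gt0 ltr_wpDl.
have pr : p <= r by rewrite ler_wsqrtr// lerDl ltW.
have p2 : p ^+ 2 = 1 - t ^+ 2 by exact: sqr_sqrtr.
have fst_le : t * p * (t / (r * (1 + r))) <= 1 - p.
  have -> : t * p * (t / (r * (1 + r))) = t ^+ 2 * (p / r * (1 + r)^-1).
    by field; rewrite !gt_eqF// addr_gt0.
  have -> : 1 - p = t ^+ 2 * (1 * (1 + p)^-1).
    have -> : t ^+ 2 = 1 - p ^+ 2 by rewrite p2; ring.
    by field; rewrite gt_eqF// ltr_wpDr.
  rewrite ler_wpM2l ?sqr_ge0// ler_pM ?divr_ge0 ?invr_ge0 ?addr_ge0 ?(ltW r0)//.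
    by rewrite ler_pdivrMr// mul1r.
  by rewrite lef_pV2 ?posrE ?lerD2l// ltr_wpDr// ltW.
have snd_le : t * p * (t + n)^-1 <= p.
  by rewrite mulrAC ler_piMl// ler_pdivrMr ?ltr_wpDl// mul1r lerDl ltW.
by rewrite mulrDr; lra.
Qed.

Lemma arcosh_reg_weight_le s : `|s| <= M -> arcosh_reg_weight s * gn_weight M s <= 2 * M ^+ 2.
Proof.
move=> sM; have gapE : quartic_gap M s = M ^+ 2 * Num.sqrt (1 - rel_sqr s ^+ 2).
  rewrite -[M ^+ 2]ger0_norm ?sqr_ge0// -sqrtr_sqr -sqrtrM ?sqr_ge0//.
  by congr Num.sqrt; rewrite /rel_sqr; field; rewrite gt_eqF.
have s2 : `|s| ^+ 2 = rel_sqr s * M ^+ 2.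
  by rewrite real_normK ?num_real// divfK// expf_neq0// gt_eqF.
have t01 : 0 <= rel_sqr s <= 1 by rewrite rel_sqr_ge0 rel_sqr_le1.
have := weight_core_le t01; rewrite -rootE// /gn_weight gapE /arcosh_reg_weight.
move: (rel_sqr s / _ + _) (Num.sqrt _) => w p core.
have -> : 2 * `|s| / M ^+ 2 * w * (`|s| * (M ^+ 2 * p)) = 2 * (`|s| ^+ 2) * p * w.
  by field; rewrite gt_eqF.
rewrite s2; have -> : 2 * (rel_sqr s * M ^+ 2) * p * w = 2 * M ^+ 2 * (rel_sqr s * p * w) by ring.
by rewrite ger_pMr// mulr_gt0 ?exprn_gt0.
Qed.

End ArcoshRegularization.

Section EdgeProfile.
Context {R : realType}.
Notation mu := (@lebesgue_measure R).
Implicit Types (a b x y C n : R) (f : R -> R).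

Lemma Rintegral_itv_ae_le a b C f : a <= b -> 0 <= C ->
  mu.-integrable `[a, b] (EFin \o f) -> (forall x, a <= x <= b -> 0 <= f x) ->
  {ae mu, forall x, `[a, b]%classic x -> f x <= C} -> \int[mu]_(x in `[a, b]) f x <= C * (b - a).
Proof.
move=> ab C0 if_ f0 fC; have iC : mu.-integrable `[a, b] (EFin \o (fun=> C)).
  by apply: continuous_integrable_itv => x; exact: cvg_cst.
rewrite -Rintegral_itv_cst// fine_le//; [exact: integrable_fin_num|exact: integrable_fin_num|].
by apply: ae_ge0_le_integral => //; exact: measurable_int if_.
Qed.

Variables (l : option R) (u g : R -> R) (M c : R).
Hypotheses (H : H1_edge l u g) (M0 : 0 < M) (c0 : 0 <= c).
Hypothesis uM : forall x, edge_dom l x -> `|u x| <= M.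
Hypothesis grad : {ae mu, forall x, edge_dom l x -> `|g x| = c / 2 * gn_weight M (u x)}.

Lemma arcosh_reg_lipschitz n x y : 0 < n -> edge_dom l x -> edge_dom l y ->
  `|arcosh_reg M n (u x) - arcosh_reg M n (u y)| <= c * M ^+ 2 * `|x - y|.
Proof.
move=> n0; wlog xy : x y / x <= y.
  move=> W Dx Dy; have [/W|/ltW/W] := leP x y; first exact.
  by rewrite distrC (distrC x); exact.
move=> Dx Dy; have x0 := edge_dom_ge0 Dx; have sub := edge_dom_sub Dy x0.
rewrite distrC (distrC x) (@ger0_norm _ (y - x)) ?subr_ge0//.
have sb := slope_bound_arcosh_reg M0 n0; have up := H1_edge_weak_primitive H x0 Dy.
have uMxy z : x <= z <= y -> `|u z| <= M by move=> zxy; apply/uM/sub; rewrite /= in_itv.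
apply: (le_trans (chain_rule_le xy sb up uMxy)).
apply: (Rintegral_itv_ae_le xy _ (integrable_weighted_slope xy sb up)).
- by rewrite mulr_ge0// sqr_ge0.
- by move=> z _; rewrite mulr_ge0// arcosh_reg_weight_ge0.
apply: (filterS (F := almost_everywhere mu) _ grad) => z gz zxy; rewrite (gz (sub z zxy)) mulrCA.
have -> : c * M ^+ 2 = c / 2 * (2 * M ^+ 2) by field.
by rewrite ler_wpM2l ?divr_ge0// arcosh_reg_weight_le// uM//; exact: sub.
Qed.

End EdgeProfile.

Section OptimizerProfile.
Context {R : realType}.
Notation mu := (@lebesgue_measure R).

Lemma right_limit_le (f h : R -> R) : continuous f -> continuous h ->
  (forall n, 0 < n -> f n <= h n) -> f 0 <= h 0.
Proof.
move=> cf ch fh; have cvg0 (k : R -> R) : continuous k -> k n @[n --> (0 : R)^'+] --> k (0 : R).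
  by move=> ck; exact/cvg_at_right_filter/ck.
apply: (ler_cvg_to (cvg0 f cf) (cvg0 h ch)).
by near=> n; apply: fh; near: n; exact: nbhs_right_gt.
Unshelve. all: by end_near.
Qed.

Variables (G : mgraph R) (u g : 'I_(nE G) -> R -> R) (M c : R).
Hypotheses (H : H1 u g) (M0 : 0 < M) (c0 : 0 < c).
Hypothesis uM : forall p, in_dom p -> `|u p.1 p.2| <= M.
Hypothesis defect0 : gn_defect u g c M = 0.
Implicit Types (e : 'I_(nE G)) (p q : gpoint G) (d n : R).

Lemma gn_defect0_grad e :
  {ae mu, forall x, edge_dom (edge_len e) x -> `|g e x| = c / 2 * gn_weight M (u e x)}.
Proof.
have mD := measurable_edge_dom (edge_len e).
have [idens _] := gn_defect_edge H M0 uM c e.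
have dens_ge0 i : 0 <= \int[mu]_(x in edge_dom (edge_len i)) gn_defect_density u g c M i x.
  by apply: Rintegral_ge0 => x _; exact: sqr_ge0.
have dens0 : (\int[mu]_(x in edge_dom (edge_len e)) `|(gn_defect_density u g c M e x)%:E| = 0)%E.
  under eq_integral do rewrite gee0_abs ?lee_fin ?sqr_ge0//.
  move/eqP: defect0; rewrite psumr_eq0// => /allP/(_ e (mem_index_enum _))/eqP int0.
  by rewrite -[LHS]fineK ?integrable_fin_num//; congr EFin.
have := (ae_eq_integral_abs mu mD (measurable_int mu idens)).1 dens0.
apply: filterS => x /= dx Dx; have /eqP := dx Dx; rewrite eqe sqrf_eq0 subr_eq0 => /eqP gE.
by rewrite mulrAC -gE; field.
Qed.

Lemma sech_le_rel_sqr p q d : `|u p.1 p.2| = M -> in_dom q -> reach p q d ->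
  sech (c * M ^+ 2 * d) <= rel_sqr M (u q.1 q.2).
Proof.
move=> pM qd pq; set t := rel_sqr M _; have k0 : 0 < c * M ^+ 2 by rewrite mulr_gt0 ?exprn_gt0.
have t1 : t <= 1 by rewrite rel_sqr_le1 ?uM.
apply: sech_le_profile => //; set k := c * M ^+ 2 in k0 *.
have lipschitz n : 0 < n -> `|arcosh_reg M n (u p.1 p.2) - arcosh_reg M n (u q.1 q.2)| <= k * d.
  move=> n0; rewrite mulrC -ler_pdivrMr// -[X in _ / X]gtr0_norm// -normf_div mulrBl.
  apply: (reach_potential (h := fun p => arcosh_reg M n (u p.1 p.2) / k)) pq.
    move=> e x y; rewrite !in_domE -mulrBl normf_div (gtr0_norm k0) ler_pdivrMr// [leRHS]mulrC.
    apply: (arcosh_reg_lipschitz (H1_H1_edge e H) M0 (ltW c0) _ (gn_defect0_grad e) n0).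
    exact: edge_bound.
  by move=> a b ad bd ab; rewrite (H1_same_pt H ad bd ab).
pose lhs n := (1 + Num.sqrt (1 - t ^+ 2 + n)) * (1 + n).
pose rhs n := expR (k * d) * ((1 + Num.sqrt n) * (t + n)).
have : lhs 0 <= rhs 0; last first.
  by rewrite /lhs /rhs sqrtr0 !addr0 mulr1 mul1r.
have cadd a : continuous (fun n : R => a + n).
  by move=> n; apply: cvgD; [exact: cvg_cst|exact: cvg_id].
apply: right_limit_le => [n|n|n n0].
- apply: cvgM; last exact: cadd.
  apply: cvgD; first exact: cvg_cst.
  exact: (continuous_fun_comp (cadd (1 - t ^+ 2)) (@sqrt_continuous R)).
- apply: cvgM; first exact: cvg_cst.
  apply: cvgM; last exact: cadd.
  by apply: cvgD; [exact: cvg_cst|exact: sqrt_continuous].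
have := lipschitz n n0; rewrite distrC => /(le_trans (ler_norm _)).
rewrite /arcosh_reg -/t (rel_sqr_max M0 pM) expr1n subrr add0r.
have t0 : 0 <= t by exact: rel_sqr_ge0.
have [root_n root_t] : 0 < 1 + Num.sqrt n /\ 0 < 1 + Num.sqrt (1 - t ^+ 2 + n).
  by rewrite !ltr_wpDr ?sqrtr_ge0.
have [n1 tn] : 0 < 1 + n /\ 0 < t + n by rewrite addr_gt0// ltr_wpDl.
rewrite /lhs /rhs; move: (1 + Num.sqrt n) (1 + Num.sqrt (_ + n)) root_n root_t.
move: (1 + n) (t + n) n1 tn => x y x0 y0 a b a0 b0.
rewrite -!ln_div ?posrE ?divr_gt0// -(ler_expR (ln _)) lnK ?posrE ?divr_gt0//.
have -> : b / y / (a / x) = b * x / (a * y) by field; rewrite !gt_eqF.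
by rewrite ler_pdivrMr ?mulr_gt0.
Qed.

End OptimizerProfile.

Section ChartIntegral.
Context {R : realType}.
Notation mu := (@lebesgue_measure R).
Variables (G : mgraph R) (A : seq 'I_(nE G)) (f : gpoint G -> R).
Hypothesis cf : line_chart A f.
Implicit Types (e : 'I_(nE G)) (p : gpoint G) (F : R -> R) (x y I : R).

Lemma line_chart_dist e x y : e \in A -> `|f (e, x) - f (e, y)| = `|x - y|.
Proof.
move=> /(chart_affine cf)[k [c [k1 fE]]]; rewrite !fE (_ : _ - _ = k * (x - y)); last by ring.
by rewrite normrM k1 mul1r.
Qed.

Lemma line_chart_continuous e : e \in A -> continuous (fun x => f (e, x)).
Proof.
move=> /(chart_affine cf)[k [c [_ fE]]]; rewrite (_ : (fun x => _) = (fun x => k * x + c)).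
  exact: continuous_affine.
by apply/funext => x.
Qed.

Lemma integral_line_chart F I : continuous F -> (forall x, 0 <= F x) ->
  (\int[mu]_x (F x)%:E = I%:E)%E ->
  (forall e, e \in A -> mu.-integrable (edge_dom (edge_len e)) (EFin \o (fun x => F (f (e, x))))) /\
  \sum_(e in A) \int[mu]_(x in edge_dom (edge_len e)) F (f (e, x)) = I.
Proof.
move=> cF F0; have overE e x : e \in A -> interior_pt e x -> over A (e, x).
  by move=> eA xi; rewrite /over eA interior_in_dom.
apply: (change_of_variables_integrable (A := mem A) (l := @edge_len R G)
  (f := fun e x => f (e, x)) (Q := fun=> [::]) (P := map f (edge_ends G)) _ _ _ cF F0).
- by move=> e x eA _; exists 1 => // y z _ _; exact: line_chart_dist.
- move=> e e' x x' eA e'A; rewrite !punctured_nil => xi xi' ff.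
  have /same_ptP[[-> ->]//|[v]] := chart_inj cf (overE e x eA xi) (overE e' x' e'A xi') ff.
  by rewrite (vtx_of_interior xi).
- move=> t tn; have [//|[e x] /andP[xd eA] fx] := chart_onto cf (t := t).
  exists e, x; rewrite punctured_nil; split=> //; apply: vtx_of_eq_None xd _.
  case E : vtx_of => [v|//]; move: tn; rewrite -fx map_f//; exact: vtx_of_edge_ends E.
- move=> e eA; apply: measurable_funTS; apply: continuous_measurable_fun.
  exact: continuous_fun_comp (line_chart_continuous eA) cF.
Qed.

End ChartIntegral.

Lemma Rintegral_eq0_continuous (R : realType) (l : option R) (h : R -> R) (x : R) : pos_length l ->
  (forall y, edge_dom l y -> {within `[0, y], continuous h}) ->
  (forall y, edge_dom l y -> 0 <= h y) ->
  (@lebesgue_measure R).-integrable (edge_dom l) (EFin \o h) ->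
  \int[@lebesgue_measure R]_(y in edge_dom l) h y = 0 -> edge_dom l x -> h x = 0.
Proof.
move=> l0 ch h0 ih int0 Dx; apply/eqP; rewrite eq_le h0// andbT leNgt; apply/negP => hx.
have x0 := edge_dom_ge0 Dx.
have [X [DX X0 xX]] : exists X, [/\ edge_dom l X, 0 < X & x <= X].
  case: (l) l0 Dx => [b|] b0; rewrite edge_domE => /andP[_ xb].
    by exists b; rewrite edge_domE lexx andbT ltW.
  by exists (x + 1); rewrite edge_domE andbT addr_ge0// ltr_wpDl// lerDl.
have hx2 : 0 < h x / 2 by rewrite divr_gt0.
have [d d0 near_x] := (within_itv_continuousP 0 X h).1 (ch X DX) x _ (introT andP (conj x0 xX)) hx2.
pose a := Num.max 0 (x - d / 2); pose b := Num.min X (x + d / 2).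
have ab : a < b by rewrite lt_min !gt_max X0 /=; apply/and3P; split; lra.
have in_ab z : a <= z <= b -> [/\ 0 <= z <= X & `|z - x| < d].
  rewrite ge_max le_min => /andP[/andP[z0 zx] /andP[zX xz]]; rewrite z0 zX.
  by split=> //; rewrite ltr_norml; apply/andP; split; lra.
have [|/andP[a0 _] _] := in_ab a; first by rewrite lexx ltW.
have [|/andP[_ bX] _] := in_ab b; first by rewrite lexx ltW.
have sub : `[a, b] `<=` edge_dom l.
  by apply: edge_dom_sub => //; apply: (edge_dom_le DX) => //; exact: le_trans (ltW ab).
have : h x / 2 * (b - a) <= 0; last by rewrite leNgt mulr_gt0// subr_gt0.
rewrite -Rintegral_itv_cst ?(ltW ab)// -int0.
apply: le_trans (ge0_subset_Rintegral _ (measurable_edge_dom l) sub h0 ih) => //.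
apply: le_Rintegral => //.
- by apply: continuous_integrable_itv => z; exact: cvg_cst.
- by apply: integrableS ih => //; exact: measurable_edge_dom.
move=> z /=; rewrite in_itv/= => /in_ab[zX zd].
by have := near_x z zX zd; rewrite ltr_distl => /andP[? _]; lra.
Qed.

Section ChartIsometry.
Context {R : realType}.
Variables (G : mgraph R) (A : seq 'I_(nE G)) (f : gpoint G -> R).
Hypotheses (cf : line_chart A f) (allA : forall e, e \in A).
Hypothesis f_same : forall p q, in_dom p -> in_dom q -> same_pt p q -> `|f p| = `|f q|.
Implicit Types (p q : gpoint G) (x t : R).

Let overA p : in_dom p -> over A p.
Proof. by rewrite /over allA andbT. Qed.

Definition glue_points : seq R := undup [seq f p | p <- edge_ends G &
  (0 < f p) && has (fun q => same_pt p q && (f q == - f p)) (edge_ends G)].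

Let glue_pointsP x : reflect (exists p q, [/\ p \in edge_ends G, q \in edge_ends G, same_pt p q,
    f p = x & f q = - x /\ 0 < x]) (x \in glue_points).
Proof.
rewrite mem_undup; apply: (iffP mapP) => [[p]|[p [q [pe qe pq <- [fq x0]]]]].
  rewrite mem_filter => /andP[/andP[fp0 /hasP[q qe /andP[pq /eqP fq]]] pe] ->.
  by exists p, q.
exists p => //; rewrite mem_filter x0 pe /= andbT; apply/hasP; exists q => //.
by rewrite pq fq eqxx.
Qed.

Let glued_same_pt p q : in_dom p -> in_dom q -> glued glue_points (f p) (f q) -> same_pt p q.
Proof.
have inj a b : in_dom a -> in_dom b -> f a = f b -> same_pt a b.
  by move=> ad bd; exact: chart_inj cf _ _ (overA ad) (overA bd).
move=> pd qd /orP[/eqP|/hasP[x /glue_pointsP[a [b [/edge_ends_in_dom ad /edge_ends_in_dom bd]]]]].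
  exact: inj.
move=> ab fa [fb _] /orP[] /andP[/eqP fp /eqP fq].
  by apply: same_pt_trans (same_pt_trans _ ab) _; apply: inj; rewrite ?fp ?fq ?fa ?fb.
by apply: same_pt_trans (same_pt_trans _ (same_pt_sym ab)) _; apply: inj; rewrite ?fp ?fq ?fa ?fb.
Qed.

Let same_pt_glued p q : in_dom p -> in_dom q -> same_pt p q -> glued glue_points (f p) (f q).
Proof.
move=> pd qd /[dup] pq /same_ptP[->|[v /vtx_of_edge_ends pe /vtx_of_edge_ends qe]].
  by rewrite /glued eqxx.
have /eqP := f_same pd qd pq; rewrite eqr_norm2.
move=> /orP[/eqP->|/eqP fpq]; first by rewrite /glued eqxx.
have [fp0|fp0|fp0] := ltgtP (f p) 0.
- have fq_in : f q \in glue_points.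
    by apply/glue_pointsP; exists q, p; split=> //; [exact: same_pt_sym|split; lra].
  by apply/orP; right; apply/hasP; exists (f q) => //; rewrite fpq !eqxx orbT.
- have fp_in : f p \in glue_points by apply/glue_pointsP; exists p, q; split=> //; split; lra.
  by apply/orP; right; apply/hasP; exists (f p) => //; rewrite fpq opprK !eqxx.
- by rewrite /glued fp0 eq_sym -oppr_eq0 -fpq fp0 eqxx.
Qed.

Lemma reach_glue_reach p q c : reach p q c ->
  [/\ in_dom p, in_dom q & glue_reach glue_points (f p) (f q) c].
Proof.
have edge e x y : glue_reach glue_points (f (e, x)) (f (e, y)) `|x - y|.
  by rewrite -(line_chart_dist cf _ _ (allA e)); exact: glue_reach_step.
move: p q c; apply: chain_ind => [p q|p q q' r c].
  by move=> /edge_stepP[e [x [y [-> -> xd yd]]]].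
move=> /edge_stepP[e [x [y [-> -> xd yd]]]] yq _ [q'd rd IH]; split=> //.
by apply: (chain_cat (edge e x y) _ IH); exact: same_pt_glued.
Qed.

Lemma glue_reach_reach s t c : glue_reach glue_points s t c ->
  forall p q, in_dom p -> in_dom q -> f p = s -> f q = t -> reach p q c.
Proof.
move: s t c; apply: chain_ind => [s t _ p q pd qd <- <-|s t t' r c _ tt' _ IH p q pd qd <- fq].
  exact: chart_reach cf _ _ (overA pd) (overA qd).
have [//|a /andP[ad _] fa] := chart_onto cf (t := t).
have [//|b /andP[bd _] fb] := chart_onto cf (t := t').
apply: (reach_cat (q := a) (q' := b)); last exact: IH.
  by rewrite -fa; exact: chart_reach cf _ _ (overA pd) (overA ad).
by apply: glued_same_pt => //; rewrite fa fb.
Qed.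

Lemma glue_dist_chart p q : in_dom p -> in_dom q -> glue_dist glue_points (f p) (f q) = gdist p q.
Proof.
move=> pd qd; rewrite glue_distE gdistE; congr inf; apply/seteqP; split=> c /=.
  by move=> /glue_reach_reach; exact.
by case/reach_glue_reach.
Qed.

Lemma line_chart_isometric : is_R G \/ is_bubble_tower G.
Proof.
have onto t : exists p, in_dom p /\ f p = t.
  by have [//|p /andP[pd _] fp] := chart_onto cf (t := t); exists p.
have [no_glue|some_glue] := eqVneq glue_points [::].
  left; exists f; split=> [p q pd qd|t].
    by rewrite -glue_dist_chart// no_glue glue_dist_nil.
  by have [p [pd <-]] := onto t; exists p; rewrite subrr normr0.
right; exists glue_points; split=> //; first exact: undup_uniq.
  by apply/allP => x /glue_pointsP[p [q [_ _ _ _ []]]].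
exists f; split; first exact: glue_dist_chart.
by move=> t; have [p [pd <-]] := onto t; exists p; rewrite glue_distxx.
Qed.

End ChartIsometry.

Section Optimizer.
Context {R : realType}.
Notation mu := (@lebesgue_measure R).
Variables (G : mgraph R) (u g : 'I_(nE G) -> R -> R).
Hypotheses (cG : gconnected G) (HG : assumptionH G) (opt : gn_optimizer u g).
Implicit Types (e : 'I_(nE G)) (p q : gpoint G).

Let H : H1 u g. Proof. by case: opt. Qed.
Let m0 : 0 < normk 2 u. Proof. by case: opt. Qed.

Let c := pi / normk 2 u.

Lemma gn_optimizer_defect0 p : max_point u p -> gn_defect u g c `|u p.1 p.2| = 0.
Proof.
move=> pmax; apply/eqP; rewrite eq_le gn_defect_ge0 andbT.
apply: (le_trans (gn_defect_le H HG pmax m0)); case: opt => _ _ optE.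
by rewrite /c exprMn mulrAC exprVn optE le_eqVlt; apply/orP; left; apply/eqP; field; rewrite gt_eqF.
Qed.

Variables (A : seq 'I_(nE G)) (f : gpoint G -> R) (p0 : gpoint G).
Hypotheses (cf : line_chart A f) (p0A : over A p0) (p0max : max_point u p0) (fp0 : f p0 = 0).

Let M := `|u p0.1 p0.2|.
Let k := c * M ^+ 2.

Let M0 : 0 < M. Proof. exact: max_point_gt0 p0max m0. Qed.
Let c0 : 0 < c. Proof. by rewrite divr_gt0 ?pi_gt0. Qed.
Let k0 : 0 < k. Proof. by rewrite mulr_gt0 ?exprn_gt0. Qed.

Let sech_le q d : in_dom q -> reach p0 q d -> sech (k * d) <= rel_sqr M (u q.1 q.2).
Proof.
case: (p0max) => _ uM qd.
exact: sech_le_rel_sqr H M0 c0 uM (gn_optimizer_defect0 p0max) _ _ _ erefl qd.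
Qed.

Let rel_sqr_gt0 q : in_dom q -> 0 < rel_sqr M (u q.1 q.2).
Proof.
move=> qd; case: (p0max) => p0d _; have [d /(sech_le qd)] := gconnected_reach cG p0d qd.
exact/lt_le_trans/sech_gt0.
Qed.

Let sech_chart_le q : over A q -> sech (k * f q) <= rel_sqr M (u q.1 q.2).
Proof.
move=> qA; have := chart_reach cf p0A qA; rewrite fp0 sub0r normrN => /sech_le.
by rewrite -[X in X * `|_|](gtr0_norm k0) -normrM sech_norm; apply; case/andP: qA.
Qed.

Let excess e x := u e x ^+ 2 + - M ^+ 2 * sech (k * f (e, x)).

Let excess_eq0 e x : excess e x = 0 -> rel_sqr M (u e x) = sech (k * f (e, x)).
Proof.
rewrite /excess mulNr => /eqP; rewrite subr_eq0 /rel_sqr => /eqP->.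
by rewrite mulrAC divff ?mul1r// expf_neq0// gt_eqF.
Qed.

Let excess_ge0 e x : e \in A -> edge_dom (edge_len e) x -> 0 <= excess e x.
Proof.
move=> eA Dx; rewrite /excess mulNr subr_ge0 mulrC -ler_pdivlMr ?exprn_gt0//.
by apply: (sech_chart_le (q := (e, x))); rewrite /over eA andbT in_domE.
Qed.

Let continuous_sech_scale : continuous (fun x => sech (k * x)).
Proof. exact: continuous_fun_comp (@mulrl_continuous _ k) continuous_sech. Qed.

(* The trail carries at least the mass of the soliton, which is already the
   whole mass of u. *)
Let excess_sum : (forall e, e \in A -> mu.-integrable (edge_dom (edge_len e)) (EFin \o excess e)) /\
  \sum_(e in A) \int[mu]_(x in edge_dom (edge_len e)) excess e x +
  \sum_(e | e \notin A) \int[mu]_(x in edge_dom (edge_len e)) (u e x ^+ 2) = 0.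
Proof.
have [isech sech_sum] := integral_line_chart cf continuous_sech_scale
  (fun x => sech_ge0 (k * x)) (integral_sech k0).
have mD e := measurable_edge_dom (@edge_len R G e).
have iu e : mu.-integrable (edge_dom (edge_len e)) (EFin \o (fun x => u e x ^+ 2)).
  by case: (H1_H1_edge e H).
have isechM e : e \in A -> mu.-integrable (edge_dom (edge_len e))
    (EFin \o (fun x => - M ^+ 2 * sech (k * f (e, x)))).
  by move=> eA; apply: integrable_funZl => //; exact: isech.
split=> [e eA|]; first by apply: integrable_funD => //; exact: isechM.
have -> : \sum_(e in A) \int[mu]_(x in edge_dom (edge_len e)) excess e x =
    \sum_(e in A) \int[mu]_(x in edge_dom (edge_len e)) (u e x ^+ 2) - M ^+ 2 * (pi / k).
  rewrite -sech_sum mulr_sumr -sumrB; apply: eq_bigr => e eA.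
  rewrite RintegralD//; last exact: isechM.
  by rewrite RintegralZl ?mulNr//; exact: isech.
rewrite addrAC.
rewrite -(bigID (mem A) predT (fun e => \int[mu]_(x in edge_dom (edge_len e)) (u e x ^+ 2))) /=.
rewrite -/(graph_integral (fun e x => u e x ^+ 2)) -normk_even// /k /c.
have := lt0r_neq0 (pi_gt0 R); move: (pi : R) => p pn0.
by field; rewrite pn0 !gt_eqF.
Qed.

Let excess_integral0 e : (e \in A -> \int[mu]_(x in edge_dom (edge_len e)) excess e x = 0) /\
  (e \notin A -> \int[mu]_(x in edge_dom (edge_len e)) (u e x ^+ 2) = 0).
Proof.
have [_ /eqP] := excess_sum.
have int_ge0 i : i \in A -> 0 <= \int[mu]_(x in edge_dom (edge_len i)) excess i x.
  by move=> iA; apply: Rintegral_ge0 => x Dx; exact: excess_ge0.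
have sqr_int_ge0 i : 0 <= \int[mu]_(x in edge_dom (edge_len i)) (u i x ^+ 2).
  by apply: Rintegral_ge0 => x _; exact: sqr_ge0.
rewrite paddr_eq0 ?sumr_ge0// => /andP[]; rewrite !psumr_eq0//.
move=> /allP/(_ e (mem_index_enum _))/implyP eA /allP/(_ e (mem_index_enum _))/implyP eNA.
by split=> [/eA/eqP|/eNA/eqP].
Qed.

Let continuous_usqr e y : edge_dom (edge_len e) y ->
  {within `[0, y], continuous (fun x => u e x ^+ 2)}.
Proof.
move=> Dy x; apply: (@continuous_comp (subspace `[0, y]) _ _ (u e) (fun s => s ^+ 2)).
  exact: (H1_edge_continuous (H1_H1_edge e H) Dy).
exact: exprn_continuous.
Qed.

Lemma optimizer_chart_full e : e \in A.
Proof.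
apply: contraT => /(excess_integral0 e).2 int0; case: (H1_H1_edge e H) => iu _ _.
have := rel_sqr_gt0 (in_dom0 e).
have D0 : edge_dom (edge_len e) 0 by exact/edge_dom0/pos_edge_len.
by rewrite /rel_sqr /= (Rintegral_eq0_continuous (pos_edge_len e) (@continuous_usqr e)
  (fun x _ => sqr_ge0 (u e x)) iu int0 D0) mul0r ltxx.
Qed.

Lemma optimizer_profile q : in_dom q -> rel_sqr M (u q.1 q.2) = sech (k * f q).
Proof.
case: q => e x; rewrite in_domE /= => Dx; have eA := optimizer_chart_full e.
apply: excess_eq0; have int0 := (excess_integral0 e).1 eA.
apply: (Rintegral_eq0_continuous (pos_edge_len e) _ _ (excess_sum.1 e eA) int0 Dx) => [y Dy|y Dy].
  move=> z; apply: cvgD; first exact: continuous_usqr.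
  apply: cvgM; first exact: cvg_cst.
  have := continuous_fun_comp (line_chart_continuous cf eA) continuous_sech_scale.
  by move=> /continuous_subspaceT; exact.
exact: excess_ge0.
Qed.

Lemma optimizer_chart_same p q : in_dom p -> in_dom q -> same_pt p q -> `|f p| = `|f q|.
Proof.
move=> pd qd pq; apply: (mulfI (lt0r_neq0 k0)); rewrite -{1 2}(gtr0_norm k0) -!normrM.
by apply: sech_inj_norm; rewrite -!optimizer_profile// (H1_same_pt H pd qd pq).
Qed.

End Optimizer.

Lemma optimizer_structure (R : realType) (G : mgraph R) (u g : 'I_(nE G) -> R -> R) :
  gconnected G -> noncompact G -> assumptionH G -> gn_optimizer u g -> is_R G \/ is_bubble_tower G.
Proof.
move=> cG ncG HG opt; have [H _ _] := opt; have [p pmax] := H1_max_point ncG H.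
have [pd uM] := pmax; have [s0 [ss [tr onp]]] := HG p pd.
have [q [qd pq qin]] := on_trailP pd onp; have [f cf fq] := trail_chart q tr.
have qmax : max_point u q by split=> // r /uM; rewrite (H1_same_pt H pd qd pq).
have qA : over (map fst (s0 :: ss)) q by rewrite /over qd.
apply: (line_chart_isometric cf).
  exact: optimizer_chart_full cG HG opt _ _ _ cf qA qmax fq.
exact: optimizer_chart_same cG HG opt _ _ _ cf qA qmax fq.
Qed.

(** * Transplanting the soliton *)

Section IsometryToGluedLine.
Context {R : realType}.
Notation mu := (@lebesgue_measure R).
Variables (G : mgraph R) (f : gpoint G -> R) (xs : seq R).
Hypothesis cG : gconnected G.
Hypothesis f_dist : forall p q, in_dom p -> in_dom q -> glue_dist xs (f p) (f q) = gdist p q.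
Hypothesis f_onto : forall t, exists p, in_dom p /\ glue_dist xs (f p) t = 0.
Implicit Types (e : 'I_(nE G)) (p q : gpoint G) (F : R -> R) (x y t I : R).

Lemma isometry_norm p q : in_dom p -> in_dom q -> `| `|f p| - `|f q| | <= gdist p q.
Proof. by move=> pd qd; rewrite -f_dist//; exact: glue_dist_norm. Qed.

Lemma isometry_norm_same p q : in_dom p -> in_dom q -> same_pt p q -> `|f p| = `|f q|.
Proof.
move=> pd qd pq; apply/eqP; rewrite -subr_eq0 -normr_le0.
exact: le_trans (isometry_norm pd qd) (gdist_le (reach_same pd qd pq)).
Qed.

Lemma isometry_interior_inj e x q : interior_pt e x -> in_dom q -> f (e, x) = f q -> q = (e, x).
Proof.
move=> xi qd fq; apply: gdist_interior_eq0 => //.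
by rewrite -f_dist ?interior_in_dom// -fq glue_distxx.
Qed.

Lemma isometry_local_isom e x : interior_pt e x -> f (e, x) \notin xs -> - f (e, x) \notin xs ->
  local_isom (fun y => f (e, y)) x.
Proof.
move=> xi fx1 fx2; have [r r0 edge_isom] := gdist_interior_isometry cG xi.
have [r' r'0 line_isom] := glue_dist_isometry fx1 fx2.
have xx : `|x - x| < r by rewrite subrr normr0.
have near_fx y : `|y - x| < r -> `|y - x| < r' -> glue_dist xs (f (e, x)) (f (e, y)) < r'.
  by move=> yx; have [xd yd xy] := edge_isom x y xx yx; rewrite f_dist// xy distrC.
exists (Num.min r r') => [|y z]; first by rewrite lt_min r0.
rewrite !lt_min => /andP[yr yr'] /andP[zr zr']; have [yd zd yz] := edge_isom y z yr zr.
by rewrite -line_isom ?near_fx// f_dist.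
Qed.

(* The finitely many values where f may fail to be a local isometry. *)
Let fold_values : seq R := (xs ++ map -%R xs) ++ map f (edge_ends G).

Definition fold_points e : seq R :=
  [seq xget 0 [set x | interior_pt e x /\ f (e, x) = t] | t <- fold_values].

Let unfoldedP e x :
  punctured 0 (edge_len e) (fold_points e) x <-> interior_pt e x /\ f (e, x) \notin fold_values.
Proof.
rewrite puncturedE -/(interior_pt e x); split=> [/andP[xi xfold]|[xi fx]].
  split=> //; apply: contra xfold => fx; apply/mapP; exists (f (e, x)) => //.
  case: xgetP => [y _ /= [yi fy]|/(_ x)]; last by case.
  by have [] : (e, y) = (e, x) by apply: isometry_interior_inj => //; exact: interior_in_dom.
rewrite xi /=; apply/negP => /mapP[t tP]; case: xgetP => [y _ /= [yi fy] xy|_ x0].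
  by move: fx; rewrite xy fy tP.
by move: xi; rewrite /interior_pt in_open_itv x0 ltxx.
Qed.

Let fold_values_glue t : t \notin fold_values -> t \notin xs /\ - t \notin xs.
Proof.
rewrite !mem_cat !negb_or => /andP[/andP[-> tN] _]; split=> //.
by apply: contra tN => txs; apply/mapP; exists (- t); rewrite ?opprK.
Qed.

Lemma unfolded_local_isom e x : punctured 0 (edge_len e) (fold_points e) x ->
  local_isom (fun y => f (e, y)) x.
Proof. by move=> /unfoldedP[xi /fold_values_glue[fx1 fx2]]; exact: isometry_local_isom. Qed.

Let unfolded_inj e e' x x' : punctured 0 (edge_len e) (fold_points e) x ->
  punctured 0 (edge_len e') (fold_points e') x' -> f (e, x) = f (e', x') -> e = e' /\ x = x'.
Proof.
by move=> /unfoldedP[xi _] /unfoldedP[xi' _] /(isometry_interior_inj xi (interior_in_dom xi')) [].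
Qed.

Let unfolded_onto t : t \notin fold_values ->
  exists e x, punctured 0 (edge_len e) (fold_points e) x /\ f (e, x) = t.
Proof.
move=> tP; have [t1 t2] := fold_values_glue tP; have [[e x] [xd]] := f_onto t.
rewrite glue_dist_sym => /(glue_dist_eq0_unglued t1 t2) fx.
exists e, x; split=> //; apply/unfoldedP; rewrite fx; split=> //; apply: vtx_of_eq_None xd _.
case E : vtx_of => [v|//]; move: tP; rewrite !mem_cat -fx map_f ?orbT//.
exact: vtx_of_edge_ends E.
Qed.

Let evenE F : (forall t, F (- t) = F t) -> forall t, F t = F `|t|.
Proof. by move=> FN t; case: (ger0P t) => // _; rewrite FN. Qed.

Lemma isometry_even_continuous e F y : continuous F -> (forall t, F (- t) = F t) ->
  edge_dom (edge_len e) y -> {within `[0, y], continuous (fun x => F (f (e, x)))}.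
Proof.
move=> cF FN yd; rewrite (_ : (fun x => _) = F \o (fun x => `|f (e, x)|)); last first.
  by apply/funext => x /=; exact: evenE.
have cnorm : {within `[0, y], continuous (fun x => `|f (e, x)|)}.
  apply/within_itv_continuousP => x d xy d0; exists d => // z zy zx; apply: le_lt_trans zx.
  have dom w : 0 <= w <= y -> in_dom (e, w).
    by rewrite in_domE => /andP[w0 wy]; exact: edge_dom_le yd w0 wy.
  exact: le_trans (isometry_norm (dom z zy) (dom x xy)) (gdist_edge_le (dom z zy) (dom x xy)).
move=> x; apply: (@continuous_comp (subspace `[0, y]) _ _ (fun x => `|f (e, x)|) F).
  exact: cnorm.
exact: cF.
Qed.

Lemma isometry_even_measurable e F : continuous F -> (forall t, F (- t) = F t) ->
  measurable_fun (edge_dom (edge_len e)) (fun x => F (f (e, x))).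
Proof.
move=> cF FN; apply: measurable_fun_edge_dom => y Dy.
by apply: subspace_continuous_measurable_fun => //; exact: isometry_even_continuous.
Qed.

Lemma isometry_even_integral F I : continuous F -> (forall t, F (- t) = F t) ->
  (forall t, 0 <= F t) -> (\int[mu]_x (F x)%:E = I%:E)%E ->
  (forall e, mu.-integrable (edge_dom (edge_len e)) (EFin \o (fun x => F (f (e, x))))) /\
  graph_integral (fun e x => F (f (e, x))) = I.
Proof.
move=> cF FN F0 FI.
have [||t /unfolded_onto[e [x [xp fx]]]||i sumI] := @change_of_variables_integrable R _ predT
  (@edge_len R G) (fun e x => f (e, x)) fold_points fold_values _ _ _ F I cF F0 _ FI.
- by move=> e x _; exact: unfolded_local_isom.
- by move=> e e' x x' _ _; exact: unfolded_inj.
- by exists e, x.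
- by move=> e _; exact: isometry_even_measurable.
by split=> // e; exact: i.
Qed.

End IsometryToGluedLine.

Section TransplantedSoliton.
Context {R : realType}.
Notation mu := (@lebesgue_measure R).
Variables (G : mgraph R) (f : gpoint G -> R) (xs : seq R).
Hypothesis cG : gconnected G.
Hypothesis f_dist : forall p q, in_dom p -> in_dom q -> glue_dist xs (f p) (f q) = gdist p q.
Hypothesis f_onto : forall t, exists p, in_dom p /\ glue_dist xs (f p) t = 0.
Implicit Types (e : 'I_(nE G)) (p q : gpoint G) (x y : R).

Let unfolded e := punctured 0 (edge_len e) (fold_points f xs e).

Let u e x := soliton (f (e, x)).
Let g e := (fun x => derive1 (fun y => f (e, y)) x * dsoliton (f (e, x))) \_ (unfolded e).

Let gE e x : unfolded e x -> g e x = derive1 (fun y => f (e, y)) x * dsoliton (f (e, x)).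
Proof. by move=> xu; rewrite /g patchT ?inE. Qed.

Let unfolded_slope e x : unfolded e x -> `|derive1 (fun y => f (e, y)) x| = 1.
Proof. by move=> /(unfolded_local_isom cG f_dist) /local_isom_affine[d []]. Qed.

Let g_sqr e x : unfolded e x -> g e x ^+ 2 = dsoliton (f (e, x)) ^+ 2.
Proof.
move=> xu; rewrite gE// exprMn -[X in X * _](real_normK (num_real _)).
by rewrite unfolded_slope// expr1n mul1r.
Qed.

Let g_le1 e x : `|g e x| <= 1.
Proof.
rewrite /g patchE; case: ifPn => [|_]; last by rewrite normr0.
rewrite inE => xu; rewrite normrM unfolded_slope// mul1r /dsoliton.
rewrite normrM normrN normfV normr_nat normrM (gtr0_norm (soliton_gt0 _)).
have : soliton (f (e, x)) * `|tanh (f (e, x))| <= 1.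
  by rewrite mulr_ile1 ?soliton_le1 ?tanh_le1 ?normr_ge0// ltW// soliton_gt0.
by lra.
Qed.

Let measurable_g e : measurable_fun [set: measurableTypeR R] (g e).
Proof.
have [mf mdf] := punctured_measurable_fun (unfolded_local_isom cG f_dist (e := e)).
apply/(measurable_restrict _ (measurable_punctured _ _ _) measurableT); rewrite setTI.
apply: measurable_funM => //; apply: (measurableT_comp (f := @dsoliton R)) => //.
by apply: continuous_measurable_fun; exact: continuous_dsoliton.
Qed.

Let dsoliton_sqr_even (t : R) : dsoliton (- t) ^+ 2 = dsoliton t ^+ 2.
Proof. by rewrite !dsoliton_sqr sechN. Qed.

Let integral_u_sqr :
  (forall e, mu.-integrable (edge_dom (edge_len e)) (EFin \o (fun x => u e x ^+ 2))) /\
  normk 2 u = pi.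
Proof.
rewrite normk_even//.
apply: (isometry_even_integral cG f_dist f_onto (F := fun t => soliton t ^+ 2)).
- exact: continuous_funX continuous_soliton.
- by move=> t; rewrite solitonN.
- by move=> t; exact: sqr_ge0.
- exact: integral_soliton_sqr.
Qed.

Let normk6_u : normk 6 u = pi / 2.
Proof.
rewrite normk_even//.
apply: (isometry_even_integral cG f_dist f_onto (F := fun t => soliton t ^+ 6) _ _ _ _).2.
- exact: continuous_funX continuous_soliton.
- by move=> t; rewrite solitonN.
- by move=> t; rewrite exprn_ge0// ltW// soliton_gt0.
- exact: integral_soliton_exp6.
Qed.

Let integral_g_sqr :
  (forall e, mu.-integrable (edge_dom (edge_len e)) (EFin \o (fun x => g e x ^+ 2))) /\
  normk 2 g = pi / 8.
Proof.
have cds : continuous (fun t : R => dsoliton t ^+ 2) by exact: continuous_funX continuous_dsoliton.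
have [ids ds_sum] := isometry_even_integral cG f_dist f_onto cds dsoliton_sqr_even
  (fun t => sqr_ge0 (dsoliton t)) integral_dsoliton_sqr.
have mg e : measurable_fun (edge_dom (edge_len e)) (fun x => g e x ^+ 2).
  by apply: measurable_funX; exact: measurable_funTS (measurable_g e).
split=> [e|].
  apply: (le_integrable (measurable_edge_dom _) _ _ (ids e)); first exact/measurable_EFinP.
  move=> x _ /=; rewrite lee_fin !ger0_norm ?sqr_ge0//.
  have [xu|xu] := pselect (unfolded e x); first by rewrite g_sqr.
  by rewrite /g patchC ?inE// expr0n sqr_ge0.
rewrite normk_even// -ds_sum; apply: eq_bigr => e _; congr fine.
rewrite !(integral_edge_punctured (fold_points f xs e)) => [||x||x]; rewrite ?lee_fin ?sqr_ge0//.
- by apply: eq_integral => x; rewrite inE => xu; rewrite g_sqr.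
- by apply/measurable_EFinP; exact: (isometry_even_measurable f_dist cds dsoliton_sqr_even).
- exact/measurable_EFinP.
Qed.

Let weak_primitive_u e y : edge_dom (edge_len e) y -> weak_primitive 0 y (u e) (g e).
Proof.
move=> Dy; have ig x : mu.-integrable `[0, x] (EFin \o g e).
  apply: (@le_integrable _ _ _ mu _ _ _ (EFin \o (fun=> 1 : R))) => //.
  - by apply/measurable_EFinP; exact: measurable_funTS (measurable_g e).
  - by move=> z _ /=; rewrite lee_fin normr1 g_le1.
  - by apply: continuous_integrable_itv => z; exact: cvg_cst.
split=> // x /andP[]; rewrite le_eqVlt => /predU1P[<- _|x0 xy].
  by rewrite set_itv1 /Rintegral integral_set1 addr0.
have Dx := edge_dom_le Dy (ltW x0) xy.
have sub z : punctured 0 (Some x) (fold_points f xs e) z -> unfolded e z.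
  rewrite /unfolded !puncturedE !in_open_itv => /andP[/andP[-> zx] ->]; rewrite andbT /=.
  by move: Dx; rewrite edge_domE => /andP[_]; case: (edge_len e) => // l; exact: lt_le_trans.
have : u e x - u e 0 = \int[mu]_(z in `[0, x]) g e z; last by move=> <-; rewrite addrC subrK.
apply: (piecewise_primitive (f := fun x => f (e, x)) is_derive_soliton (@continuous_dsoliton R) x0
  (fun z zu => unfolded_local_isom cG f_dist (sub z zu)) _ (ig x) (fun z zu => gE (sub z zu))).
exact: (isometry_even_continuous f_dist (@continuous_soliton R) (@solitonN R) Dx).
Qed.

Lemma transplanted_soliton_optimizer : exists u g, @gn_optimizer R G u g.
Proof.
have [iu u2] := integral_u_sqr; have [ig g2] := integral_g_sqr.
exists u, g; split; last first.
- rewrite u2 normk6_u g2; move: (pi : R) => q; by field.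
- by rewrite u2 pi_gt0.
apply/H1P; split=> [e|]; first by split; [exact: iu|exact: ig|exact: weak_primitive_u].
apply/vertex_valuesP => -[e x] [e' x'] pd qd pq /=.
have solitonE (t : R) : soliton t = soliton `|t| by case: (ger0P t) => // _; rewrite solitonN.
by rewrite /u solitonE (isometry_norm_same f_dist pd qd pq) -solitonE.
Qed.

End TransplantedSoliton.

Theorem theorem7p2 (R : realType) (G : mgraph R) :
  gconnected G -> noncompact G -> assumptionH G ->
  [/\ mucrit G = mucrit (Rline R),
      Elevel G (mucrit (Rline R)) = 0%E &
      (attained G (mucrit (Rline R)) <-> is_R G \/ is_bubble_tower G)].
Proof.
move=> cG ncG HG; rewrite !(mucritE (@noncompact_Rline R) (@assumptionH_Rline R)).
split; [exact: mucritE|exact: Elevel_crit|rewrite (attained_crit ncG HG)].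
split=> [[u [g]]|structure]; first exact: optimizer_structure.
have [xs [f [f_dist f_onto]]] : exists xs : seq R, isometric_to G (glue_dist xs).
  case: structure => [[f [f_dist f_onto]]|[xs [_ _ _ isom]]]; last by exists xs.
  exists [::], f; split=> [p q pd qd|t]; first by rewrite glue_dist_nil f_dist.
  by have [p [pd ft]] := f_onto t; exists p; rewrite glue_dist_nil.
exact: transplanted_soliton_optimizer cG f_dist f_onto.
Qed.
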